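(* There exist a constant $c$ and a single tile system, consisting of a tile set $T$ with $|T| = O(1)$, a seed tile $s\in T$ and a glue function $G$, such that for every integer $n \geq 22$ there exists a temperature sequence $\{\tau_i\}_{i=1}^{k}$ with $k = O(\log n)$ and all $\tau_i \le c$, such that $(T,s,G)$ with temperature sequence $\{\tau_i\}_{i=1}^{k}$ uniquely assembles an $n\times n$ square in the multiple temperature model.
   Context: Tile self-assembly model: a tile is a Wang tile given by a quadruple (north, east, south, west) of glue types from an alphabet $\Sigma$ containing a special glue $\mathtt{null}$. A glue function $G:\Sigma^2\to\mathbb{Z}_{\ge 0}$ is symmetric, with $G(\mathtt{null},x)=0$ for all $x$ and $G(x,y)=0$ whenever $x\ne y$. A configuration is a map from $\mathbb{Z}^2$ to $T\cup\{\mathtt{empty}\}$ ($\mathtt{empty}$ has $\mathtt{null}$ on all sides); its shape is the set of non-empty positions. A tile $t$ is attachable at an empty position $(i,j)$ at temperature $\tau$ if the sum of $G$ applied to the glues of $t$ and the abutting glues of the neighbouring tiles at $(i,j\pm1),(i\pm1,j)$ is at least $\tau$. A supertile is a configuration whose adjacency graph (non-empty positions, edges between positions at Manhattan distance 1) is finite and connected; a cut of a supertile is a cut of this graph, and its strength is the sum over cut edges of the glue strength between the abutting edges. Multiple temperature model: assembly starts from the seed tile $s$ at $(0,0)$ and proceeds in $k$ phases for the temperature sequence $\tau_1,\dots,\tau_k$ (positive integers; $k$ is the temperature complexity). In phase 1, tiles attachable at temperature $\tau_1$ are added until none can be added. In phase $i\ge2$, at any time, any tile attachable at temperature $\tau_i$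 may be added, and if some cut of the current supertile has strength less than $\tau_i$, the part on the side not containing the seed may be removed; the phase continues until no tile can be added or removed. The system uniquely assembles a shape $\Upsilon$ if, for every choice of additions and removals, all $k$ phases terminate and the final supertile is always the same supertile $R$, whose shape is $\Upsilon$. The temperature range (maximum temperature) is required to be bounded by a constant. *)

(* Defs.v *)
From Stdlib Require Import Relation_Operators.
From mathcomp Require Import all_boot all_order all_algebra finmap.

Set Implicit Arguments.
Unset Strict Implicit.
Unset Printing Implicit Defensive.

Import Order.TTheory GRing.Theory Num.Theory.

Notation tile Sigma := (Sigma * Sigma * Sigma * Sigma)%type.

Definition north (Sigma : Type) (t : tile Sigma) : Sigma := t.1.1.1.
Definition east (Sigma : Type) (t : tile Sigma) : Sigma := t.1.1.2.
Definition south (Sigma : Type) (t : tile Sigma) : Sigma := t.1.2.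
Definition west (Sigma : Type) (t : tile Sigma) : Sigma := t.2.

(* The temperatures are not part of a tile system: one system is run under many
   temperature sequences. *)
Record tile_system := TileSystem {
  glue : finType;
  null : glue;
  tiles : {set tile glue};
  seed : tile glue;
  strength : glue -> glue -> nat;
  seed_tiles : seed \in tiles;
  strength_sym : forall x y, strength x y = strength y x;
  strength_null : forall x, strength null x = 0;
  strength_neq : forall x y, x != y -> strength x y = 0
}.

Definition pos : Type := (int * int)%type.

Section Model.

Variable ts : tile_system.

(* [None] is the empty cell. *)
Definition config := pos -> option (tile (glue ts)).

Definition empty_tile : tile (glue ts) := (null ts, null ts, null ts, null ts).

Definition tile_at (A : config) (p : pos) : tile (glue ts) :=
  odflt empty_tile (A p).

Definition shape (A : config) : pred pos := fun p => A p != None.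

Definition adjacent (p q : pos) : bool :=
  (`|p.1 - q.1| + `|p.2 - q.2| == 1)%R.

Definition adjacency (A : config) : rel pos :=
  fun p q => [&& shape A p, shape A q & adjacent p q].

Definition supertile (A : config) : Prop :=
  (exists D : {fset pos}, forall p, shape A p = (p \in D)) /\
  (forall p q, shape A p -> shape A q ->
     exists2 s : seq pos, path (adjacency A) p s & last p s = q).

Definition attach_strength (A : config) (p : pos) (t : tile (glue ts)) : nat :=
  strength (north t) (south (tile_at A (p.1, p.2 + 1)%R))
  + strength (east t) (west (tile_at A (p.1 + 1, p.2)%R))
  + strength (south t) (north (tile_at A (p.1, p.2 - 1)%R))
  + strength (west t) (east (tile_at A (p.1 - 1, p.2)%R)).

Definition attachable (tau : nat) (A : config) (p : pos) (t : tile (glue ts)) :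
    bool :=
  [&& t \in tiles ts, ~~ shape A p & tau <= attach_strength A p t].

(* Glue strength between the abutting edges of the cells p and q, and 0 when p
   and q are not neighbours. *)
Definition bond (A : config) (p q : pos) : nat :=
  if q == (p.1, p.2 + 1)%R then
    strength (north (tile_at A p)) (south (tile_at A q))
  else if q == (p.1 + 1, p.2)%R then
    strength (east (tile_at A p)) (west (tile_at A q))
  else if q == (p.1, p.2 - 1)%R then
    strength (south (tile_at A p)) (north (tile_at A q))
  else if q == (p.1 - 1, p.2)%R then
    strength (west (tile_at A p)) (east (tile_at A q))
  else 0.

Definition is_cut (A : config) (S F : {fset pos}) : Prop :=
  [/\ S != fset0, F != fset0, [disjoint S & F]%fset &
      forall p, shape A p = (p \in (S `|` F)%fset)].

Definition cut_strength (A : config) (S F : {fset pos}) : nat :=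
  \sum_(p <- S) \sum_(q <- F) bond A p q.

Definition origin : pos := (0, 0)%R.

Definition seed_config : config :=
  fun p => if p == origin then Some (seed ts) else None.

Definition place (A : config) (p : pos) (t : tile (glue ts)) : config :=
  fun q => if q == p then Some t else A q.

Definition restrict (A : config) (S : {fset pos}) : config :=
  fun q => if q \in S then A q else None.

Definition addition (tau : nat) (A B : config) : Prop :=
  exists p t, attachable tau A p t /\ B = place A p t.

(* S is the side of the cut containing the seed, which always occupies the
   origin. What remains must again be a supertile: if the seed side S of a weak
   cut is disconnected, then the components of S away from the seed are removed
   too, since the seed's component of S against all the rest is a cut that is at
   most as strong. *)
Definition removal (tau : nat) (A B : config) : Prop :=
  exists S F : {fset pos},
    [/\ is_cut A S F, origin \in S, cut_strength A S F < tau,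
        B = restrict A S & supertile B].

(* Phases are numbered from 0; there is no removal in the initial phase. *)
Definition step (i tau : nat) (A B : config) : Prop :=
  addition tau A B \/ (0 < i /\ removal tau A B).

Definition terminal (i tau : nat) (A : config) : Prop :=
  forall B, ~ step i tau A B.

Definition phase_terminates (i tau : nat) (A : config) : Prop :=
  ~ exists run : nat -> config,
      run 0 = A /\ forall m, step i tau (run m) (run m.+1).

(* [outcome taus i A]: A is a possible result of the first i phases. *)
Fixpoint outcome (taus : seq nat) (i : nat) (A : config) : Prop :=
  match i with
  | 0 => A = seed_config
  | j.+1 => exists B : config,
      [/\ outcome taus j B,
          clos_refl_trans config (step j (nth 0 taus j)) B A &
          terminal j (nth 0 taus j) A]
  end.

Definition uniquely_assembles (taus : seq nat) (Y : pred pos) : Prop :=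
  (forall i A, i < size taus -> outcome taus i A ->
     phase_terminates i (nth 0 taus i) A) /\
  exists R : config,
    [/\ supertile R, forall A, outcome taus (size taus) A <-> A = R &
        shape R =1 Y].

End Model.

Definition square (n : nat) (o : pos) : pred pos :=
  fun p => ((o.1 <= p.1 < o.1 + n%:Z) && (o.2 <= p.2 < o.2 + n%:Z))%R.

(* Main.v *)
From HB Require Import structures.
From Stdlib Require Import Relation_Operators Operators_Properties.
From Stdlib Require Import Classical FunctionalExtensionality.
From mathcomp Require Import all_boot all_order all_algebra finmap zify.
Require Import Defs.

Set Implicit Arguments.
Unset Strict Implicit.
Unset Printing Implicit Defensive.

(** A cell is made programmable as follows. A weakly bound tile occupies it and
    triggers a growth that runs around the cell, gets anchored elsewhere and
    comes back to another side of the cell. When the temperature rises, the weak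
    tile falls off and is replaced by a tile held by that other side, which could
    not have been attached earlier. Two such cells wait at the tip of a strip:
    temperature 11 replaces the tile of one of them only, temperature 12 those of
    both. Back at temperature 8, the new tile of the first cell starts the next
    unit of the strip, which reads and locks the second cell; so a bit costs two
    phases. Finally temperature 7, lower than all the previous ones, starts a
    zigzag binary counter on top of the strip, whose height is prescribed by the
    bits (one of them gives the parity), and two diagonals, to the east and to
    the south, complete the rectangle to a square.

    Cooperative glues have strength 6: one never suffices, two always do, hence
    everything but the waiting tiles is stable at temperature 12. That a growth
    phase has a unique result reduces to a local condition on the neighbourhood
    of each cell, verified by computation. *)

(** * Cuts and phases *)

(** The temperature has to serve both as clock and as datum: a pulse must advance the strip by one
    unit whatever the bit, and still record the bit. Hence two cells per unit. The one held by 8 + 2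
    gives way at 11 and at 12 and acts as the clock; the one held by 8 + 3 gives way at 12 only and
    carries the bit. A glue of strength 8 alone is too weak during a pulse, so growth resumes only
    afterwards. Uniqueness of growth rests on an order of attachment. Each tile has designated sides
    through which it arrives; a neighbour that arrives through a cell cannot be present while that
    cell is empty, and is ignored when judging what the cell may receive. With [k] counter bits, [N]
    increments up to overflow and parity bit [pb], the side of the square is the width [5k + 10] of
    the strip plus the height [2N + pb] of the counter. Since [0 < N <= 2^k], the sides from
    [5k + 12] to [5k + 11 + 2^(k+1)] are covered. From [k = 2] on these intervals leave no gap, and
    the first one starts at 22; 21 is missed, as [k = 1] stops at 20. *)

Inductive dir := dN | dE | dS | dW.

Definition opp d := match d with dN => dS | dE => dW | dS => dN | dW => dE end.

Definition eqd d d' :=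
  match d, d' with
  | dN, dN | dE, dE | dS, dS | dW, dW => true
  | _, _ => false
  end.

Definition nbr (p : pos) d : pos :=
  match d with
  | dN => (p.1, p.2 + 1)%R
  | dE => (p.1 + 1, p.2)%R
  | dS => (p.1, p.2 - 1)%R
  | dW => (p.1 - 1, p.2)%R
  end.

Definition side (G : Type) (t : tile G) d :=
  match d with dN => north t | dE => east t | dS => south t | dW => west t end.

Definition sum4 (f : dir -> nat) := f dN + f dE + f dS + f dW.

Lemma leq_sum4 f g : (forall d, f d <= g d) -> sum4 f <= sum4 g.
Proof. by move=> fg; rewrite /sum4 !leq_add. Qed.

Lemma oppK d : opp (opp d) = d. Proof. by case: d. Qed.

Lemma nbrK p d : nbr (nbr p d) (opp d) = p.
Proof. by case: p => x y; case: d; congr pair => /=; lia. Qed.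

Lemma nbr_neq p d : (nbr p d == p) = false.
Proof. by case: p => x y; case: d; rewrite /= xpair_eqE; lia. Qed.

Lemma nbr_inj p d d' : nbr p d = nbr p d' -> d = d'.
Proof. by case: p => x y; case: d; case: d' => //= -[]; lia. Qed.

Lemma uniq_nbrs p : uniq [seq nbr p d | d <- [:: dN; dE; dS; dW]].
Proof. by case: p => x y; rewrite /= !inE !xpair_eqE; lia. Qed.

Lemma adjacentP p q : reflect (exists d, q = nbr p d) (adjacent p q).
Proof.
apply: (iffP idP); last first.
  by case=> d ->; case: p => x y; case: d; rewrite /adjacent /=; lia.
case: p q => x y [x' y']; rewrite /adjacent /= => h.
have : [\/ x' = x /\ y' = (y + 1)%R, x' = (x + 1)%R /\ y' = y,
    x' = x /\ y' = (y - 1)%R | x' = (x - 1)%R /\ y' = y].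
  have : (x' = x /\ y' = (y + 1)%R \/ x' = (x + 1)%R /\ y' = y)
    \/ (x' = x /\ y' = (y - 1)%R \/ x' = (x - 1)%R /\ y' = y) by lia.
  by case=> -[] ?; [constructor 1|constructor 2|constructor 3|constructor 4].
case.
- by case=> -> ->; exists dN.
- by case=> -> ->; exists dE.
- by case=> -> ->; exists dS.
- by case=> -> ->; exists dW.
Qed.

Lemma leq_sum_uniq (I : eqType) (s s' : seq I) (f : I -> nat) :
  uniq s -> uniq s' -> {subset s <= s'} -> \sum_(i <- s) f i <= \sum_(i <- s') f i.
Proof. by move=> us us' ss; apply: uniq_sub_le_big => // x y; apply: leq_addr. Qed.

(** * Bonds and cuts of a configuration *)

Section ModelTheory.

Variable ts : tile_system.
Implicit Types (A B C Z : config ts) (p q : pos) (t : tile (glue ts)).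
Implicit Types (S F : {fset pos}).

Lemma strength_nullr x : strength x (null ts) = 0.
Proof. by rewrite strength_sym strength_null. Qed.

Lemma side_empty d : side (empty_tile ts) d = null ts.
Proof. by case: d. Qed.

Definition pull A p t d := strength (side t d) (side (tile_at A (nbr p d)) (opp d)).

Lemma attach_strengthE A p t : attach_strength A p t = sum4 (pull A p t).
Proof. by []. Qed.

Lemma bond_nbr A p d : bond A p (nbr p d) = pull A p (tile_at A p) d.
Proof.
rewrite /bond /pull; have n d' : nbr p d == nbr p d' = eqd d d'.
  by apply/eqP/idP => [/nbr_inj <-|]; case: d; case: d'.
by rewrite (n dN) (n dE) (n dS) (n dW); case: d {n}.
Qed.

Lemma bond_adjacent A p q : ~~ adjacent p q -> bond A p q = 0.
Proof.
move=> /adjacentP h; rewrite /bond.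
have n d : q == nbr p d = false by apply/negP => /eqP e; case: h; exists d.
by rewrite (n dN) (n dE) (n dS) (n dW).
Qed.

Lemma adjacentC p q : adjacent p q = adjacent q p.
Proof. by case: p q => x y [x' y']; rewrite /adjacent /=; lia. Qed.

Lemma bondC A p q : bond A p q = bond A q p.
Proof.
have [/adjacentP [d ->]|n] := boolP (adjacent p q); last first.
  by rewrite !bond_adjacent // adjacentC.
have := bond_nbr A (nbr p d) (opp d); rewrite nbrK => ->.
by rewrite bond_nbr /pull nbrK oppK strength_sym.
Qed.

Lemma tile_at_None A p : A p = None -> tile_at A p = empty_tile ts.
Proof. by rewrite /tile_at => ->. Qed.

Lemma pull_None A p t d : A (nbr p d) = None -> pull A p t d = 0.
Proof. by move=> h; rewrite /pull tile_at_None // side_empty strength_nullr. Qed.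

Lemma bond_shape A p q : 0 < bond A p q -> [/\ shape A p, shape A q & adjacent p q].
Proof.
move=> h; have [/adjacentP [d e]|n] := boolP (adjacent p q); last first.
  by rewrite bond_adjacent in h.
rewrite e in h *; split.
- rewrite /shape; apply/eqP => n.
  have := bond_nbr A (nbr p d) (opp d); rewrite nbrK bondC pull_None ?nbrK // => h0.
  by rewrite h0 in h.
- rewrite bond_nbr in h; rewrite /shape; apply/eqP => n.
  by rewrite pull_None in h.
- by [].
Qed.

Lemma eq_bond A B p q : A p = B p -> A q = B q -> bond A p q = bond B p q.
Proof. by rewrite /bond /tile_at => -> ->. Qed.

(** Lower bounds on cuts always come from exhibiting a few distinct crossing pairs; the other terms
    of the double sum are non-negative. *)
Lemma cut_ge_pairs A S F (l : seq (pos * pos)) :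
  uniq l -> all (fun pq => (pq.1 \in S) && (pq.2 \in F)) l ->
  \sum_(pq <- l) bond A pq.1 pq.2 <= cut_strength A S F.
Proof.
move=> ul /allP lSF.
have -> : cut_strength A S F =
    \sum_(pq <- [seq (p, q) | p <- enum_fset S, q <- enum_fset F])
      bond A pq.1 pq.2 by rewrite big_allpairs.
apply: leq_sum_uniq => //.
- by apply: allpairs_uniq; rewrite ?fset_uniq // => -[? ?] [? ?].
by case=> p q /lSF /= /andP[pS qF]; apply/allpairsP; exists (p, q).
Qed.

Lemma cut_ge1 A S F p q : p \in S -> q \in F -> bond A p q <= cut_strength A S F.
Proof.
by move=> pS qF; have := @cut_ge_pairs A S F [:: (p, q)] erefl;
  rewrite /= pS qF big_seq1; apply.
Qed.

Lemma cut_ge2 A S F p q p' q' : (p, q) != (p', q') ->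
  p \in S -> q \in F -> p' \in S -> q' \in F ->
  bond A p q + bond A p' q' <= cut_strength A S F.
Proof.
move=> n pS qF pS' qF'; have := @cut_ge_pairs A S F [:: (p, q); (p', q')].
by rewrite /= inE n pS qF pS' qF' !big_cons big_nil addn0; apply.
Qed.

Lemma sub_cut A B S F S' F' : {subset S' <= S} -> {subset F' <= F} ->
  (forall p, (p \in S') || (p \in F') -> A p = B p) ->
  cut_strength A S' F' <= cut_strength B S F.
Proof.
move=> sS sF eAB.
have -> : cut_strength A S' F' =
    \sum_(pq <- [seq (p, q) | p <- enum_fset S', q <- enum_fset F'])
      bond B pq.1 pq.2.
  rewrite big_allpairs; apply: eq_big_seq => p pS; apply: eq_big_seq => q qF /=.
  by apply: eq_bond; apply: eAB; rewrite ?pS ?qF ?orbT.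
apply: cut_ge_pairs; first by apply: allpairs_uniq; rewrite ?fset_uniq // => -[? ?] [? ?].
by apply/allP => -[p q] /allpairsP[[p' q'] /= [/sS ? /sF ? [-> ->]]]; apply/andP.
Qed.

(** The only upper bound on cuts: isolating one tile breaks at most its four bonds. It shows that a
    tile held too weakly can be removed. *)
Lemma cut_le_attach A S p t : A p = Some t ->
  cut_strength A S [fset p]%fset <= attach_strength A p t.
Proof.
move=> Ap.
have -> : cut_strength A S [fset p]%fset = \sum_(q <- S) bond A p q.
  by apply: eq_bigr => q _; rewrite big_seq_fset1 bondC.
have -> : attach_strength A p t = \sum_(q <- [seq nbr p d | d <- [:: dN; dE; dS; dW]])
    bond A p q.
  rewrite big_map !big_cons big_nil !bond_nbr attach_strengthE /sum4 addn0.
  by rewrite /tile_at Ap /= !addnA.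
rewrite (bigID (adjacent p)) /= [X in _ + X]big1 ?addn0; last first.
  by move=> q; exact: bond_adjacent.
rewrite -big_filter; apply: leq_sum_uniq => //.
- by rewrite filter_uniq ?fset_uniq.
- exact: uniq_nbrs.
move=> q; rewrite mem_filter => /andP[/adjacentP [d ->] _].
by case: d; rewrite !inE eqxx ?orbT.
Qed.

(** * Stability at a temperature *)

Definition stable tau A :=
  forall S F, is_cut A S F -> origin \in S -> tau <= cut_strength A S F.

Lemma stable_le tau tau' A : tau' <= tau -> stable tau A -> stable tau' A.
Proof. by move=> le sA S F c o; apply: leq_trans le (sA _ _ c o). Qed.

Lemma no_removal tau A B : stable tau A -> ~ removal tau A B.
Proof. by move=> sA [S [F [c o lt _ _]]]; have := sA _ _ c o; lia. Qed.

(* A cut of the extension that meets the old part restricts to a cut of it. *)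
Lemma weak_cut_avoids tau A Z S F : (forall p t, A p = Some t -> Z p = Some t) ->
  shape A origin -> stable tau A ->
  is_cut Z S F -> origin \in S -> cut_strength Z S F < tau ->
  forall p, shape A p -> p \in S.
Proof.
move=> AZ Ao sA [S0 F0 dSF SF] o lt.
have eZ p : shape A p -> A p = Z p.
  by rewrite /shape; case e: (A p) => [t|//] _; rewrite (AZ _ _ e).
have subSF p : shape A p -> (p \in S) || (p \in F).
  by move=> Ap; rewrite -in_fsetU -SF /shape -eZ.
pose S' := [fset p in S | shape A p]%fset.
pose F' := [fset p in F | shape A p]%fset.
have [F'0|F'0] := eqVneq F' fset0.
  move=> p Ap; have := subSF _ Ap; case: (p \in S) => //= pF.
  have : p \in F' by rewrite !inE /= pF.
  by rewrite F'0 inE.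
suff : tau <= cut_strength Z S F by lia.
apply: leq_trans (sA S' F' _ _) _.
- split => //.
  + by apply/fset0Pn; exists origin; rewrite !inE /= o.
  + apply/fdisjointP => p; rewrite !inE /= => /andP[pS _].
    by rewrite negb_and (fdisjointP dSF).
  + move=> p; rewrite !inE /= -andb_orl.
    by case Ap: (shape A p); rewrite ?andbF ?andbT // subSF.
- by rewrite !inE /= o.
apply: sub_cut.
- by move=> p; rewrite !inE /= => /andP[].
- by move=> p; rewrite !inE /= => /andP[].
- by move=> p; rewrite !inE /= => /orP[] /andP[_]; apply: eZ.
Qed.

(** Starting from a stable part that lies wholly on the seed side, it remains to pull the new cells
    over to that side one after another, each by bonds of total strength at least [tau]. *)
Lemma stable_extend tau A Z : (forall p t, A p = Some t -> Z p = Some t) ->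
  shape A origin -> stable tau A ->
  (forall S F, is_cut Z S F -> origin \in S -> cut_strength Z S F < tau ->
     (forall p, shape A p -> p \in S) -> False) ->
  stable tau Z.
Proof.
move=> AZ Ao sA h S F c o; rewrite leqNgt; apply/negP => lt.
by apply: (h S F) => //; apply: weak_cut_avoids c o lt.
Qed.

Lemma placeE A p t q : place A p t q = if q == p then Some t else A q.
Proof. by []. Qed.

(** A weak cut keeps the old part on the seed side, so it can only isolate [p]; its strength is then
    the attachment strength of the new tile. *)
Lemma stable_place tau A p t : shape A origin -> stable tau A ->
  ~~ shape A p -> tau <= attach_strength A p t -> stable tau (place A p t).
Proof.
move=> Ao sA /negPn/eqP Ap tp; apply: (@stable_extend _ A) => //.
  move=> q u; rewrite /place; case: eqP => // ->; by rewrite Ap.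
move=> S F [S0 F0 dSF SF] o lt AS.
suff : attach_strength A p t <= cut_strength (place A p t) S F by lia.
have pF : p \in F.
  case/fset0Pn: F0 => q qF; suff <- : q = p by [].
  have : shape (place A p t) q by rewrite SF inE qF orbT.
  rewrite /shape /place; case: (eqVneq q p) => // _ Aq.
  by have := fdisjointP dSF _ (AS _ Aq); rewrite qF.
have pS d : A (nbr p d) != None -> nbr p d \in S by move=> h; apply: AS.
have -> : attach_strength A p t =
    \sum_(d <- [seq d <- [:: dN; dE; dS; dW] | A (nbr p d) != None])
       bond (place A p t) (nbr p d) p.
  have e d : pull A p t d = if A (nbr p d) != None then
      bond (place A p t) (nbr p d) p else 0.
    case: ifPn => [h|/negPn/eqP /pull_None //].
    by rewrite bondC bond_nbr /pull /tile_at !placeE eqxx nbr_neq.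
  by rewrite attach_strengthE /sum4 !e big_filter !big_mkcond !big_cons big_nil /=
    addn0 !addnA.
rewrite -(big_map (fun d => (nbr p d, p)) xpredT (fun pq => bond (place A p t) pq.1 pq.2)).
apply: cut_ge_pairs.
  have -> : [seq (nbr p d, p) | d <- [seq d <- [:: dN; dE; dS; dW] | A (nbr p d) != None]]
     = [seq (q, p) | q <- [seq q <- [seq nbr p d | d <- [:: dN; dE; dS; dW]] | A q != None]].
    by rewrite filter_map -map_comp.
  rewrite map_inj_uniq; last by move=> ? ? [].
  exact/filter_uniq/uniq_nbrs.
rewrite all_map all_filter /= pF !andbT; apply/and4P.
by split; apply/implyP; [apply: (pS dN)|apply: (pS dE)|apply: (pS dS)|apply: (pS dW)].
Qed.

(** Were the shape disconnected, the component of the origin against all the rest would be a cut of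
    strength 0. *)
Lemma stable_supertile tau A (D : {fset pos}) : 0 < tau -> stable tau A ->
  shape A origin -> (forall p, shape A p = (p \in D)) -> supertile A.
Proof.
move=> t0 sA Ao AD; split; first by exists D.
pose e : rel D := fun x y => adjacency A (val x) (val y).
have es : symmetric e.
  by move=> x y; rewrite /e /adjacency adjacentC andbCA.
have oD : origin \in D by rewrite -AD.
pose o := [` oD]%fset.
have lift (x y : D) : connect e x y ->
    exists2 s : seq pos, path (adjacency A) (val x) s & last (val x) s = val y.
  case/connectP => s ps ->; exists (map val s); last by rewrite last_map.
  by rewrite path_map.
suff all_o (x : D) : connect e o x.
  move=> p q; rewrite !AD => pD qD.
  apply: (lift [` pD]%fset [` qD]%fset); apply: connect_trans (all_o _).
  by rewrite (sym_connect_sym es).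
apply/negPn/negP => nx.
pose S := [fset val y | y in [pred y | connect e o y]]%fset.
pose F := [fset val y | y in [pred y | ~~ connect e o y]]%fset.
have inS y : (val y \in S) = connect e o y.
  apply/imfsetP/idP => [[z /= ? /val_inj -> //]|cy]; by exists y.
have inF y : (val y \in F) = ~~ connect e o y.
  apply/imfsetP/idP => [[z /= ? /val_inj -> //]|cy]; by exists y.
have SD p : p \in S -> p \in D by case/imfsetP => y _ ->; exact: valP.
have FD p : p \in F -> p \in D by case/imfsetP => y _ ->; exact: valP.
have := sA S F; rewrite (_ : cut_strength A S F = 0); last first.
  rewrite /cut_strength big_seq big1 // => p pS; rewrite big_seq big1 // => q qF.
  apply/eqP/negPn/negP; rewrite -lt0n => /bond_shape [Ap Aq apq].
  have := pS; have := qF; have pD := SD _ pS; have qD := FD _ qF.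
  rewrite (inS [` pD]%fset : (p \in S) = _) (inF [` qD]%fset : (q \in F) = _).
  move=> /negP nq cp; apply: nq; apply: connect_trans cp _; apply: connect1.
  by rewrite /e /adjacency Ap Aq.
rewrite leqNgt t0 => /(_ _ _) h; apply: notF; apply: h.
- split.
  + by apply/fset0Pn; exists (val o); rewrite inS connect0.
  + by apply/fset0Pn; exists (val x); rewrite inF.
  + apply/fdisjointP => p pS; have pD := SD _ pS.
    by rewrite (inF [` pD]%fset : (p \in F) = _) -inS negbK.
  + move=> p; rewrite AD inE; apply/idP/orP => [pD|[/SD|/FD] //].
    rewrite (inS [` pD]%fset : (p \in S) = _) (inF [` pD]%fset : (p \in F) = _).
    by apply/orP; rewrite orbN.
- by rewrite (inS o : (origin \in S) = _) connect0.
Qed.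

(** * Phases with a unique result *)

Definition phase_yields i tau A Z :=
  phase_terminates i tau A /\
  forall B, (clos_refl_trans _ (@step ts i tau) A B /\ terminal i tau B) <-> B = Z.

(** The measure bounds every run, hence some terminal configuration is reachable; the invariant
    identifies it as [Z], which is thereby reachable and terminal itself. *)
Lemma phase_yields_inv i tau A Z (inv : config ts -> Prop) (mu : config ts -> nat) :
  inv A ->
  (forall B C, inv B -> step i tau B C -> inv C /\ mu C < mu B) ->
  (forall B, inv B -> terminal i tau B -> B = Z) ->
  phase_yields i tau A Z.
Proof.
move=> iA st tZ.
have inv_rt B : clos_refl_trans _ (@step ts i tau) A B -> inv B.
  move/clos_rt_rtn1_iff; elim => // B' C s _ iB.
  by case: (st _ _ iB s).
have term : phase_terminates i tau A.
  case=> run [r0 rs].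
  have h m : inv (run m) /\ mu (run m) + m <= mu A.
    elim: m => [|m [im le]]; first by rewrite r0 addn0.
    by have [? ?] := st _ _ im (rs m); split => //; lia.
  by have [_] := h (mu A).+1; lia.
split => // B; split=> [[/inv_rt iB tB]|->]; first exact: tZ.
suff [C [rC tC]] : exists C, clos_refl_trans _ (@step ts i tau) A C /\ terminal i tau C.
  by have <- := tZ C (inv_rt _ rC) tC.
suff h m B0 : inv B0 -> mu B0 < m ->
    exists C, clos_refl_trans _ (@step ts i tau) B0 C /\ terminal i tau C.
  exact: h iA (ltnSn _).
elim: m B0 => // m IH B0 iB lt.
(* Excluded middle decides whether a further step exists; the measure makes the search end. *)
have [[C s]|n] := classic (exists C, step i tau B0 C).
  have [iC ltC] := st _ _ iB s.
  have [|D [rD tD]] := IH C iC; first by lia.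
  by exists D; split => //; apply: rt_trans rD; apply: rt_step.
by exists B0; split; [apply: rt_refl | move=> C s; apply: n; exists C].
Qed.

(** * Confluent growth along an order of attachment *)

Section Grow.

Variables (i tau : nat) (A Z : config ts).
Variables (inp ext : pos -> dir -> bool) (rank : pos -> nat) (box : seq pos).

(** The last clause drives the argument: a tile is never present without the neighbours it depends
    on. [inp] marks those that suffice to attach it, [ext] those whose earlier presence follows from
    that of the inputs. *)
Definition grown B :=
  [/\ forall p t, A p = Some t -> B p = Some t,
      forall p t, B p = Some t -> Z p = Some t &
      forall p d, B p != None -> inp p d || ext p d -> B (nbr p d) != None].

(* The pull exerted on [t] at [p] by the neighbours that may precede [p]. *)
Definition upstream p t d :=
  if inp (nbr p d) (opp d) || ext (nbr p d) (opp d) then 0 else pull Z p t d.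

Hypothesis Ao : shape A origin.
Hypothesis sA : stable tau A.
Hypothesis AZ : forall p t, A p = Some t -> Z p = Some t.
Hypothesis Zbox : forall p, Z p != None -> p \in box.
Hypothesis Ztiles : forall p t, Z p = Some t -> t \in tiles ts.
Hypothesis Aclosed :
  forall p d, A p != None -> inp p d || ext p d -> A (nbr p d) != None.
Hypothesis inp_enough : forall p t, A p = None -> Z p = Some t ->
  tau <= sum4 (fun d => if inp p d then pull Z p t d else 0).
Hypothesis inp_rank : forall p d, A p = None -> Z p != None -> inp p d ->
  Z (nbr p d) != None /\ (A (nbr p d) != None \/ rank (nbr p d) < rank p).
Hypothesis ext_inp : forall B p d, grown B -> A p = None -> Z p != None ->
  (forall d', inp p d' -> B (nbr p d') != None) -> ext p d -> B (nbr p d) != None.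
Hypothesis no_other : forall p t, A p = None -> t \in tiles ts -> Z p <> Some t ->
  sum4 (upstream p t) < tau.
Hypothesis inp_needed : forall p t d, A p = None -> Z p = Some t -> inp p d ->
  sum4 (fun d' => if eqd d d' then 0 else upstream p t d') < tau.

(** A neighbour depending on [p] is absent as long as [p] is empty, so masking it in [upstream]
    loses nothing. *)
Lemma grown_pull B p t d : grown B -> B p = None ->
  pull B p t d <= (if B (nbr p d) != None then upstream p t d else 0).
Proof.
move=> [_ BZ Bc] Bp; case: ifPn => [Bq|/negPn/eqP /pull_None -> //].
rewrite /upstream ifN; last first.
  by apply/negP => /(Bc _ _ Bq); rewrite nbrK Bp.
by rewrite /pull /tile_at; case e: (B (nbr p d)) Bq => [u|//] _; rewrite (BZ _ _ e).
Qed.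

(** [no_other] forces the added tile to be the intended one, [inp_needed] forces all its inputs to
    be there already, and [ext_inp] then restores closure. One more cell of the finite box is
    occupied. *)
Lemma grown_addition B C : grown B -> addition tau B C ->
  grown C /\ count (fun p => C p == None) box < count (fun p => B p == None) box.
Proof.
move=> gB [p [t [/and3P[tt /negPn/eqP Bp ts_] ->]]].
have [AB BZ Bc] := gB; rewrite attach_strengthE in ts_.
have Ap : A p = None by case e: (A p) => [u|//]; rewrite (AB _ _ e) in Bp.
have le d : pull B p t d <= upstream p t d.
  by apply: leq_trans (grown_pull _ _ gB Bp) _; case: ifP.
have Zp : Z p = Some t.
  apply: NNPP => n; have := no_other Ap tt n; rewrite ltnNge => /negP; apply.
  exact: leq_trans ts_ (leq_sum4 le).
have inB d : inp p d -> B (nbr p d) != None.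
  move=> ip; apply/negP => /eqP Bq; have := inp_needed Ap Zp ip.
  rewrite ltnNge => /negP; apply; apply: leq_trans ts_ _; apply: leq_sum4 => d'.
  case: ifP => // e; have <- : d = d' by case: (d) (d') e => [] [].
  by rewrite pull_None.
split.
  split.
  - by move=> q u Aq; rewrite /place; case: eqP => [e|_]; [rewrite e Ap in Aq | exact: AB].
  - by move=> q u; rewrite /place; case: eqP => [-> [<-] //|_]; apply: BZ.
  - move=> q d; rewrite /place; case: (eqVneq q p) => [-> _|_ Bq] ie; last first.
      by case: ifP => // _; exact: Bc Bq ie.
    rewrite nbr_neq; case/orP: ie => [/inB //|ep].
    by apply: (ext_inp gB Ap _ inB ep); rewrite Zp.
have pb : p \in box by apply: Zbox; rewrite Zp.
elim: box pb => //= q s IH; rewrite inE.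
have mono r : (place B p t r == None) <= (B r == None).
  by rewrite /place; case: (r == p).
have le_s : count (fun r => place B p t r == None) s <= count (fun r => B r == None) s.
  by elim: s {IH} => //= r s IH; apply: leq_add => //; apply: mono.
case/orP => [/eqP <-|/IH lt]; last by rewrite -addnS leq_add.
by rewrite {1}/place eqxx Bp eqxx /= add0n add1n ltnS.
Qed.

(** By induction on the rank: the inputs of a missing cell lie in [A] or have lower rank, so they
    are present and the cell can be filled. *)
Lemma grown_full B : grown B -> (forall p t, ~ attachable tau B p t) -> B = Z.
Proof.
move=> gB nB; have [AB BZ Bc] := gB.
have full m p : rank p < m -> Z p != None -> B p != None.
  elim: m p => // m IH p lt Zp; apply/negP => /eqP Bp.
  have Ap : A p = None by case e: (A p) => [u|//]; rewrite (AB _ _ e) in Bp.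
  case e: (Z p) Zp => [t|//] Zp.
  apply: (nB p t); rewrite /attachable (Ztiles e) /shape Bp /=.
  rewrite attach_strengthE; apply: leq_trans (inp_enough Ap e) _.
  apply: leq_sum4 => d; case: ifP => // ip.
  have [|Zq r] := inp_rank Ap _ ip; first by rewrite e.
  have Bq : B (nbr p d) != None.
    case: r => [|r]; first by case e': (A (nbr p d)) => [u|//]; rewrite (AB _ _ e').
    by apply: IH => //; lia.
  by rewrite /pull /tile_at; case e': (B _) Bq => [u|//] _; rewrite (BZ _ _ e').
apply: functional_extensionality => p.
case e: (B p) => [t|]; first by rewrite (BZ _ _ e).
by case e': (Z p) => [t|//]; have := full _ p (ltnSn _); rewrite e e' => /(_ erefl).
Qed.

(** Additions preserve stability, so nothing is ever removed, even in phases that allow it. As [Z]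
    is reachable, it inherits the stability. *)
Theorem grow : phase_yields i tau A Z /\ stable tau Z.
Proof.
have st B C : grown B /\ stable tau B -> step i tau B C ->
    (grown C /\ stable tau C) /\
    count (fun p => C p == None) box < count (fun p => B p == None) box.
  move=> [gB sB] [ad|[_ /(no_removal sB) //]].
  have [gC lt] := grown_addition gB ad; do 2!split => //.
  case: ad => p [t [/and3P[tt Bp ts_] ->]]; apply: stable_place => //.
  move: Ao; rewrite /shape; case e: (A origin) => [u|//] _.
  by have [AB _ _] := gB; rewrite (AB _ _ e).
have gA : grown A by split => // p t Ap; apply: AZ.
have yields : phase_yields i tau A Z.
  apply: (@phase_yields_inv _ _ _ _ (fun B => grown B /\ stable tau B)
    (fun B => count (fun p => B p == None) box)) => // B [gB sB] tB.
  apply: grown_full => // p t at_; apply: (tB (place B p t)); left.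
  by exists p, t.
split => //; have [_ /(_ Z) [_ /(_ erefl) [rt _]]] := yields.
suff [] : grown Z /\ stable tau Z by [].
by move/clos_rt_rtn1_iff: rt; elim => // B C s _ iB; case: (st _ _ iB s).
Qed.

End Grow.

Lemma outcome_unique taus (c : nat -> config ts) :
  c 0 = seed_config ts ->
  (forall i, i < size taus -> phase_yields i (nth 0 taus i) (c i) (c i.+1)) ->
  forall i, i <= size taus -> forall A, outcome taus i A <-> A = c i.
Proof.
move=> c0 cs; elim=> [|i IH] lt A /=; first by rewrite c0.
have [_ y] := cs _ lt.
have {}IH := IH (ltnW lt).
split=> [[B [/IH -> r t]]|e]; first by apply/y.
by exists (c i); split; [exact/IH| |]; case/y: e.
Qed.

Lemma uniquely_assembles_phases taus (c : nat -> config ts) (Y : pred pos) :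
  c 0 = seed_config ts ->
  (forall i, i < size taus -> phase_yields i (nth 0 taus i) (c i) (c i.+1)) ->
  supertile (c (size taus)) -> shape (c (size taus)) =1 Y ->
  uniquely_assembles ts taus Y.
Proof.
move=> c0 cs su sh; have ou := outcome_unique c0 cs; split.
  by move=> i A lt /(ou _ (ltnW lt)) ->; case: (cs _ lt).
by exists (c (size taus)); split => // A; apply: ou.
Qed.

End ModelTheory.

(** * The tile system *)

Inductive gl :=
  | g_null
  | g_al | g_al2
  | g_gk | g_gw | g_gf
  | g_ga | g_ga2 | g_gc
  | g_bq | g_bq2 | g_br | g_br2 | g_h | g_rd | g_n2 of bool
  | g_nb | g_n of bool | g_p of bool | g_me | g_mw
  | g_c of bool | g_i of bool | g_iz of bool | g_ret | g_t
  | g_e | g_u | g_d1 | g_l | g_e' | g_d1' | g_l'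
  | g_z1 | g_z2 | g_z3 | g_v0 | g_v1 | g_v2 | g_v3
  | g_r | g_s | g_y | g_x | g_gb | g_r2 | g_s2 | g_y2 | g_x2 | g_gb2
  | g_cw | g_ce | g_ff | g_ib | g_rw | g_rwf
  | g_d | g_d' | g_k1 | g_k2 | g_k3 | g_k4.

Definition all_gl : seq gl :=
  [:: g_null; g_al; g_al2; g_gk; g_gw; g_gf; g_ga; g_ga2; g_gc;
      g_bq; g_bq2; g_br; g_br2; g_h; g_rd; g_n2 false; g_n2 true;
      g_nb; g_n false; g_n true; g_p false; g_p true; g_me; g_mw;
      g_c false; g_c true; g_i false; g_i true; g_iz false; g_iz true; g_ret; g_t;
      g_e; g_u; g_d1; g_l; g_e'; g_d1'; g_l';
      g_z1; g_z2; g_z3; g_v0; g_v1; g_v2; g_v3;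
      g_r; g_s; g_y; g_x; g_gb; g_r2; g_s2; g_y2; g_x2; g_gb2;
      g_cw; g_ce; g_ff; g_ib; g_rw; g_rwf;
      g_d; g_d'; g_k1; g_k2; g_k3; g_k4].

Definition gl_code g :=
  match g with
  | g_null => 0 | g_al => 1 | g_al2 => 2 | g_gk => 3 | g_gw => 4 | g_gf => 5
  | g_ga => 6 | g_ga2 => 7 | g_gc => 8
  | g_bq => 9 | g_bq2 => 10 | g_br => 11 | g_br2 => 12 | g_h => 13 | g_rd => 14
  | g_n2 b => if b then 16 else 15
  | g_nb => 17 | g_n b => if b then 19 else 18 | g_p b => if b then 21 else 20
  | g_me => 22 | g_mw => 23
  | g_c b => if b then 25 else 24 | g_i b => if b then 27 else 26
  | g_iz b => if b then 29 else 28 | g_ret => 30 | g_t => 31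
  | g_e => 32 | g_u => 33 | g_d1 => 34 | g_l => 35
  | g_e' => 36 | g_d1' => 37 | g_l' => 38
  | g_z1 => 39 | g_z2 => 40 | g_z3 => 41
  | g_v0 => 42 | g_v1 => 43 | g_v2 => 44 | g_v3 => 45
  | g_r => 46 | g_s => 47 | g_y => 48 | g_x => 49 | g_gb => 50
  | g_r2 => 51 | g_s2 => 52 | g_y2 => 53 | g_x2 => 54 | g_gb2 => 55
  | g_cw => 56 | g_ce => 57 | g_ff => 58 | g_ib => 59 | g_rw => 60 | g_rwf => 61
  | g_d => 62 | g_d' => 63 | g_k1 => 64 | g_k2 => 65 | g_k3 => 66 | g_k4 => 67
  end.

Lemma gl_codeK : cancel gl_code (nth g_null all_gl).
Proof. by case=> //; case. Qed.

HB.instance Definition _ := Countable.copy gl (can_type gl_codeK).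

Lemma all_glP : Finite.axiom all_gl.
Proof. by case=> //; case. Qed.

HB.instance Definition _ := isFinite.Build gl all_glP.

(* Waiting tiles hold with 8 + 2 or 8 + 3; strength 7 only acts in the last phase. *)
Definition gl_str g :=
  match g with
  | g_null => 0
  | g_al => 2
  | g_al2 => 3
  | g_gk | g_gw | g_gf => 7
  | g_ga | g_ga2 | g_gc => 8
  | g_bq | g_bq2 | g_br | g_br2 | g_h | g_rd | g_n2 _
  | g_nb | g_n _ | g_p _ | g_me | g_mw
  | g_c _ | g_i _ | g_iz _ | g_ret | g_t
  | g_e | g_u | g_d1 | g_l | g_e' | g_d1' | g_l' => 6
  | _ => 12
  end.

Definition str (g h : gl) := if g == h then gl_str g else 0.

(* [k_z], [k_w]: first and later walls of the strip. [k_C], [k_I], [k_R], [k_T]: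
   rows of the counter that copy the bits, increment (from east to west), return
   (from west to east), and end it if the parity bit is set; the suffixes [n], [b]
   and [p] denote columns without bit, with a bit, and with the parity bit.
   [k_D], [k_U1], [k_U], [k_L]: diagonal and fillings of the eastern block;
   primed: of the southern block, which starts with [k_K0], ..., [k_K4]. *)
Inductive kind :=
  | k_z0 | k_z1 | k_z2 | k_z3
  | k_w0 | k_w1 | k_w2 | k_w3
  | k_a2 | k_b2 | k_q2 | k_r2 | k_s2 | k_y2 | k_x2
  | k_a | k_b | k_q | k_r | k_s | k_y | k_x
  | k_c | k_cw | k_ce | k_rd of bool | k_fe | k_ff
  | k_CW | k_Cn | k_Cp of bool | k_Cb of bool | k_CE
  | k_IE | k_In of bool | k_Ib of bool & bool | k_Ip of bool & bool
  | k_IW | k_IWz of bool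
  | k_RW | k_Rn | k_Rb of bool | k_Rp of bool | k_RE
  | k_TW | k_Tn | k_Tb | k_Tp | k_TE
  | k_D | k_U1 | k_U | k_L | k_L0
  | k_K0 | k_K1 | k_K2 | k_K3 | k_K4
  | k_D' | k_U1' | k_U' | k_L'.

Definition all_kinds : seq kind :=
  [:: k_z0; k_z1; k_z2; k_z3; k_w0; k_w1; k_w2; k_w3;
      k_a2; k_b2; k_q2; k_r2; k_s2; k_y2; k_x2;
      k_a; k_b; k_q; k_r; k_s; k_y; k_x;
      k_c; k_cw; k_ce; k_rd false; k_rd true; k_fe; k_ff;
      k_CW; k_Cn; k_Cp false; k_Cp true; k_Cb false; k_Cb true; k_CE;
      k_IE; k_In false; k_In true;
      k_Ib false false; k_Ib false true; k_Ib true false; k_Ib true true;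
      k_Ip false false; k_Ip false true; k_Ip true false; k_Ip true true;
      k_IW; k_IWz false; k_IWz true;
      k_RW; k_Rn; k_Rb false; k_Rb true; k_Rp false; k_Rp true; k_RE;
      k_TW; k_Tn; k_Tb; k_Tp; k_TE;
      k_D; k_U1; k_U; k_L; k_L0;
      k_K0; k_K1; k_K2; k_K3; k_K4; k_D'; k_U1'; k_U'; k_L'].

Lemma all_kindsP (P : kind -> bool) : all P all_kinds -> forall k, P k.
Proof.
have h k : has (fun k' => P k' == P k) all_kinds.
  by case: k => *; rewrite /= ?eqxx ?orbT //; repeat match goal with b : bool |- _ =>
    case: b end; rewrite ?eqxx ?orbT.
move=> a k; have := h k; elim: all_kinds a => //= k' s IH /andP[Pk' Ps].
by rewrite Pk'; case/orP => [/eqP <- //|]; apply: IH.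
Qed.

(** Only the waiting tile [k_a2] offers [g_al2] southward, without which the 6 of [g_bq2] cannot
    attach [k_q2]. Hence [k_x2] appears only when the cell is already taken, although its glue
    [g_gb2] alone would hold [k_b2] there. The same holds for [k_a], where [g_bq] and [g_al] give
    exactly 6 + 2 = 8. [k_IWz false] has no northern glue, which ends the counter; [k_IWz true]
    triggers one closing row. *)
Definition tile_of k : tile gl :=
  match k with
  | k_z0 => (g_z1, g_br2, g_gk, g_null)
  | k_z1 => (g_z2, g_bq2, g_z1, g_null)
  | k_z2 => (g_z3, g_ga2, g_z2, g_null)
  | k_z3 => (g_gw, g_null, g_z3, g_null)
  | k_w0 => (g_v0, g_br2, g_e', g_null)
  | k_w1 => (g_v1, g_bq2, g_v0, g_null)
  | k_w2 => (g_v2, g_ga2, g_v1, g_null)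
  | k_w3 => (g_nb, g_null, g_v2, g_v3)
  | k_a2 => (g_n2 false, g_null, g_al2, g_ga2)
  | k_b2 => (g_n2 true, g_gb2, g_null, g_null)
  | k_q2 => (g_al2, g_y2, g_r2, g_bq2)
  | k_r2 => (g_r2, g_s2, g_e', g_br2)
  | k_s2 => (g_null, g_br, g_e', g_s2)
  | k_y2 => (g_x2, g_bq, g_null, g_y2)
  | k_x2 => (g_h, g_ga, g_x2, g_gb2)
  | k_a => (g_null, g_null, g_al, g_ga)
  | k_b => (g_gc, g_gb, g_null, g_null)
  | k_q => (g_al, g_y, g_r, g_bq)
  | k_r => (g_r, g_s, g_e', g_br)
  | k_s => (g_null, g_e, g_e', g_s)
  | k_y => (g_x, g_e, g_null, g_y)
  | k_x => (g_gf, g_e, g_x, g_gb)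
  | k_c => (g_nb, g_ce, g_gc, g_cw)
  | k_cw => (g_nb, g_cw, g_h, g_rd)
  | k_ce => (g_nb, g_v3, g_null, g_ce)
  | k_rd b => (g_n b, g_rd, g_n2 b, g_null)
  | k_fe => (g_me, g_e, g_gf, g_ff)
  | k_ff => (g_nb, g_ff, g_null, g_ff)
  | k_CW => (g_mw, g_c false, g_gw, g_null)
  | k_Cn => (g_nb, g_c true, g_nb, g_c true)
  | k_Cp b => (g_p b, g_c true, g_n b, g_c false)
  | k_Cb b => (g_n b, g_c true, g_n b, g_c true)
  | k_CE => (g_ib, g_d, g_me, g_c true)
  | k_IE => (g_me, g_e, g_ib, g_i true)
  | k_In c => (g_nb, g_i c, g_nb, g_i c)
  | k_Ib c b => (g_n (b (+) c), g_i c, g_n b, g_i (b && c))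
  | k_Ip c b => (g_p b, g_i c, g_p b, if c then g_iz b else g_i false)
  | k_IW => (g_rw, g_i false, g_mw, g_null)
  | k_IWz b => (if b then g_rwf else g_null, g_iz b, g_mw, g_null)
  | k_RW => (g_mw, g_ret, g_rw, g_null)
  | k_Rn => (g_nb, g_ret, g_nb, g_ret)
  | k_Rb b => (g_n b, g_ret, g_n b, g_ret)
  | k_Rp b => (g_p b, g_ret, g_p b, g_ret)
  | k_RE => (g_ib, g_e, g_me, g_ret)
  | k_TW => (g_null, g_t, g_rwf, g_null)
  | k_Tn => (g_null, g_t, g_nb, g_t)
  | k_Tb => (g_null, g_t, g_n false, g_t)
  | k_Tp => (g_null, g_t, g_p true, g_t)
  | k_TE => (g_null, g_e, g_me, g_t)
  | k_D => (g_d1, g_e, g_l, g_d)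
  | k_U1 => (g_u, g_d, g_d1, g_e)
  | k_U => (g_u, g_e, g_u, g_e)
  | k_L => (g_l, g_e, g_l, g_e)
  | k_L0 => (g_l, g_e, g_null, g_d1')
  | k_K0 => (g_gk, g_k1, g_e', g_null)
  | k_K1 => (g_null, g_k2, g_e', g_k1)
  | k_K2 => (g_null, g_k3, g_e', g_k2)
  | k_K3 => (g_null, g_k4, g_e', g_k3)
  | k_K4 => (g_null, g_d1', g_e', g_k4)
  | k_D' => (g_d', g_d1', g_e', g_l')
  | k_U1' => (g_e', g_e, g_d', g_d1')
  | k_U' => (g_e', g_e, g_e', g_e)
  | k_L' => (g_e', g_l', g_e', g_l')
  end.

(* The sides through which a tile of the given kind is first attached. *)
Definition inpk k (d : dir) :=
  match k with
  | k_z0 => false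
  | k_z1 | k_z2 | k_z3 | k_x2 | k_x | k_c | k_fe | k_CW | k_IE | k_RW | k_TW =>
      eqd d dS
  | k_w0 | k_w1 | k_w2 | k_r2 | k_r | k_K0 | k_D' => eqd d dN
  | k_w3 | k_a2 | k_s2 | k_y2 | k_a | k_s | k_y | k_ce | k_D
  | k_K1 | k_K2 | k_K3 | k_K4 => eqd d dW
  | k_b2 | k_b | k_cw | k_ff => eqd d dE
  | k_q2 | k_q | k_L | k_L0 | k_U1' | k_U' => eqd d dN || eqd d dW
  | k_rd _ | k_In _ | k_Ib _ _ | k_Ip _ _ | k_IW | k_IWz _ => eqd d dE || eqd d dS
  | k_Cn | k_Cp _ | k_Cb _ | k_CE | k_Rn | k_Rb _ | k_Rp _ | k_RE
  | k_Tn | k_Tb | k_Tp | k_TE | k_U1 | k_U => eqd d dW || eqd d dS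
  | k_L' => eqd d dN || eqd d dE
  end.

(* [k_x2] and [k_x] close a loop that started at their western neighbour. *)
Definition extk k (d : dir) :=
  match k with k_x2 | k_x => eqd d dW | _ => false end.

Definition used_tiles : {set tile gl} :=
  [set t | has (fun k => tile_of k == t) all_kinds].

Lemma used_tilesP t : reflect (exists k, t = tile_of k) (t \in used_tiles).
Proof.
rewrite inE; apply: (iffP idP) => [|[k ->]].
  by elim: all_kinds => //= k s IH /orP[/eqP <-|/IH //]; exists k.
rewrite -[has _ _]negbK -all_predC; apply/negP => /all_kindsP /(_ k).
by rewrite /= eqxx.
Qed.

Lemma z0_used : tile_of k_z0 \in used_tiles.
Proof. by apply/used_tilesP; exists k_z0. Qed.

Lemma str_sym x y : str x y = str y x.
Proof. by rewrite /str eq_sym; case: eqP => // ->. Qed.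

Lemma str_null x : str g_null x = 0.
Proof. by rewrite /str; case: eqP. Qed.

Lemma str_neq x y : x != y -> str x y = 0.
Proof. by rewrite /str => /negPf ->. Qed.

Definition sys : tile_system :=
  TileSystem z0_used str_sym str_null str_neq.

(** * The local condition on a cell *)

Definition kconf (K : pos -> option kind) : config sys :=
  fun p => omap tile_of (K p).

Definition facing (ko : option kind) d : gl :=
  if ko is Some k then side (tile_of k) (opp d) else g_null.

(** The counterpart of [upstream] for glues: a neighbour attached through the cell under
    consideration counts as null. *)
Definition upfacing (ko : option kind) d : gl :=
  if ko is Some k then
    if inpk k (opp d) || extk k (opp d) then g_null else side (tile_of k) (opp d)
  else g_null.

Definition alld (P : dir -> bool) := [&& P dN, P dE, P dS & P dW].

Lemma alldP (P : dir -> bool) : reflect (forall d, P d) (alld P).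
Proof.
apply: (iffP and4P) => [[? ? ? ?] [] //|h].
by split; apply: h.
Qed.

(* The local condition at a cell with intended content [ko] whose intended
   neighbours are [nb]: nothing else can attach there before its successors, and
   the intended tile attaches exactly when all its inputs are present. *)
Definition okcell tau (ko : option kind) (nb : dir -> option kind) :=
  all (fun k => (if ko is Some k0 then tile_of k == tile_of k0 else false)
         || (sum4 (fun d => str (side (tile_of k) d) (upfacing (nb d) d)) < tau))
      all_kinds
  && (if ko is Some k then
        (tau <= sum4 (fun d =>
           if inpk k d then str (side (tile_of k) d) (facing (nb d) d) else 0))
        && alld (fun d => inpk k d ==>
             (isSome (nb d) &&
              (sum4 (fun d' => if eqd d d' then 0 else
                 str (side (tile_of k) d') (upfacing (nb d') d')) < tau)))
      else true).

(** In the counter and the blocks the neighbours depend on parameters, but only few patterns of four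
    upstream glues occur; each of them is settled by evaluation. *)
Definition okview tau (ko : option kind) (n e s w : gl) :=
  let u d := match d with dN => n | dE => e | dS => s | dW => w end in
  all (fun k => (if ko is Some k0 then tile_of k == tile_of k0 else false)
         || (sum4 (fun d => str (side (tile_of k) d) (u d)) < tau)) all_kinds
  && (if ko is Some k then
        (tau <= sum4 (fun d => if inpk k d then str (side (tile_of k) d) (u d) else 0))
        && alld (fun d => inpk k d ==>
             (sum4 (fun d' => if eqd d d' then 0 else
                str (side (tile_of k) d') (u d')) < tau))
      else true).

Lemma upfacing_str ko d g : str g (upfacing ko d) <= str g (facing ko d).
Proof. by case: ko => //= k; case: ifP => // _; rewrite str_sym str_null. Qed.

(** The presence of the inputs need not be checked: an absent input pulls with 0, so the remaining
    sides would already reach [tau], against the last condition of [okview]. *)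
Lemma okcell_view tau ko nb n e s w :
  upfacing (nb dN) dN = n -> upfacing (nb dE) dE = e ->
  upfacing (nb dS) dS = s -> upfacing (nb dW) dW = w ->
  okview tau ko n e s w -> okcell tau ko nb.
Proof.
move=> <- <- <- <- /andP[h1 h2]; apply/andP; split; first exact: h1.
case: ko {h1} h2 => // k /andP[h2 /alldP h3].
have h4 : tau <= sum4 (fun d =>
    if inpk k d then str (side (tile_of k) d) (upfacing (nb d) d) else 0) by [].
apply/andP; split.
  apply: leq_trans h4 _; apply: leq_sum4 => d; case: ifP => // _.
  exact: upfacing_str.
apply/alldP => d; apply/implyP => ik; have := h3 d; rewrite ik /= => lt.
apply/andP; split; last exact: lt.
case e': (nb d) => //; exfalso.
move: lt; rewrite ltnNge => /negP; apply; apply: leq_trans h4 _.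
have z : str (side (tile_of k) d) (upfacing (nb d) d) = 0.
  by rewrite e' /= str_sym str_null.
rewrite /sum4; case: d z {ik e'} => /= ->; rewrite ?if_same ?addn0 ?add0n.
all: by rewrite !leq_add //; case: ifP.
Qed.

Lemma str_le g h : str g h <= gl_str h.
Proof. by rewrite /str; case: eqP => // ->. Qed.

Lemma all_kindsI (P : kind -> bool) : (forall k, P k) -> all P all_kinds.
Proof. by move=> h; elim: all_kinds => //= k s ->; rewrite h. Qed.

Lemma okview_quiet tau n e s w :
  gl_str n + gl_str e + gl_str s + gl_str w < tau -> okview tau None n e s w.
Proof.
move=> lt; rewrite /okview andbT; apply: all_kindsI => k /=.
by apply: leq_ltn_trans lt; rewrite /sum4 !leq_add ?str_le.
Qed.

Lemma kconf_pull K p t d :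
  pull (kconf K) p t d = str (side t d) (facing (K (nbr p d)) d).
Proof.
rewrite /pull /tile_at /kconf /facing /=; case: (K (nbr p d)) => //=.
by case: d.
Qed.

Lemma kconf_None K p : (kconf K p == None) = ~~ isSome (K p).
Proof. by rewrite /kconf; case: (K p). Qed.

Lemma shape_kconf K p : shape (kconf K) p = isSome (K p).
Proof. by rewrite /shape kconf_None negbK. Qed.

(** * Growth from the local condition *)

Section KGrow.

Variables (i tau : nat) (KA KZ : pos -> option kind) (rank : pos -> nat).
Variable box : seq pos.

Hypothesis Ao : isSome (KA origin).
Hypothesis sA : stable tau (kconf KA).
Hypothesis AZ : forall p k, KA p = Some k -> KZ p = Some k.
Hypothesis Zbox : forall p, isSome (KZ p) -> p \in box.
Hypothesis Aclosed : forall p k d, KA p = Some k -> inpk k d || extk k d ->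
  isSome (KA (nbr p d)).
Hypothesis ok : forall p, KA p = None -> okcell tau (KZ p) (fun d => KZ (nbr p d)).
Hypothesis inp_rank : forall p k d, KA p = None -> KZ p = Some k -> inpk k d ->
  isSome (KA (nbr p d)) \/ rank (nbr p d) < rank p.
Hypothesis loop : forall p k, KA p = None -> KZ p = Some k -> extk k dW ->
  exists k1 k2, [/\ KZ (nbr p dS) = Some k1, inpk k1 dW,
    KZ (nbr (nbr p dS) dW) = Some k2 & inpk k2 dN].

Let inp p d := if KZ p is Some k then inpk k d else false.
Let ext p d := if KZ p is Some k then extk k d else false.

Lemma upstreamE p t d :
  @upstream sys (kconf KZ) inp ext p t d = str (side t d) (upfacing (KZ (nbr p d)) d).
Proof.
rewrite /upstream kconf_pull /inp /ext /facing /upfacing.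
case: (KZ (nbr p d)) => [k|] //=.
by case: ifP => // _; rewrite str_sym str_null.
Qed.

Theorem kgrow :
  phase_yields i tau (kconf KA) (kconf KZ) /\ stable tau (kconf KZ).
Proof.
have KN p : kconf KA p = None -> KA p = None by rewrite /kconf; case: (KA p).
apply: (@grow _ i tau _ _ inp ext rank box) => //.
- by rewrite shape_kconf.
- move=> p t; rewrite /kconf; case e: (KA p) => [k|//] [<-].
  by rewrite (AZ e).
- by move=> p; rewrite kconf_None negbK; exact: Zbox.
- move=> p t; rewrite /kconf; case e: (KZ p) => [k|//] [<-].
  by apply/used_tilesP; exists k.
- move=> p d; rewrite !kconf_None !negbK /inp /ext; case e: (KA p) => [k|//] _.
  by rewrite (AZ e); apply: Aclosed.
- move=> p t /KN Ap; rewrite /kconf; case e: (KZ p) => [k|//] [<-].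
  have := ok Ap; rewrite /okcell e => /andP[_ /andP[h _]].
  apply: leq_trans h _; apply: leq_sum4 => d.
  by rewrite /inp e; case: ifP => // _; rewrite kconf_pull.
- move=> p d /KN Ap; rewrite !kconf_None !negbK /inp; case e: (KZ p) => [k|//] _ ik.
  have := ok Ap; rewrite /okcell e => /andP[_ /andP[_ /alldP /(_ d)]].
  rewrite ik /= => /andP[-> _]; split => //.
  exact: inp_rank Ap e ik.
(* The loop: the southern neighbour of [p] came through its west, and that cell came through its
   north, which is the western neighbour of [p]. *)
- move=> B p d gB /KN Ap; rewrite !kconf_None !negbK /ext.
  case e: (KZ p) => [k|//] _ iB ek.
  have ed : d = dW by case: (k) (d) ek => // -[].
  rewrite {}ed in ek *; have [k1 [k2 [e1 i1 e2 i2]]] := loop Ap e ek.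
  have [_ _ Bc] := gB.
  have ikS : inpk k dS by case: (k) ek.
  have h1 : B (nbr p dS) != None by apply: iB; rewrite /inp e.
  have h2 : B (nbr (nbr p dS) dW) != None by apply: Bc; rewrite // /inp e1 i1.
  have -> : nbr p dW = nbr (nbr (nbr p dS) dW) dN.
    by case: (p) => x y; congr pair => /=; lia.
  by apply: Bc; rewrite // /inp e2 i2.
- move=> p t /KN Ap /used_tilesP[k ->] n.
  have := ok Ap => /andP[/all_kindsP /(_ k) + _].
  rewrite /sum4 !upstreamE; case/orP => // h; case: n.
  by rewrite /kconf; case: (KZ p) h => // k0 /eqP ->.
- move=> p t d /KN Ap; rewrite /kconf /inp; case e: (KZ p) => [k|//] [<-] ik.
  have := ok Ap; rewrite /okcell e => /andP[_ /andP[_ /alldP /(_ d)]].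
  by rewrite ik /= => /andP[_]; rewrite /sum4 !upstreamE.
Qed.

End KGrow.

(** * The strip *)

Inductive site := Sweak | Snone | Sstrong.

(* A complete unit, with rows numbered from 0 at the bottom:
<<
     rd  cw  c   ce  w3
     p2  x2  p   x   w2
     q2  y2  q   y   w1
     r2  s2  r   s   w0
>>
   The sites p2 and p are first held by [k_a2] and [k_a]; a bit 1 is encoded by
   [k_b2] at p2. The tip [T_] of the strip lacks the top row and the wall. *)
Inductive col :=
  | C_0 | C_seed | C_init
  | C_p2 of bool | C_x2 | C_p | C_x | C_w
  | T_p2 of site | T_x2 | T_p of site | T_x.

Definition site_kind s (weak strong : kind) :=
  match s with Sweak => Some weak | Snone => None | Sstrong => Some strong end.

Definition cell c j : option kind :=
  match c, j with
  | C_seed, 0 => Some k_z0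
  | C_init, 0 => Some k_z0
  | C_init, 1 => Some k_z1
  | C_init, 2 => Some k_z2
  | C_init, 3 => Some k_z3
  | (C_p2 _ | T_p2 _), 0 => Some k_r2
  | (C_p2 _ | T_p2 _), 1 => Some k_q2
  | C_p2 b, 2 => Some (if b then k_b2 else k_a2)
  | T_p2 s, 2 => site_kind s k_a2 k_b2
  | C_p2 b, 3 => Some (k_rd b)
  | (C_x2 | T_x2), 0 => Some k_s2
  | (C_x2 | T_x2), 1 => Some k_y2
  | (C_x2 | T_x2), 2 => Some k_x2
  | C_x2, 3 => Some k_cw
  | (C_p | T_p _), 0 => Some k_r
  | (C_p | T_p _), 1 => Some k_q
  | C_p, 2 => Some k_b
  | T_p s, 2 => site_kind s k_a k_b
  | C_p, 3 => Some k_c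
  | (C_x | T_x), 0 => Some k_s
  | (C_x | T_x), 1 => Some k_y
  | (C_x | T_x), 2 => Some k_x
  | C_x, 3 => Some k_ce
  | C_w, 0 => Some k_w0
  | C_w, 1 => Some k_w1
  | C_w, 2 => Some k_w2
  | C_w, 3 => Some k_w3
  | _, _ => None
  end.

Definition all_cols :=
  [:: C_0; C_seed; C_init; C_p2 false; C_p2 true; C_x2; C_p; C_x; C_w;
      T_p2 Sweak; T_p2 Snone; T_p2 Sstrong; T_x2;
      T_p Sweak; T_p Snone; T_p Sstrong; T_x].

Lemma all_colsP (P : col -> bool) : all P all_cols -> forall c, P c.
Proof.
move=> a [| | |[]| | | | |[]| |[]|]; move: a => /=;
  by do 17![case/andP => ?].
Qed.

Definition linked c c' :=
  match c, c' with
  | C_0, (C_0 | C_seed | C_init) | C_seed, C_0 => true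
  | (C_init | C_w), (C_p2 _ | T_p2 _) => true
  | C_p2 _, C_x2 | C_x2, C_p | C_p, C_x | C_x, C_w => true
  | T_p2 _, T_x2 | T_x2, T_p _ | T_p _, T_x | T_x, C_0 => true
  | _, _ => false
  end.

Definition pre bits :=
  C_init :: flatten [seq [:: C_p2 b; C_x2; C_p; C_x; C_w] | b <- bits].

Definition tip s2 s := [:: T_p2 s2; T_x2; T_p s; T_x].

Definition word bits s2 s := pre bits ++ tip s2 s.

Definition colat (w : seq col) (x : int) := if x is Posz i then nth C_0 w i else C_0.

Definition cellz c (y : int) := if y is Posz j then cell c j else None.

Definition kw w : pos -> option kind := fun p => cellz (colat w p.1) p.2.

Definition chained w := path linked C_0 w && linked (last C_0 w) C_0.

Lemma chained_colat w x : chained w -> linked (colat w (x - 1)%R) (colat w x).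
Proof.
case/andP=> pw lw; case: x => [[|i]|i].
- by case: w pw {lw} => //= c w /andP[].
- have -> : (Posz i.+1 - 1 = Posz i)%R by lia.
  have [lt|ge] := ltnP i.+1 (size w).
    by have /(pathP C_0)/(_ _ lt) := pw.
  rewrite /= [nth _ _ i.+1]nth_default //.
  have [lt|ge'] := ltnP i (size w); last by rewrite nth_default.
  by move: lw; rewrite (last_nth C_0) (_ : size w = i.+1) //; lia.
- by have -> : (Negz i - 1 = Negz i.+1)%R by lia.
Qed.

Lemma size_pre bits : size (pre bits) = 1 + 5 * size bits.
Proof. by rewrite /=; elim: bits => //= b bits IH; rewrite mulnS; lia. Qed.

Lemma pre_rcons bits b :
  pre (rcons bits b) = pre bits ++ [:: C_p2 b; C_x2; C_p; C_x; C_w].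
Proof. by rewrite /pre map_rcons flatten_rcons. Qed.

Lemma last_pre bits : last C_0 (pre bits) = (if nilp bits then C_init else C_w).
Proof.
case/lastP: bits => [//|bits b]; rewrite pre_rcons last_cat /=.
by case: bits.
Qed.

Lemma path_pre bits : path linked C_0 (pre bits).
Proof.
elim/last_ind: bits => [//|bits b IH].
by rewrite pre_rcons cat_path IH last_pre; case: ifP.
Qed.

Lemma chained_word bits s2 s : chained (word bits s2 s).
Proof.
rewrite /chained /word cat_path path_pre last_cat last_pre.
by case: ifP.
Qed.

Lemma size_word bits s2 s : size (word bits s2 s) = 5 * size bits + 5.
Proof. by rewrite size_cat size_pre /=; lia. Qed.

(** * Finite checks on three consecutive columns *)

Definition rows : seq int := [:: Negz 0; Posz 0; Posz 1; Posz 2; Posz 3; Posz 4].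

Definition colview c1 c2 c3 (y : int) d :=
  match d with
  | dN => cellz c2 (y + 1)%R
  | dE => cellz c3 y
  | dS => cellz c2 (y - 1)%R
  | dW => cellz c1 y
  end.

Lemma kw_nbr w (x y : int) d :
  kw w (nbr (x, y) d) = colview (colat w (x - 1)%R) (colat w x) (colat w (x + 1)%R) y d.
Proof. by case: d. Qed.

Lemma cell_big c j : 3 < j -> cell c j = None.
Proof. by case: j => [|[|[|[|j]]]] //; case: c => //; case. Qed.

Lemma cell0 j : cell C_0 j = None.
Proof. by case: j => [|[|[|[|j]]]]. Qed.

Lemma cellz0 y : cellz C_0 y = None.
Proof. by case: y => // j; exact: cell0. Qed.

Lemma kw_nneg w x y k : kw w (x, y) = Some k -> exists a b, x = Posz a /\ y = Posz b.
Proof.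
by rewrite /kw; case: x => [a|a] /=; [case: y => // b; exists a, b | rewrite cellz0].
Qed.

Lemma kw_far w (x y : int) : y \notin rows ->
  kw w (x, y) = None /\ forall d, kw w (nbr (x, y) d) = None.
Proof.
have e c (z : int) : ~~ (0 <= z <= 3)%R -> cellz c z = None.
  by case: z => [j|//] nz /=; rewrite cell_big //; lia.
rewrite !inE => n; split; first by rewrite /kw e //=; lia.
by case; rewrite /kw /= e //; lia.
Qed.

(** Rows -1 and 4 are included because they touch the strip. Conditionals instead of implications
    keep the evaluation from visiting triples that are not linked. *)
Definition check3 (Q : pred col) (P : col -> col -> col -> int -> bool) :=
  all (fun c1 => if Q c1 then all (fun c2 => if Q c2 && linked c1 c2 then
    all (fun c3 => if Q c3 && linked c2 c3 then all (P c1 c2 c3) rows else true)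
    all_cols else true) all_cols else true) all_cols.

Lemma check3P Q P w : check3 Q P -> chained w -> (forall x, Q (colat w x)) ->
  forall x y, y \in rows -> P (colat w (x - 1)%R) (colat w x) (colat w (x + 1)%R) y.
Proof.
move=> h cw Qw x y yr; have := h.
move=> /all_colsP /(_ (colat w (x - 1)%R)); rewrite Qw.
move=> /all_colsP /(_ (colat w x)); rewrite Qw chained_colat // andTb.
move=> /all_colsP /(_ (colat w (x + 1)%R)).
have := chained_colat (x + 1)%R cw; rewrite GRing.addrK => ->.
by rewrite Qw => /allP; apply.
Qed.

Definition allin (w : seq col) Q := all Q w && Q C_0.

Lemma colat_all w Q : allin w Q -> forall x, Q (colat w x).
Proof.
case/andP => /(all_nthP C_0) h h0 [i|//] /=.
by have [/h //|ge] := ltnP i (size w); rewrite nth_default.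
Qed.

Lemma all_pre (Q : pred col) bits : Q C_init -> all (fun b => all Q [:: C_p2 b; C_x2; C_p; C_x; C_w])
  [:: true; false] -> all Q (pre bits).
Proof.
move=> h0 h; rewrite /= h0 /=; elim: bits => //= b bits ->.
have /andP[/and5P[-> -> -> -> /andP[-> _]] _] : all Q [:: C_p2 b; C_x2; C_p; C_x; C_w] && true.
  by rewrite andbT; move: h => /=; case: b => /andP[? /andP[? _]].
by [].
Qed.

(* Cells that precede the completion of their column; the tiles through which
   they were attached may have been replaced since. *)
Definition settled c (y : int) :=
  match c with
  | C_p2 _ | C_p => (y < 3)%R
  | C_init => (y == 0)%R
  | _ => false
  end.

(* A potential that increases along dependencies: moving one column to the right
   is worth 10. *)
Definition ordk k :=
  match k with
  | k_z1 | k_w2 | k_q2 | k_x2 | k_q | k_x | k_c => 1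
  | k_z2 | k_w1 | k_r2 | k_r => 2
  | k_z3 | k_w0 => 3
  | k_cw => 12
  | k_rd _ => 23
  | _ => 0
  end.

(** The columns that may occur when growth at temperature 8 comes to rest: no cell of the tip has
    been emptied or replaced yet. *)
Definition calm c :=
  match c with
  | T_p2 Snone | T_p2 Sstrong | T_p Snone | T_p Sstrong | C_seed => false
  | _ => true
  end.

(** Enough for the start of a growth phase: dependencies ask that a neighbour be present, not which
    tile it is, so they survive the replacement of a waiting tile. *)
Definition filled c := match c with T_p2 Snone | T_p Snone => false | _ => true end.

Definition grow_check c1 c2 c3 (y : int) :=
  let nb := colview c1 c2 c3 y in
  if cellz c2 y is Some k then
    settled c2 y ||
    [&& okcell 8 (Some k) nb,
        alld (fun d => inpk k d ==>
          if nb d is Some k' then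
            match d with
            | dW => ordk k' < ordk k + 10
            | dE => ordk k' + 10 < ordk k
            | _ => ordk k' < ordk k
            end
          else false) &
        extk k dW ==>
          if cellz c2 (y - 1)%R is Some k1 then
            if cellz c1 (y - 1)%R is Some k2 then inpk k1 dW && inpk k2 dN else false
          else false]
  else okcell 8 None nb.

Definition closed_check c1 c2 c3 (y : int) :=
  if cellz c2 y is Some k then
    alld (fun d => inpk k d || extk k d ==> isSome (colview c1 c2 c3 y d))
  else true.

Lemma grow_checked : check3 calm grow_check.
Proof. by vm_compute. Qed.

Lemma closed_checked : check3 filled closed_check.
Proof. by vm_compute. Qed.

Definition completes c c' :=
  match c, c' with
  | C_0, (C_0 | C_w | T_p2 Sweak | T_x2 | T_p Sweak | T_x)
  | C_seed, C_init | C_init, C_init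
  | C_p2 false, C_p2 false | C_p2 true, C_p2 true
  | C_x2, C_x2 | C_p, C_p | C_x, C_x | C_w, C_w
  | T_p2 Sweak, C_p2 false | T_p2 Sstrong, C_p2 true
  | T_x2, C_x2 | T_p Sstrong, C_p | T_x, C_x => true
  | _, _ => false
  end.

Lemma completes_cell c c' y : completes c c' ->
  match cellz c y, cellz c' y with
  | Some k, Some k' => k = k'
  | None, Some _ => ~~ settled c' y
  | None, None => True
  | Some _, None => False
  end.
Proof.
case: y => [j|//] h /=.
have [ge|] := ltnP 3 j; first by rewrite !cell_big.
by case: c c' h => [| | |[]| | | | |[]| |[]|] [| | |[]| | | | |[]| |[]|] // _;
  case: j => [|[|[|[|j]]]].
Qed.

Lemma kw_closed w p k d : chained w -> allin w filled -> kw w p = Some k ->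
  inpk k d || extk k d -> isSome (kw w (nbr p d)).
Proof.
move=> cw fw; case: p => x y e.
have yr : y \in rows by apply/negPn/negP => /(kw_far w x) []; rewrite e.
have := check3P closed_checked cw (colat_all fw) x yr.
rewrite /closed_check -/(kw w (x, y)) e => /alldP /(_ d) /implyP h /h.
by rewrite kw_nbr.
Qed.

(** The local condition fails at settled cells, whose original input may have been replaced;
    [completes] ensures that those cells belong to [wA] already. Cells away from [rows] have only
    empty neighbours. *)
Lemma strip_grow i wA wZ :
  chained wA -> chained wZ -> allin wA filled -> allin wZ calm ->
  (forall x, completes (colat wA x) (colat wZ x)) ->
  isSome (kw wA origin) -> stable 8 (kconf (kw wA)) ->
  phase_yields i 8 (kconf (kw wA)) (kconf (kw wZ)) /\ stable 8 (kconf (kw wZ)).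
Proof.
move=> cA cZ fA fZ comp Ao sA.
have chkZ := check3P grow_checked cZ (colat_all fZ).
have AZ p k : kw wA p = Some k -> kw wZ p = Some k.
  move=> Ap; have := completes_cell p.2 (comp p.1); rewrite -/(kw wA p) -/(kw wZ p) Ap.
  by case: (kw wZ p) => // k' ->.
have ns p k : kw wA p = None -> kw wZ p = Some k -> ~~ settled (colat wZ p.1) p.2.
  move=> Ap Zp; have := completes_cell p.2 (comp p.1).
  by rewrite -/(kw wA p) -/(kw wZ p) Ap Zp.
have inrows w x y k : kw w (x, y) = Some k -> y \in rows.
  by move=> e; apply/negPn/negP => /(kw_far w x) []; rewrite e.
have chk p k : kw wA p = None -> kw wZ p = Some k ->
    grow_check (colat wZ (p.1 - 1)%R) (colat wZ p.1) (colat wZ (p.1 + 1)%R) p.2 /\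
    settled (colat wZ p.1) p.2 = false.
  case: p => x y Ap Zp; split; first by apply: chkZ; apply: inrows Zp.
  exact/negbTE/(ns _ _ Ap Zp).
have nbE p : (fun d => kw wZ (nbr p d)) =
    colview (colat wZ (p.1 - 1)%R) (colat wZ p.1) (colat wZ (p.1 + 1)%R) p.2.
  by case: p => x y; apply: functional_extensionality => d; rewrite kw_nbr.
apply: (@kgrow i 8 _ _ (fun p => if kw wZ p is Some k then
    10 * absz p.1 + ordk k else 0)
  [seq (Posz a, Posz b) | a <- iota 0 (size wZ), b <- iota 0 4]) => //.
- case=> x y Zp.
  have [a [b [ex ey]]] : exists a b, x = Posz a /\ y = Posz b.
    by move: Zp; case e: (kw wZ (x, y)) => // _; apply: kw_nneg e.
  rewrite {}ex {}ey in Zp *; apply/allpairsP; exists (a, b); rewrite !mem_iota /=; split=> //.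
    by rewrite ltnNge; apply/negP => ge; move: Zp; rewrite /kw /= nth_default // (cellz0 (Posz b)).
  by rewrite ltnNge; apply/negP => ge; move: Zp; rewrite /kw /= cell_big.
- by move=> p k d; apply: kw_closed.
- move=> [x y] Ap; case Zp: (kw wZ (x, y)) => [k|].
    have [] := chk _ _ Ap Zp; rewrite /grow_check /= -/(kw wZ (x, y)) Zp => + ns'.
    by rewrite ns' /= nbE => /andP[].
  have [yr|/(kw_far wZ x) [_ n]] := boolP (y \in rows).
    by have := chkZ x y yr; rewrite /grow_check -/(kw wZ (x, y)) Zp nbE.
  have -> : (fun d => kw wZ (nbr (x, y) d)) = fun=> None.
    by apply: functional_extensionality => d; rewrite n.
  by vm_compute.
- move=> [x y] k d Ap Zp ik; right.
  have [] := chk _ _ Ap Zp; rewrite /grow_check /= -/(kw wZ (x, y)) Zp => + ns'.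
  rewrite ns' /= => /and3P[_ /alldP /(_ d) + _]; rewrite ik -kw_nbr.
  have [a [b [-> _]]] := kw_nneg Zp; case e: (kw wZ _) => [k'|//].
  case: d e {ik} => /= e; try lia.
  by case: a e => [|a]; [rewrite /kw /= cellz0 | lia].
- move=> [x y] k Ap Zp ek.
  have [] := chk _ _ Ap Zp; rewrite /grow_check /= -/(kw wZ (x, y)) Zp => + ns'.
  rewrite ns' /= ek /= => /and3P[_ _].
  rewrite /kw /=; case: (cellz _ _) => [k1|//]; case: (cellz _ _) => [k2|//].
  by case/andP => i1 i2; exists k1, k2.
Qed.

(** * Stability of the strip at temperature 12 *)

Definition at_ o c j : pos := (Posz (c + o), Posz j).

Lemma at_eq o c j c' j' : (at_ o c j == at_ o c' j') = (c == c') && (j == j').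
Proof. by rewrite /at_ xpair_eqE; lia. Qed.

Section Bonds.

Variables (K : pos -> option kind) (o c j : nat) (k k' : kind).
Hypothesis Kk : K (at_ o c j) = Some k.

Lemma kbondE : K (at_ o c.+1 j) = Some k' ->
  bond (kconf K) (at_ o c j) (at_ o c.+1 j) = str (east (tile_of k)) (west (tile_of k')).
Proof.
move=> e'; have e : at_ o c.+1 j = nbr (at_ o c j) dE by congr pair => /=; lia.
by rewrite e bond_nbr kconf_pull -e e' /tile_at /kconf Kk.
Qed.

Lemma kbondN : K (at_ o c j.+1) = Some k' ->
  bond (kconf K) (at_ o c j) (at_ o c j.+1) = str (north (tile_of k)) (south (tile_of k')).
Proof.
move=> e'; have e : at_ o c j.+1 = nbr (at_ o c j) dN by congr pair => /=; lia.
by rewrite e bond_nbr kconf_pull -e e' /tile_at /kconf Kk.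
Qed.

Lemma kbondW : K (at_ o c.+1 j) = Some k' ->
  bond (kconf K) (at_ o c.+1 j) (at_ o c j) = str (east (tile_of k)) (west (tile_of k')).
Proof. by rewrite bondC; apply: kbondE. Qed.

Lemma kbondS : K (at_ o c j.+1) = Some k' ->
  bond (kconf K) (at_ o c j.+1) (at_ o c j) = str (north (tile_of k)) (south (tile_of k')).
Proof. by rewrite bondC; apply: kbondN. Qed.

End Bonds.

Section WeakCut.

Variables (tau : nat) (A : config sys) (S F : {fset pos}).
Hypothesis cSF : is_cut A S F.
Hypothesis lt : cut_strength A S F < tau.

Lemma cut_other p : shape A p -> p \notin S -> p \in F.
Proof. by case: cSF => _ _ _ -> ; rewrite inE => /orP[->|]. Qed.

Lemma cut_one p q : p \in S -> shape A q -> tau <= bond A p q -> q \in S.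
Proof.
move=> pS Aq le; apply/negPn/negP => /(cut_other Aq) qF.
by have := @cut_ge1 _ A S F _ _ pS qF; lia.
Qed.

Lemma cut_two p q p' q' : (p != p') || (q != q') -> p \in S -> p' \in S ->
  shape A q -> shape A q' -> tau <= bond A p q + bond A p' q' ->
  (q \in S) || (q' \in S).
Proof.
move=> n pS pS' Aq Aq' le; apply/negPn/negP; rewrite negb_or => /andP[nq nq'].
have := @cut_ge2 _ A S F p q p' q'; rewrite xpair_eqE negb_and => /(_ n pS (cut_other Aq nq) pS' (cut_other Aq' nq')).
by lia.
Qed.

End WeakCut.

Lemma colat_word bits s2 s c : 0 < c ->
  colat (word bits s2 s) (Posz (c + 5 * size bits)) = nth C_0 (tip s2 s) c.-1.
Proof.
move=> c0; rewrite /= /word nth_cat size_pre ifF; last by apply/negP; lia.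
by congr nth; lia.
Qed.

Lemma colat_wall bits s2 s :
  let c := colat (word bits s2 s) (Posz (0 + 5 * size bits)) in c = C_init \/ c = C_w.
Proof.
rewrite /= /word nth_cat size_pre ifT; last by lia.
have -> : 5 * size bits = (size (pre bits)).-1 by rewrite size_pre.
by rewrite nth_last last_pre; case: ifP; [left|right].
Qed.

Lemma colat_pre_cat (R : col -> col -> bool) bits t t' :
  (forall b, all (fun c => R c c) [:: C_init; C_p2 b; C_x2; C_p; C_x; C_w]) ->
  (forall j, R (nth C_0 t j) (nth C_0 t' j)) ->
  forall x, R (colat (pre bits ++ t) x) (colat (pre bits ++ t') x).
Proof.
move=> R1 R2 [i|i]; rewrite /colat; last first.
  by have := R2 (size t + size t'); rewrite !nth_default //; lia.
rewrite !nth_cat; case: ifP => lt; last exact: R2.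
have /(all_nthP C_0)/(_ _ lt) // : all (fun c => R c c) (pre bits).
apply: all_pre => /=; have /= /and5P[? ? ? ? ]:= R1 true => //.
move=> /and3P[? ? _]; have /= /and5P[? ? ? ? /and3P[? ? _]]:= R1 false.
by apply/and3P; split => //; apply/and5P; split=> //; apply/andP.
Qed.

Lemma kw_word bits s2 s c j : 0 < c ->
  kw (word bits s2 s) (at_ (5 * size bits) c j) = cell (nth C_0 (tip s2 s) c.-1) j.
Proof. by move=> c0; rewrite -(colat_word bits s2 s c0). Qed.

Definition conf bits s2 s := kconf (kw (word bits s2 s)).

Lemma kw_word_other bits s2 s s2' s' p :
  p != at_ (5 * size bits) 1 2 -> p != at_ (5 * size bits) 3 2 ->
  kw (word bits s2 s) p = kw (word bits s2' s') p.
Proof.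
case: p => -[i|i] [y|y] n1 n3 //.
rewrite /kw /= /word !nth_cat; case: ifP => // ge.
move: n1 n3; rewrite /at_ !xpair_eqE => n1 n3.
have : i - size (pre bits) = 0 -> y != 2 by rewrite size_pre in ge *; lia.
have : i - size (pre bits) = 2 -> y != 2 by rewrite size_pre in ge *; lia.
case: (i - _) => [|[|[|[|a]]]] //= h2 h0.
- by have := h0 erefl; case: y {n1 n3 h0 h2} => [|[|[|[|y]]]]; case: s2; case: s2'.
- by have := h2 erefl; case: y {n1 n3 h0 h2} => [|[|[|[|y]]]]; case: s; case: s'.
Qed.

Lemma conf_origin bits s2 s : isSome (kw (word bits s2 s) origin).
Proof. by []. Qed.

(* The two loops of the tip hold on to the wall even when their sites are empty. *)
Lemma loops_attached tau bits s2 s S F :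
  tau <= 12 -> is_cut (conf bits s2 s) S F -> cut_strength (conf bits s2 s) S F < tau ->
  (forall j, j < 4 -> at_ (5 * size bits) 0 j \in S) ->
  forall c j, 0 < c -> isSome (cell (nth C_0 (tip Snone Snone) c.-1) j) ->
    at_ (5 * size bits) c j \in S.
Proof.
move=> t12 cSF lt; set o := 5 * size bits => wS.
set K := kw (word bits s2 s).
have sh c j : 0 < c -> isSome (cell (nth C_0 (tip s2 s) c.-1) j) ->
    shape (conf bits s2 s) (at_ o c j).
  by move=> c0 h; rewrite shape_kconf kw_word.
have KE c j : 0 < c -> K (at_ o c j) = cell (nth C_0 (tip s2 s) c.-1) j.
  exact: kw_word.
have Kr2 : K (at_ o 1 0) = Some k_r2 := KE 1 0 erefl.
have Kq2 : K (at_ o 1 1) = Some k_q2 := KE 1 1 erefl.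
have Ks2 : K (at_ o 2 0) = Some k_s2 := KE 2 0 erefl.
have Ky2 : K (at_ o 2 1) = Some k_y2 := KE 2 1 erefl.
have Kx2 : K (at_ o 2 2) = Some k_x2 := KE 2 2 erefl.
have Kr : K (at_ o 3 0) = Some k_r := KE 3 0 erefl.
have Kq : K (at_ o 3 1) = Some k_q := KE 3 1 erefl.
have Ks : K (at_ o 4 0) = Some k_s := KE 4 0 erefl.
have Ky : K (at_ o 4 1) = Some k_y := KE 4 1 erefl.
have Kx : K (at_ o 4 2) = Some k_x := KE 4 2 erefl.
have [k0 [K0 s0]] : exists k, K (at_ o 0 0) = Some k /\ east (tile_of k) = g_br2.
  rewrite /K /kw /=; have /= := colat_wall bits s2 s; rewrite -/o add0n.
  by case=> ->; [exists k_z0 | exists k_w0].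
have [k1 [K1 s1]] : exists k, K (at_ o 0 1) = Some k /\ east (tile_of k) = g_bq2.
  rewrite /K /kw /=; have /= := colat_wall bits s2 s; rewrite -/o add0n.
  by case=> ->; [exists k_z1 | exists k_w1].
have one p q : p \in S -> shape (kconf K) q -> tau <= bond (kconf K) p q -> q \in S.
  exact: (cut_one cSF lt).
have two p q p' q' : (p != p') || (q != q') -> p \in S -> p' \in S ->
    shape (kconf K) q -> shape (kconf K) q' ->
    tau <= bond (kconf K) p q + bond (kconf K) p' q' -> (q \in S) || (q' \in S).
  exact: (cut_two cSF lt).
(* [g_bq2] and [g_br2] tie the loop to two cells of the wall with 6 + 6 = 12; the bond of 12 between
   [k_q2] and [k_r2] then brings over the other one. *)
have q2r2 : (at_ o 1 1 \in S) || (at_ o 1 0 \in S).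
  apply: (two (at_ o 0 1) _ (at_ o 0 0)); rewrite ?at_eq ?wS ?sh //.
  rewrite (kbondE K1 Kq2) (kbondE K0 Kr2).
  by rewrite s0 s1; apply: leq_trans t12 _; vm_compute.
have [q2S r2S] : at_ o 1 1 \in S /\ at_ o 1 0 \in S.
  by case/orP: q2r2 => h; split=> //; [apply: (one _ _ h) | apply: (one _ _ h)];
    rewrite ?sh // ?(kbondS Kr2 Kq2)
      ?(kbondN Kr2 Kq2).
have s2S : at_ o 2 0 \in S.
  by apply: (one _ _ r2S); rewrite ?sh // (kbondE Kr2 Ks2).
have y2S : at_ o 2 1 \in S.
  by apply: (one _ _ q2S); rewrite ?sh // (kbondE Kq2 Ky2).
have x2S : at_ o 2 2 \in S.
  by apply: (one _ _ y2S); rewrite ?sh // (kbondN Ky2 Kx2).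
have qr : (at_ o 3 1 \in S) || (at_ o 3 0 \in S).
  apply: (two (at_ o 2 1) _ (at_ o 2 0)); rewrite ?at_eq ?sh //.
  by rewrite (kbondE Ky2 Kq) (kbondE Ks2 Kr).
have [qS rS] : at_ o 3 1 \in S /\ at_ o 3 0 \in S.
  by case/orP: qr => h; split=> //; [apply: (one _ _ h) | apply: (one _ _ h)];
    rewrite ?sh // ?(kbondS Kr Kq)
      ?(kbondN Kr Kq).
have sS : at_ o 4 0 \in S.
  by apply: (one _ _ rS); rewrite ?sh // (kbondE Kr Ks).
have yS : at_ o 4 1 \in S.
  by apply: (one _ _ qS); rewrite ?sh // (kbondE Kq Ky).
have xS : at_ o 4 2 \in S.
  by apply: (one _ _ yS); rewrite ?sh // (kbondN Ky Kx).
by case=> [|[|[|[|[|c]]]]] // [|[|[|[|j]]]] // _; rewrite /= nth_nil.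
Qed.

Lemma kw_pre_cat bits t c j : 0 < c ->
  kw (pre bits ++ t) (at_ (5 * size bits) c j) = cell (nth C_0 t c.-1) j.
Proof.
move=> c0; rewrite -[LHS]/(cell (nth C_0 (pre bits ++ t) (c + 5 * size bits)) j).
rewrite nth_cat size_pre ifF; last by apply/negP; lia.
by congr (cell (nth _ _ _) _); lia.
Qed.

Lemma kw_left bits t t' i y : i <= 5 * size bits ->
  kw (pre bits ++ t) (Posz i, y) = kw (pre bits ++ t') (Posz i, y).
Proof.
move=> le; congr (cellz _ _).
rewrite -[LHS]/(nth C_0 (pre bits ++ t) i) -[RHS]/(nth C_0 (pre bits ++ t') i).
by rewrite !nth_cat size_pre ltnS le.
Qed.

Lemma kw_cases w p : isSome (kw w p) -> exists i j, p = (Posz i, Posz j).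
Proof.
case: p => x y; case e: (kw w (x, y)) => [k|//] _.
by have [a [b [-> ->]]] := kw_nneg e; exists a, b.
Qed.

Lemma seed_stable tau : stable tau (kconf (kw [:: C_seed])).
Proof.
move=> S F [_ /fset0Pn[p pF] dSF SF] o.
have : shape (kconf (kw [:: C_seed])) p by rewrite SF inE pF orbT.
rewrite shape_kconf => h; have [i [j e]] := kw_cases h; rewrite {}e in h pF *.
case: i h pF => [|i]; last by rewrite /kw /= nth_nil cell0.
case: j => [|j] // _ pF; have := fdisjointP dSF _ o.
by rewrite (pF : origin \in F).
Qed.

(** Induction on the units. Both waiting cells are left empty, so that what remains is the part no
    temperature can damage. A new unit is pulled to the seed side by single bonds of 12 or by pairs
    of bonds reaching 12. *)
Lemma core_stable bits : stable 12 (conf bits Snone Snone).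
Proof.
(* Once everything up to the last wall is on the seed side, [loops_attached] brings the tip and
   nothing is left for [F]. *)
have fin bits' S F (h : is_cut (conf bits' Snone Snone) S F) :
    (forall i j, i <= 5 * size bits' ->
      isSome (kw (word bits' Snone Snone) (Posz i, Posz j)) -> (Posz i, Posz j) \in S) ->
    cut_strength (conf bits' Snone Snone) S F < 12 -> False.
  move=> hS lt; have [_ /fset0Pn[p pF] dSF SF] := h.
  have sp : isSome (kw (word bits' Snone Snone) p).
    by rewrite -shape_kconf SF inE pF orbT.
  suff pS : p \in S by have := fdisjointP dSF _ pS; rewrite pF.
  have [i [j e]] := kw_cases sp; rewrite {}e in sp pF *.
  have [le|gt] := leqP i (5 * size bits'); first exact: hS.
  have e : (Posz i, Posz j) = at_ (5 * size bits') (i - 5 * size bits') j.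
    by congr pair; lia.
  rewrite e in sp *; apply: (loops_attached (leqnn 12) h lt) => //; try lia.
  - move=> j' j4; apply: hS => //; rewrite /kw /=.
    have /= := colat_wall bits' Snone Snone; rewrite add0n => -[] ->;
    by case: j' j4 => [|[|[|[|]]]].
  - by move: sp; rewrite kw_word //; lia.
elim/last_ind: bits => [|bits b IH].
  apply: (@stable_extend _ _ (kconf (kw [:: C_seed]))) => //; last first.
  - move=> S F c o lt _; apply: (fin [::] _ _ c _ lt) => i j.
    rewrite muln0 leqn0 => /eqP -> sj.
    have one p q := @cut_one _ _ _ _ c lt p q.
    have S0 : at_ 0 0 0 \in S by [].
    have S1 : at_ 0 0 1 \in S by apply: (one _ _ S0) => //; rewrite (@kbondN _ 0 0 0 k_z0 k_z1).
    have S2 : at_ 0 0 2 \in S by apply: (one _ _ S1) => //; rewrite (@kbondN _ 0 0 1 k_z1 k_z2).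
    have S3 : at_ 0 0 3 \in S by apply: (one _ _ S2) => //; rewrite (@kbondN _ 0 0 2 k_z2 k_z3).
    by case: j sj => [|[|[|[|j]]]].
  - exact: seed_stable.
  - move=> p t; rewrite /kconf; case e: (kw _ p) => [k|//] [<-].
    have := e; have [|i [j ep]] := @kw_cases [:: C_seed] p; first by rewrite e.
    rewrite {}ep in e *; case: i e => [|i]; last by rewrite /kw /= nth_nil cell0.
    by case: j => [|j] //= _ [<-].
set o := 5 * size bits.
set K := kw (word (rcons bits b) Snone Snone).
have wE : word (rcons bits b) Snone Snone = pre bits ++
    ([:: C_p2 b; C_x2; C_p; C_x; C_w] ++ tip Snone Snone).
  by rewrite /word pre_rcons catA.
have KE c j : 0 < c -> K (at_ o c j) =
    cell (nth C_0 ([:: C_p2 b; C_x2; C_p; C_x; C_w] ++ tip Snone Snone) c.-1) j.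
  by move=> c0; rewrite /K wE kw_pre_cat.
apply: (@stable_extend _ _ (conf bits Snone Snone)) => //; first last.
  move=> S F c os lt AS; apply: (fin _ _ _ c _ lt) => i j; rewrite size_rcons => le si.
  have [le'|gt] := leqP i (5 * size bits).
    apply: AS; rewrite shape_kconf; move: si; rewrite wE.
    by rewrite (@kw_left _ _ (tip Snone Snone)).
  have e : (Posz i, Posz j) = at_ o (i - o) j by congr pair; lia.
  have rng : 0 < i - o <= 5 by lia.
  have Ki : K (at_ o (i - o) j) =
      cell (nth C_0 [:: C_p2 b; C_x2; C_p; C_x; C_w] (i - o).-1) j.
    rewrite KE ?nth_cat; last by lia.
    by rewrite ifT //=; lia.
  have wS j' : j' < 4 -> at_ o 0 j' \in S.
    move=> j4; apply: AS; rewrite shape_kconf /kw /=.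
    have /= := colat_wall bits Snone Snone; rewrite add0n => -[] ->;
    by case: j' j4 => [|[|[|[|]]]].
  have {}AS c' j' : 0 < c' -> isSome (cell (nth C_0 (tip Snone Snone) c'.-1) j') ->
      at_ o c' j' \in S.
    by move=> c0 h; apply: AS; rewrite shape_kconf kw_word.
  have [k2 [K2 s2]] : exists k, K (at_ o 0 2) = Some k /\ east (tile_of k) = g_ga2.
    rewrite /K wE (@kw_left _ _ (tip Snone Snone)) // /kw /=.
    have /= := colat_wall bits Snone Snone; rewrite -/o add0n.
    by case=> ->; [exists k_z2 | exists k_w2].
  have Kp2 : K (at_ o 1 2) = Some (if b then k_b2 else k_a2) := KE 1 2 erefl.
  have Krd : K (at_ o 1 3) = Some (k_rd b) := KE 1 3 erefl.
  have Kx2 : K (at_ o 2 2) = Some k_x2 := KE 2 2 erefl.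
  have Kcw : K (at_ o 2 3) = Some k_cw := KE 2 3 erefl.
  have Kb : K (at_ o 3 2) = Some k_b := KE 3 2 erefl.
  have Kc : K (at_ o 3 3) = Some k_c := KE 3 3 erefl.
  have Kx : K (at_ o 4 2) = Some k_x := KE 4 2 erefl.
  have Kce : K (at_ o 4 3) = Some k_ce := KE 4 3 erefl.
  have Kw0 : K (at_ o 5 0) = Some k_w0 := KE 5 0 erefl.
  have Kw1 : K (at_ o 5 1) = Some k_w1 := KE 5 1 erefl.
  have Kw2 : K (at_ o 5 2) = Some k_w2 := KE 5 2 erefl.
  have Kw3 : K (at_ o 5 3) = Some k_w3 := KE 5 3 erefl.
  have one p q k : K q = Some k -> p \in S -> 12 <= bond (kconf K) p q -> q \in S.
    by move=> Kq pS; apply: (cut_one c lt) => //; rewrite shape_kconf -/K Kq.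
  have two p q p' q' k k' : K q = Some k -> K q' = Some k' ->
      (p != p') || (q != q') -> p \in S -> p' \in S ->
      12 <= bond (kconf K) p q + bond (kconf K) p' q' -> (q \in S) || (q' \in S).
    move=> Kq Kq' n pS p'S.
    by apply: (cut_two c lt) => //; rewrite shape_kconf -/K ?Kq ?Kq'.
  have bS : at_ o 3 2 \in S.
    by apply: (one (at_ o 4 2) _ _ Kb); rewrite ?AS // (kbondW Kb Kx).
  (* The upper row is held by 8 through [g_gc] and 6 through [g_h]. *)
  have cS0 : (at_ o 3 3 \in S) || (at_ o 2 3 \in S).
    apply: (two (at_ o 3 2) _ (at_ o 2 2) _ _ _ Kc Kcw); rewrite ?at_eq ?bS ?AS //.
    by rewrite (kbondN Kb Kc) (kbondN Kx2 Kcw).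
  have [cS cwS] : at_ o 3 3 \in S /\ at_ o 2 3 \in S.
    case/orP: cS0 => h; split=> //.
      by apply: (one _ _ _ Kcw h); rewrite (kbondW Kcw Kc).
    by apply: (one _ _ _ Kc h); rewrite (kbondE Kcw Kc).
  have ceS : at_ o 4 3 \in S by apply: (one _ _ _ Kce cS); rewrite (kbondE Kc Kce).
  have w3S : at_ o 5 3 \in S by apply: (one _ _ _ Kw3 ceS); rewrite (kbondE Kce Kw3).
  have w2S : at_ o 5 2 \in S by apply: (one _ _ _ Kw2 w3S); rewrite (kbondS Kw2 Kw3).
  have w1S : at_ o 5 1 \in S by apply: (one _ _ _ Kw1 w2S); rewrite (kbondS Kw1 Kw2).
  have w0S : at_ o 5 0 \in S by apply: (one _ _ _ Kw0 w1S); rewrite (kbondS Kw0 Kw1).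
  (* This is the locking of the second cell: for bit 0 the tile [k_a2] has 8 from the wall, and
     [k_rd] adds 6. *)
  have p2rd : (at_ o 1 2 \in S) || (at_ o 1 3 \in S).
    have [eb|eb] := boolP b.
      apply/orP; left; apply: (one (at_ o 2 2) _ _ Kp2); rewrite ?AS //.
      by rewrite (kbondW Kp2 Kx2) eb.
    apply: (two (at_ o 0 2) _ (at_ o 2 3) _ _ _ Kp2 Krd); rewrite ?at_eq ?wS //.
    by rewrite (kbondE K2 Kp2) (kbondW Krd Kcw) s2 (negbTE eb).
  have [p2S rdS] : at_ o 1 2 \in S /\ at_ o 1 3 \in S.
    case/orP: p2rd => h; split=> //.
      suff : (at_ o 1 3 \in S) || (at_ o 1 3 \in S) by rewrite orbb.
      apply: (two (at_ o 1 2) _ (at_ o 2 3) _ _ _ Krd Krd); rewrite ?at_eq //.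
      by rewrite (kbondN Kp2 Krd) (kbondW Krd Kcw); case: (b).
    have [eb|eb] := boolP b.
      by apply: (one (at_ o 2 2) _ _ Kp2); rewrite ?AS // (kbondW Kp2 Kx2) eb.
    suff : (at_ o 1 2 \in S) || (at_ o 1 2 \in S) by rewrite orbb.
    apply: (two (at_ o 0 2) _ (at_ o 1 3) _ _ _ Kp2 Kp2); rewrite ?at_eq ?wS //.
    by rewrite (kbondE K2 Kp2) (kbondS Kp2 Krd) s2 (negbTE eb).
  rewrite e in si *; move: si; rewrite -/K.
  move: rng Ki.
  by case: (i - o) => [|[|[|[|[|[|]]]]]] //; case: j {e} => [|[|[|[|j]]]] // _ h;
    rewrite ?h //= => _; rewrite AS.
move=> p t; rewrite /conf /kconf; case e: (kw _ p) => [k|//] [<-].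
have [|i [j ep]] := @kw_cases (word bits Snone Snone) p; first by rewrite e.
rewrite {}ep in e *; have [le|gt] := leqP i (5 * size bits).
  by rewrite wE (@kw_left _ _ (tip Snone Snone)) // e.
have e' : (Posz i, Posz j) = at_ o (i - o) j by congr pair; lia.
move: e; rewrite e' kw_word; last by lia.
rewrite -/K KE; last by lia.
case: (i - o) => [|[|[|[|[|c]]]]]; rewrite /= ?nth_nil.
all: by case: j {e'} => [|[|[|[|j]]]] //= [<-].
Qed.

(** * Pulses *)

(** All four neighbours count here, with no masking: during a pulse the only addition allowed is
    that of the replacing tile in an emptied cell. *)
Definition pulse_check tau c1 c2 c3 (y : int) :=
  if cellz c2 y is Some _ then true else
  all (fun k =>
    (sum4 (fun d => str (side (tile_of k) d) (facing (colview c1 c2 c3 y d) d)) < tau)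
    || match c2 with
       | T_p2 Snone => (y == 2) && (tile_of k == tile_of k_b2)
       | T_p Snone => (y == 2) && (tile_of k == tile_of k_b)
       | _ => false
       end) all_kinds.

(** At temperature 11 an empty second cell would take [k_a2] back, with 8 + 3 = 11; the check at 11
    therefore supposes this cell occupied. *)
Definition p2_held c :=
  match c with T_p2 Snone | C_seed => false | _ => true end.

Definition begun c := if c is C_seed then false else true.

Lemma pulse_checked11 : check3 p2_held (pulse_check 11).
Proof. by vm_compute. Qed.

Lemma pulse_checked12 : check3 begun (pulse_check 12).
Proof. by vm_compute. Qed.

Lemma site_cases s : [\/ s = Sweak, s = Snone | s = Sstrong].
Proof. by case: s; [constructor 1 | constructor 2 | constructor 3]. Qed.

Section Pulse.

Variable bits : seq bool.
Let o := 5 * size bits.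
Let P2 := at_ o 1 2.
Let P := at_ o 3 2.
Let cf s2 s := conf bits s2 s.
Let K s2 s := kw (word bits s2 s).

Lemma KtipE s2 s c j : 0 < c -> K s2 s (at_ o c j) = cell (nth C_0 (tip s2 s) c.-1) j.
Proof. exact: kw_word. Qed.

Lemma K_P2 s2 s : K s2 s P2 = site_kind s2 k_a2 k_b2. Proof. exact: KtipE. Qed.

Lemma K_P s2 s : K s2 s P = site_kind s k_a k_b. Proof. exact: KtipE. Qed.

Lemma K_P2w s2 s : s2 = Sweak -> K s2 s P2 = Some k_a2.
Proof. by rewrite K_P2 => ->. Qed.

Lemma K_P2s s2 s : s2 = Sstrong -> K s2 s P2 = Some k_b2.
Proof. by rewrite K_P2 => ->. Qed.

Lemma K_Pw s2 s : s = Sweak -> K s2 s P = Some k_a.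
Proof. by rewrite K_P => ->. Qed.

Lemma K_Ps s2 s : s = Sstrong -> K s2 s P = Some k_b.
Proof. by rewrite K_P => ->. Qed.

Lemma K_other s2 s s2' s' p : p != P2 -> p != P -> K s2 s p = K s2' s' p.
Proof. exact: kw_word_other. Qed.

Lemma K_wall2 s2 s : exists2 k, K s2 s (at_ o 0 2) = Some k & east (tile_of k) = g_ga2.
Proof.
rewrite /K /kw /=; have /= := colat_wall bits s2 s; rewrite -/o add0n.
by case=> ->; [exists k_z2 | exists k_w2].
Qed.

Lemma cf_core s2 s p t : cf Snone Snone p = Some t -> cf s2 s p = Some t.
Proof.
rewrite /cf /conf /kconf -/(K _ _ p) -/(K _ _ p).
have [->|n2] := eqVneq p P2; first by rewrite K_P2.
have [->|n] := eqVneq p P; first by rewrite K_P.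
by rewrite (K_other Snone Snone s2 s n2 n).
Qed.

(** The core is stable at 12, so it stays on the seed side and only the tiles of the two cells can
    be cut off. *)
Lemma cut_sites tau s2 s S F : tau <= 12 -> is_cut (cf s2 s) S F -> origin \in S ->
  cut_strength (cf s2 s) S F < tau ->
  (forall p, p != P2 -> p != P -> shape (cf s2 s) p -> p \in S) /\
  (forall p, p \in F -> p = P2 \/ p = P).
Proof.
move=> t12 c os lt.
have h := weak_cut_avoids (@cf_core s2 s) (conf_origin bits Snone Snone)
  (@core_stable bits) c os (leq_trans lt t12).
have h' p : p != P2 -> p != P -> shape (cf s2 s) p -> p \in S.
  move=> n2 n; rewrite shape_kconf -/(K _ _ p) (K_other s2 s Snone Snone n2 n) => sp.
  by apply: h; rewrite shape_kconf.
split=> // p pF; have [->|n2] := eqVneq p P2; first by left.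
have [->|n] := eqVneq p P; first by right.
have [_ _ dSF SF] := c.
have /(h' _ n2 n) pS : shape (cf s2 s) p by rewrite SF inE pF orbT.
by have := fdisjointP dSF _ pS; rewrite pF.
Qed.

Lemma shape_tip s2 s c j : 0 < c -> isSome (cell (nth C_0 (tip s2 s) c.-1) j) ->
  shape (cf s2 s) (at_ o c j).
Proof. by move=> c0 h; rewrite shape_kconf -/(K _ _ _) KtipE. Qed.

Section Cut.

Variables (tau : nat) (s2 s : site) (S F : {fset pos}).
Hypotheses (t12 : tau <= 12) (cSF : is_cut (cf s2 s) S F) (os : origin \in S).
Hypothesis lt : cut_strength (cf s2 s) S F < tau.

Lemma tip_in_S c j : 0 < c -> isSome (cell (nth C_0 (tip Snone Snone) c.-1) j) ->
  at_ o c j \in S.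
Proof.
move=> c0 h; have [h' _] := cut_sites t12 cSF os lt; apply: h'.
- by rewrite at_eq; case: c c0 h => [|[|c]] // _; case: j => [|[|[|j]]].
- by rewrite at_eq; case: c c0 h => [|[|[|[|c]]]] // _; case: j => [|[|[|j]]].
apply: shape_tip => //.
by case: c c0 h => [|[|[|[|[|c]]]]] // _; case: j => [|[|[|[|j]]]] //=; rewrite ?nth_nil.
Qed.

Lemma wall_in_S : at_ o 0 2 \in S.
Proof.
have [h' _] := cut_sites t12 cSF os lt; apply: h'; rewrite ?at_eq // shape_kconf.
by have [k e _] := K_wall2 s2 s; rewrite -/(K _ _ _) e.
Qed.

(** Cutting off [k_a2] costs 8 at the wall and 3 at [k_q2]; cutting off [k_b2] costs 12 at
    [k_x2]. *)
Lemma P2_in_F : P2 \in F -> s2 = Sweak /\ 11 < tau.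
Proof.
move=> PF; have [_ _ dSF SF] := cSF.
have : shape (cf s2 s) P2 by rewrite SF inE PF orbT.
rewrite shape_kconf -/(K _ _ _) K_P2.
have [k0 e0 g0] := K_wall2 s2 s.
have ex : K s2 s (at_ o 2 2) = Some k_x2 by rewrite KtipE.
have eq : K s2 s (at_ o 1 1) = Some k_q2 by rewrite KtipE.
have qS : at_ o 1 1 \in S by exact: tip_in_S.
have xS : at_ o 2 2 \in S by exact: tip_in_S.
move=> sp; case: (site_cases s2) => es; [split=> // | by rewrite es in sp | ].
- have e2 := K_P2w s es.
  have := @cut_ge2 _ (cf s2 s) S F _ P2 _ P2 _ wall_in_S PF qS PF.
  rewrite xpair_eqE at_eq (kbondE e0 e2) (kbondN eq e2) g0 => /(_ erefl).
  by move=> h; apply: leq_trans lt.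
- have e2 := K_P2s s es.
  have := @cut_ge1 _ (cf s2 s) S F _ P2 xS PF.
  by rewrite (kbondW e2 ex) => h; have := leq_trans lt t12; rewrite ltnNge h.
Qed.

Lemma P_in_F : P \in F -> s = Sweak.
Proof.
move=> PF; have [_ _ dSF SF] := cSF.
have : shape (cf s2 s) P by rewrite SF inE PF orbT.
rewrite shape_kconf -/(K _ _ _) K_P.
have ex : K s2 s (at_ o 4 2) = Some k_x by rewrite KtipE.
have xS : at_ o 4 2 \in S by exact: tip_in_S.
move=> sp; case: (site_cases s) => es //; first by rewrite es in sp.
have e := K_Ps s2 es.
have := @cut_ge1 _ (cf s2 s) S F _ P xS PF.
by rewrite (kbondW e ex) => h; have := leq_trans lt t12; rewrite ltnNge h.
Qed.

(** The waiting tiles fall off one at a time: losing both would break two bonds of 8, and 16 exceeds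
    every temperature. *)
Lemma not_both : P2 \in F -> P \in F -> False.
Proof.
move=> P2F PF; have [es2 _] := P2_in_F P2F; have es := P_in_F PF.
have e2 := K_P2w s es2; have e := K_Pw s2 es; have [k0 e0 g0] := K_wall2 s2 s.
have ex : K s2 s (at_ o 2 2) = Some k_x2 by rewrite KtipE.
have xS : at_ o 2 2 \in S by exact: tip_in_S.
have := @cut_ge2 _ (cf s2 s) S F _ P2 _ P _ wall_in_S P2F xS PF.
rewrite xpair_eqE at_eq (kbondE e0 e2) (kbondE ex e) g0 => /(_ erefl) h.
by have := leq_trans lt t12; rewrite ltnNge (leq_trans _ h).
Qed.

(** Every weak cut breaks at least one bond of strength 8, namely that of a waiting tile to its
    west. So nothing falls off at temperature 8 or below. *)
Lemma low_cut : 8 < tau.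
Proof.
have [_ /fset0Pn[p pF] _ _] := cSF.
have [_ /(_ _ pF) [] ep] := cut_sites t12 cSF os lt; rewrite ep in pF.
  by have [_ /ltnW/ltnW/ltnW] := P2_in_F pF.
have e := K_Pw s2 (P_in_F pF).
have ex : K s2 s (at_ o 2 2) = Some k_x2 by rewrite KtipE.
have xS : at_ o 2 2 \in S by exact: tip_in_S.
have := @cut_ge1 _ (cf s2 s) S F _ P xS pF.
by rewrite (kbondE ex e) => h; apply: leq_ltn_trans lt.
Qed.

Lemma removed : restrict (cf s2 s) S =
  cf (if P2 \in F then Snone else s2) (if P \in F then Snone else s).
Proof.
have [_ _ dSF SF] := cSF.
have [inS inF] := cut_sites t12 cSF os lt.
have notS p : p \in F -> (p \in S) = false.
  move=> pF; apply/negP => pS; have := fdisjointP dSF _ pS; by rewrite pF.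
have out p : p \notin F -> p \notin S -> cf s2 s p = None.
  move=> nF nS; apply/eqP; rewrite -[_ == _]negbK -/(shape _ p) SF inE.
  by rewrite (negbTE nF) (negbTE nS).
apply: functional_extensionality => p; rewrite /restrict.
have [->|n2] := eqVneq p P2.
  case: (boolP (P2 \in F)) => PF.
    by rewrite notS // /cf /conf /kconf -/(K _ _ _) K_P2.
  case: ifP => PS.
    by rewrite /cf /conf /kconf -!/(K _ _ _) !K_P2.
  have := out P2 PF; rewrite PS => /(_ erefl).
  by rewrite /cf /conf /kconf -!/(K _ _ _) !K_P2 => ->.
have [->|n] := eqVneq p P.
  case: (boolP (P \in F)) => PF.
    by rewrite notS // /cf /conf /kconf -/(K _ _ _) K_P.
  case: ifP => PS.
    by rewrite /cf /conf /kconf -!/(K _ _ _) !K_P.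
  have := out P PF; rewrite PS => /(_ erefl).
  by rewrite /cf /conf /kconf -!/(K _ _ _) !K_P => ->.
have e : cf s2 s p = cf (if P2 \in F then Snone else s2) (if P \in F then Snone else s) p.
  by rewrite /cf /conf /kconf -!/(K _ _ _); congr omap; apply: K_other.
case: ifP => pS //; rewrite -e out ?pS //; apply/negP => /inF[] e'.
  by rewrite e' eqxx in n2.
by rewrite e' eqxx in n.
Qed.

End Cut.

Lemma cf_stable s2 s : stable 8 (cf s2 s).
Proof.
move=> S F c os; rewrite leqNgt; apply/negP => lt.
by have := low_cut (isT : 8 <= 12) c os lt.
Qed.

Lemma word_tip s2 s x :
  match colat (word bits s2 s) x with
  | T_p2 s' => x = Posz (1 + o) /\ s' = s2
  | T_p s' => x = Posz (3 + o) /\ s' = s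
  | C_seed => False
  | _ => True
  end.
Proof.
case: x => [i|//]; rewrite -[colat _ _]/(nth C_0 (pre bits ++ tip s2 s) i) nth_cat.
case: ifP => [lt|ge].
  pose Q c := match c with T_p2 _ | T_p _ | C_seed => false | _ => true end.
  have /(all_nthP C_0)/(_ _ lt) : all Q (pre bits) by apply: all_pre.
  by case: (nth _ _ _).
have e : i = i - size (pre bits) + (1 + o) by rewrite size_pre -/o in ge *; lia.
rewrite {2 3}e; case: (i - _) => [|[|[|[|a]]]] //=; last by rewrite nth_nil.
all: by split=> //; congr Posz; lia.
Qed.

Lemma pulse_attachable tau s2 s p t :
  tau = 12 \/ tau = 11 /\ s2 <> Snone -> attachable tau (cf s2 s) p t ->
  [/\ p = P2, s2 = Snone & t = tile_of k_b2] \/ [/\ p = P, s = Snone & t = tile_of k_b].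
Proof.
move=> ht /and3P[/used_tilesP[k ->] np le]; case: p np le => x y np le.
have Kp : K s2 s (x, y) = None by move: np; rewrite shape_kconf -/(K _ _ _); case: (K _ _ _).
have t0 : 0 < tau by case: ht => [|[]] ->.
have [yr|/(kw_far (word bits s2 s) x) [_ nn]] := boolP (y \in rows); last first.
  have e d : pull (cf s2 s) (x, y) (tile_of k) d = 0.
    by rewrite kconf_pull nn /= str_sym str_null.
  by move: le; rewrite attach_strengthE /sum4 !e leqNgt t0.
have chk : pulse_check tau (colat (word bits s2 s) (x - 1)%R) (colat (word bits s2 s) x)
    (colat (word bits s2 s) (x + 1)%R) y.
  case: ht => [->|[-> n2]].
    apply: (check3P pulse_checked12 (chained_word _ _ _)) => // x'.
    by have := word_tip s2 s x'; case: (colat _ _).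
  apply: (check3P pulse_checked11 (chained_word _ _ _)) => // x'.
  have := word_tip s2 s x'; case: (colat _ _) => //= s'.
  by case: s' n2 => // n2 [_ e]; rewrite -e in n2.
move: chk; rewrite /pulse_check -[cellz _ _]/(K s2 s (x, y)) Kp => /all_kindsP /(_ k).
have e d : str (side (tile_of k) d) (facing (colview (colat (word bits s2 s) (x - 1)%R)
     (colat (word bits s2 s) x) (colat (word bits s2 s) (x + 1)%R) y d) d) =
    pull (cf s2 s) (x, y) (tile_of k) d by rewrite kconf_pull kw_nbr.
rewrite /sum4 !e -[_ + _ + _ + _]/(sum4 (pull (cf s2 s) (x, y) (tile_of k))).
rewrite -attach_strengthE ltnNge le /=.
have := word_tip s2 s x; case: (colat _ _) => //= s'; case: s' => // -[-> <-].
  by case/andP => /eqP -> /eqP ->; left.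
by case/andP => /eqP -> /eqP ->; right.
Qed.

Lemma place_P2 s : place (cf Snone s) P2 (tile_of k_b2) = cf Sstrong s.
Proof.
apply: functional_extensionality => p; rewrite /place /cf /conf /kconf -!/(K _ _ _).
have [->|n2] := eqVneq p P2; first by rewrite K_P2.
have [->|n] := eqVneq p P; first by rewrite !K_P.
by rewrite (K_other Snone s Sstrong s n2 n).
Qed.

Lemma place_P s2 : place (cf s2 Snone) P (tile_of k_b) = cf s2 Sstrong.
Proof.
apply: functional_extensionality => p; rewrite /place /cf /conf /kconf -!/(K _ _ _).
have [->|n] := eqVneq p P; first by rewrite K_P.
have [->|n2] := eqVneq p P2; first by rewrite !K_P2.
by rewrite (K_other s2 Snone s2 Sstrong n2 n).
Qed.

Lemma conf_fset s2 s : exists D : {fset pos}, forall p, shape (cf s2 s) p = (p \in D).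
Proof.
pose L := [seq (Posz a, Posz b) | a <- iota 0 (size (word bits s2 s)), b <- iota 0 4].
exists (seq_fset tt [seq p <- L | isSome (K s2 s p)]) => p.
rewrite shape_kconf seq_fsetE mem_filter -/(K s2 s p) andb_idr // => Kp.
have [a [b e]] := kw_cases Kp; rewrite {}e in Kp *.
apply/allpairsP; exists (a, b); rewrite !mem_iota /=; split=> //.
  by rewrite ltnNge; apply/negP => ge; move: Kp; rewrite /K /kw /= nth_default // cell0.
by rewrite ltnNge; apply/negP => ge; move: Kp; rewrite /K /kw /= cell_big.
Qed.

Lemma cf_supertile s2 s : supertile (cf s2 s).
Proof.
have [D hD] := conf_fset s2 s.
exact: (stable_supertile (isT : 0 < 8) (@cf_stable s2 s) (conf_origin bits s2 s) hD).
Qed.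

(** The cut isolating [p] is weak, and what remains is again one of the configurations [cf], hence a
    supertile as [removal] demands. *)
Lemma remove_site tau s2 s p t : tau <= 12 -> p = P2 \/ p = P ->
  cf s2 s p = Some t -> attach_strength (cf s2 s) p t < tau ->
  exists B, removal tau (cf s2 s) B.
Proof.
move=> t12 hp cp lt; have [D hD] := conf_fset s2 s.
pose S := [fset q in D | q != p]%fset.
have po : origin != p by case: hp => ->; rewrite /origin /P2 /P /at_ xpair_eqE; lia.
have oD : origin \in D by rewrite -hD shape_kconf.
have cut : is_cut (cf s2 s) S [fset p]%fset.
  split.
  - by apply/fset0Pn; exists origin; rewrite !inE /= po oD.
  - by apply/fset0Pn; exists p; rewrite inE.
  - by apply/fdisjointP => q; rewrite !inE => /andP[].
  - move=> q; rewrite hD !inE /=; case: (eqVneq q p) => [->|_]; rewrite ?andbF ?andbT ?orbF //.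
    by rewrite -hD /shape cp.
have os : origin \in S by rewrite !inE /= po oD.
have lt' : cut_strength (cf s2 s) S [fset p]%fset < tau.
  exact: leq_ltn_trans (cut_le_attach _ cp) lt.
exists (restrict (cf s2 s) S), S, [fset p]%fset; split=> //.
by rewrite (removed t12 cut os lt'); apply: cf_supertile.
Qed.

Lemma nbr_at c j d : nbr (at_ o c.+1 j.+1) d =
  match d with dN => at_ o c.+1 j.+2 | dE => at_ o c.+2 j.+1
             | dS => at_ o c.+1 j | dW => at_ o c j.+1 end.
Proof. by case: d; congr pair => /=; lia. Qed.

Lemma attach_P2 s2 s t : attach_strength (cf s2 s) P2 t =
  str (east t) g_gb2 + str (south t) g_al2 + str (west t) g_ga2.
Proof.
have [k e0 g0] := K_wall2 s2 s.
rewrite attach_strengthE /sum4 !kconf_pull -/(K s2 s) !(nbr_at 0 1) e0 !KtipE //= g0.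
by rewrite (str_sym (north t)) str_null.
Qed.

Lemma attach_P s2 s t : attach_strength (cf s2 s) P t =
  str (east t) g_gb + str (south t) g_al + str (west t) g_ga.
Proof.
rewrite attach_strengthE /sum4 !kconf_pull -/(K s2 s) !(nbr_at 2 1) !KtipE //=.
by rewrite (str_sym (north t)) str_null.
Qed.

(** During a pulse a cell passes from weak through empty to strong and never back, so the sum over
    both cells decreases. *)
Definition pending (ot : option (tile gl)) :=
  if ot is Some t then
    if (t == tile_of k_a2) || (t == tile_of k_a) then 2 else 0
  else 1.

Lemma cf_P2 s2 s : cf s2 s P2 = omap tile_of (site_kind s2 k_a2 k_b2).
Proof. by rewrite /cf /conf /kconf -/(K _ _ _) K_P2. Qed.

Lemma cf_P s2 s : cf s2 s P = omap tile_of (site_kind s k_a k_b).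
Proof. by rewrite /cf /conf /kconf -/(K _ _ _) K_P. Qed.

Theorem pulse i (b : bool) : 0 < i ->
  phase_yields i (11 + b) (cf Sweak Sweak) (cf (if b then Sstrong else Sweak) Sstrong).
Proof.
move=> i0; have t12 : 11 + b <= 12 by case: b.
(* Unless the bit is 1, the second cell never leaves its weak state. *)
apply: (@phase_yields_inv _ _ _ _ _
  (fun B => exists s2 s, B = cf s2 s /\ (b \/ s2 = Sweak))
  (fun B => pending (B P2) + pending (B P))).
- by exists Sweak, Sweak; split => //; right.
- move=> B C [s2 [s [-> hb]]] [[p [t [at_p ->]]]|[_ [S [F [c os lt -> _]]]]].
    have ht : 11 + b = 12 \/ 11 + b = 11 /\ s2 <> Snone.
      by case: (b) hb => [_|[//|->]]; [left | right].
    have [[-> e2 ->]|[-> es ->]] := pulse_attachable ht at_p.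
      rewrite {}e2 in hb *; rewrite place_P2 !cf_P2 !cf_P; split=> //.
      by exists Sstrong, s; split=> //; case: hb => // hb; left.
    rewrite {}es; rewrite place_P !cf_P2 !cf_P; split; first by exists s2, Sstrong.
    by rewrite ltn_add2l.
  rewrite (removed t12 c os lt); have [_ inF] := cut_sites t12 c os lt.
  have [_ /fset0Pn[p pF] _ _] := c.
  have [P2F|P2F] := boolP (P2 \in F).
    have PF : (P \in F) = false by apply/negP => /(not_both t12 c os lt P2F).
    have [es2 t11] := P2_in_F t12 c os lt P2F.
    rewrite PF !cf_P2 !cf_P es2; split=> //; exists Snone, s; split=> //.
    by left; case: (b) t11.
  have PF : P \in F by case: (inF _ pF) => e; rewrite e ?(negbTE P2F) in pF.
  have es := P_in_F t12 c os lt PF.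
  rewrite PF !cf_P2 !cf_P es ltn_add2l; split=> //.
  by exists s2, Snone.
- move=> B [s2 [s [-> hb]]] term.
  have es : s = Sstrong.
    case: (site_cases s) => // es; exfalso.
      (* [k_a] holds with 8 + 2 = 10, below both pulse temperatures. *)
      have [|||C rem] := @remove_site (11 + b) s2 s P (tile_of k_a) t12.
      - by right.
      - by rewrite cf_P es.
      - by rewrite attach_P; case: (b).
      by apply: (term C); right.
    apply: (term (place (cf s2 s) P (tile_of k_b))); left.
    exists P, (tile_of k_b); split=> //; apply/and3P; split.
    - by apply/used_tilesP; exists k_b.
    - by rewrite /shape cf_P es.
    - by rewrite attach_P; case: (b).
  rewrite es; congr (cf _ _); have [eb|eb] := boolP b; last first.
    by case: hb => // hb; rewrite hb in eb.
  case: (site_cases s2) => // es2; exfalso.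
    (* The bit is 1, so the temperature is 12, and [k_a2] holds with 8 + 3 = 11. *)
    have [|||C rem] := @remove_site (11 + b) s2 s P2 (tile_of k_a2) t12.
    - by left.
    - by rewrite cf_P2 es2.
    - by rewrite attach_P2 eb.
    by apply: (term C); right.
  apply: (term (place (cf s2 s) P2 (tile_of k_b2))); left.
  exists P2, (tile_of k_b2); split=> //; apply/and3P; split.
  - by apply/used_tilesP; exists k_b2.
  - by rewrite /shape cf_P2 es2.
  - by rewrite attach_P2 eb.
Qed.

End Pulse.

Lemma allin_word (Q : pred col) bits s2 s : Q C_0 -> Q C_init ->
  (forall b, all Q [:: C_p2 b; C_x2; C_p; C_x; C_w]) ->
  Q (T_p2 s2) -> Q T_x2 -> Q (T_p s) -> Q T_x -> allin (word bits s2 s) Q.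
Proof.
move=> h0 h1 h2 h3 h4 h5 h6; rewrite /allin /word all_cat h0 andbT; apply/andP; split.
  by apply: all_pre => //; apply/allP => b _; apply: h2.
by rewrite /= h3 h4 h5 h6.
Qed.

Theorem strip_step i bits b :
  phase_yields i 8 (conf bits (if b then Sstrong else Sweak) Sstrong)
    (conf (rcons bits b) Sweak Sweak) /\
  stable 8 (conf (rcons bits b) Sweak Sweak).
Proof.
apply: strip_grow; rewrite ?chained_word //.
- by apply: allin_word => //; case: b.
- exact: allin_word.
- rewrite /word pre_rcons -catA; apply: colat_pre_cat; first by case.
  by do 9?[case=> //]; move=> *; case: b; rewrite /= ?nth_nil.
- exact: cf_stable.
Qed.

Lemma seed_configE : seed_config sys = kconf (kw [:: C_seed]).
Proof.
apply: functional_extensionality => -[x y]; rewrite /seed_config /kconf.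
case: x => [[|a]|a]; last by rewrite /kw /= cellz0.
- by case: y => [[|j]|j].
- by rewrite /kw /= nth_nil cellz0.
Qed.

Theorem strip_start :
  phase_yields 0 8 (seed_config sys) (conf [::] Sweak Sweak) /\
  stable 8 (conf [::] Sweak Sweak).
Proof.
rewrite seed_configE; apply: strip_grow => //; last exact: seed_stable.
case=> [a|//]; rewrite /word /=.
by do 6?[case: a => [//|a]].
Qed.

(** * The counter and the square *)

Definition bitn a n := odd (n %/ 2 ^ a).

Lemma bitnS a n : bitn a n.+1 = bitn a n (+) (2 ^ a %| n.+1).
Proof. by rewrite /bitn divnS ?expn_gt0 // oddD addbC; case: (_ %| _). Qed.

(** Divisibility of [n.+1] by [2 ^ a] is the carry into the bit of weight [2 ^ a]; this closed form
    replaces a recursion along the columns. *)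
Lemma carryS a n : (2 ^ a.+1 %| n.+1) = bitn a n && (2 ^ a %| n.+1).
Proof.
have [dv|ndv] := boolP (2 ^ a %| n.+1); last first.
  rewrite andbF; apply/negP => /(dvdn_trans (dvdn_exp2l 2 (leqnSn a))).
  by rewrite (negbTE ndv).
rewrite andbT expnS -(divnK dv) dvdn_pmul2r ?expn_gt0 // dvdn2.
by rewrite divnS ?expn_gt0 // dv add1n /= negbK.
Qed.

Lemma nbrN X j : nbr (Posz X, Posz j) dN = (Posz X, Posz j.+1).
Proof. by congr pair => /=; lia. Qed.
Lemma nbrE X y : nbr (Posz X, y) dE = (Posz X.+1, y).
Proof. by congr pair => /=; lia. Qed.
Lemma nbrS X j : nbr (Posz X, Posz j.+1) dS = (Posz X, Posz j).
Proof. by congr pair => /=; lia. Qed.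
Lemma nbrS0 X : nbr (Posz X, Posz 0) dS = (Posz X, Negz 0).
Proof. by []. Qed.
Lemma nbrW X y : nbr (Posz X.+1, y) dW = (Posz X, y).
Proof. by congr pair => /=; lia. Qed.
Lemma nbrNn X d : nbr (Posz X, Negz d.+1) dN = (Posz X, Negz d).
Proof. by congr pair => /=; lia. Qed.
Lemma nbrNn0 X : nbr (Posz X, Negz 0) dN = (Posz X, Posz 0).
Proof. by []. Qed.
Lemma nbrSn X d : nbr (Posz X, Negz d) dS = (Posz X, Negz d.+1).
Proof. by congr pair => /=; lia. Qed.

(* Role of a column in the counter: [cBit a] holds the bit of weight [2 ^ a], and
   [cBlank a] is crossed by the carry into that weight. *)
Inductive ccls := cWest | cP | cBit of nat | cBlank of nat | cEast.

(** * The final configuration *)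

Section Final.

Variables (k v N : nat) (pb : bool).
Hypothesis N0 : 0 < N.
Hypothesis vN : v + N = 2 ^ k.

(** Unit 0 holds the parity bit, unit [u] the bit of weight [2 ^ (k - u)]: the carry runs west
    towards the more significant bits. *)
Definition bits := pb :: [seq bitn (k - u) v | u <- iota 1 k].
Definition W := 5 * k + 10.
(** One copying row, [N] increments, [N - 1] returns between them, and a closing row if the parity
    bit is set. *)
Definition R := 2 * N + pb.
Definition sword := word bits Sweak Sweak.

Lemma size_bits : size bits = k.+1.
Proof. by rewrite /= size_map size_iota. Qed.

(** Unit [u] has its bit in column [5 * u + 1]. The columns of the tip give [u = k + 1], where
    [k - u] truncates to 0: they transmit the carry into the lowest bit, which is always 1. *)
Definition cls X :=
  if X == 0 then cWest else if X.+1 == W then cEast else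
  let u := (X.-1) %/ 5 in
  if ((X.-1) %% 5 == 0) && (u <= k) then if u == 0 then cP else cBit (k - u)
  else cBlank (k - u).

Definition convk X :=
  match cls X with
  | cWest => k_CW | cP => k_Cp pb | cBit a => k_Cb (bitn a v)
  | cBlank _ => k_Cn | cEast => k_CE
  end.

(** The increment number [t], counted from 1, turns [v + t.-1] into [v + t]; overflow happens at
    [t = N]. *)
Definition inck t X :=
  match cls X with
  | cWest => if t < N then k_IW else k_IWz pb
  | cP => k_Ip (2 ^ k %| v + t) pb
  | cBit a => k_Ib (2 ^ a %| v + t) (bitn a (v + t.-1))
  | cBlank a => k_In (2 ^ a %| v + t)
  | cEast => k_IE
  end.

Definition retk t X :=
  match cls X with
  | cWest => k_RW | cP => k_Rp pb | cBit a => k_Rb (bitn a (v + t))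
  | cBlank _ => k_Rn | cEast => k_RE
  end.

Definition fink X :=
  match cls X with
  | cWest => k_TW | cP => k_Tp | cBit _ => k_Tb | cBlank _ => k_Tn | cEast => k_TE
  end.

Definition countk r X :=
  if r == 0 then convk X else if odd r then inck r.+1./2 X
  else if r < 2 * N then retk r./2 X else fink X.

Definition stripk X j :=
  if cell (nth C_0 sword X) j is Some q then q else if X.+1 == W then k_fe else k_ff.

Definition southk d X :=
  if X < 4 + d then if d == 0 then nth k_K0 [:: k_K0; k_K1; k_K2; k_K3] X else k_L'
  else if X == 4 + d then if d == 0 then k_K4 else k_D'
  else if X == 5 + d then k_U1' else k_U'.

Definition eastk m j :=
  if j < 4 + m then k_L else if j == 4 + m then k_D
  else if j == 5 + m then k_U1 else k_U.

Definition KZ (p : pos) : option kind :=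
  match p.1 with
  | Posz X =>
      if X < W then
        match p.2 with
        | Posz j => if j < 4 then Some (stripk X j)
                    else if j - 4 < R then Some (countk (j - 4) X) else None
        | Negz d => if d < W - 4 then Some (southk d X) else None
        end
      else if X - W < R then
        match p.2 with
        | Posz j => if j < 4 + R then Some (eastk (X - W) j) else None
        | Negz d => if d < W - 4 then
                      Some (if (X == W) && (d.+1 == W - 4) then k_L0 else k_L)
                    else None
        end
      else None
  | Negz _ => None
  end.

(** * Glues shown by the neighbours of a cell *)

Lemma R2 : 1 < R. Proof. by rewrite /R; lia. Qed.

Lemma KZ_strip X j : X < W -> j < 4 -> KZ (Posz X, Posz j) = Some (stripk X j).
Proof. by rewrite /KZ /= => -> ->. Qed.

Lemma KZ_count X r : X < W -> r < R -> KZ (Posz X, Posz r.+4) = Some (countk r X).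
Proof. by rewrite /KZ /= => ->; rewrite !subSS subn0 => ->. Qed.

Lemma KZ_top X j : R.+4 <= j -> KZ (Posz X, Posz j) = None.
Proof. by rewrite /KZ /= => h; do 4?[case: ifP => ?] => //; exfalso; lia. Qed.

Lemma KZ_south X d : X < W -> d < W - 4 -> KZ (Posz X, Negz d) = Some (southk d X).
Proof. by rewrite /KZ /= => -> ->. Qed.

Lemma KZ_bottom X d : W - 4 <= d -> KZ (Posz X, Negz d) = None.
Proof. by rewrite /KZ /= leqNgt => /negbTE ->; rewrite !if_same. Qed.

Lemma KZ_east m j : m < R -> j < R.+4 -> KZ (Posz (W + m), Posz j) = Some (eastk m j).
Proof.
rewrite /KZ /= => hm hj; rewrite ifF; last by apply/negP; lia.
by rewrite addKn hm ifT.
Qed.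

Lemma KZ_east' m d : m < R -> d < W - 4 -> KZ (Posz (W + m), Negz d) =
  Some (if (m == 0) && (d.+1 == W - 4) then k_L0 else k_L).
Proof.
rewrite /KZ /= => hm hd; rewrite ifF; last by apply/negP; lia.
by rewrite addKn hm hd -{2}[W]addn0 eqn_add2l.
Qed.

Lemma KZ_right X y : W + R <= X -> KZ (Posz X, y) = None.
Proof. by rewrite /KZ /= => h; rewrite !ifF //; apply/negP; lia. Qed.

Lemma clsP X : X < W ->
  [\/ X = 0 /\ cls X = cWest,
      X = 1 /\ cls X = cP,
      exists u, [/\ 0 < u <= k, X = 5 * u + 1 & cls X = cBit (k - u)] |
      (exists u c, [/\ 0 < c < 5, u <= k, X = 5 * u + c + 1 & cls X = cBlank (k - u)]) \/
      (exists2 c, c < 3 & X = 5 * k + 6 + c /\ cls X = cBlank 0) \/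
      (X.+1 = W /\ cls X = cEast)].
Proof.
move=> lt; rewrite /cls; case: (eqVneq X 0) => [|X0]; first by constructor 1.
case: (eqVneq X.+1 W) => [e|nW]; first by constructor 4; right; right.
case: ifP => [/andP[/eqP h5 le]|h].
  case: (eqVneq (X.-1 %/ 5) 0) => [e|n0]; first by constructor 2; split => //; lia.
  by constructor 3; exists (X.-1 %/ 5); split=> //; lia.
have [le|gt] := leqP (X.-1 %/ 5) k.
  rewrite le andbT in h; constructor 4; left; exists (X.-1 %/ 5), (X.-1 %% 5).
  by split=> //; lia.
constructor 4; right; left; exists (X - (5 * k + 6)); rewrite /W in lt nW; first by lia.
by split; [lia | congr cBlank; lia].
Qed.

Lemma nth_pre bs u c : u < size bs -> c < 5 ->
  nth C_0 (pre bs) (5 * u + c).+1 =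
  nth C_0 [:: C_p2 (nth false bs u); C_x2; C_p; C_x; C_w] c.
Proof.
rewrite /=; elim: bs u => // b bs IH [|u] lt c5.
  by rewrite muln0 add0n; case: c c5 {IH} => [|[|[|[|[|]]]]].
have -> : 5 * u.+1 + c = (5 * u + c).+4.+1 by lia.
exact: IH.
Qed.

Lemma sword_unit u c : u <= k -> c < 5 -> nth C_0 sword (5 * u + c + 1) =
  nth C_0 [:: C_p2 (nth false bits u); C_x2; C_p; C_x; C_w] c.
Proof.
move=> uk c5; rewrite addn1 /sword /word nth_cat size_pre size_bits ifT; last by lia.
by rewrite nth_pre // size_bits.
Qed.

Lemma sword_tip c : nth C_0 sword (5 * k + 6 + c) = nth C_0 (tip Sweak Sweak) c.
Proof.
rewrite /sword /word nth_cat size_pre size_bits ifF; last by apply/negP; lia.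
by congr nth; lia.
Qed.

Lemma bits_nth u : 0 < u <= k -> nth false bits u = bitn (k - u) v.
Proof.
case: u => // u h; rewrite /= (nth_map 0) ?size_iota; last by lia.
by rewrite nth_iota; [congr bitn; lia | lia].
Qed.

Definition topg X :=
  match cls X with
  | cWest => g_gw | cP => g_n pb | cBit a => g_n (bitn a v)
  | cBlank _ => g_nb | cEast => g_me
  end.

Lemma stripk_top X : X < W -> upfacing (Some (stripk X 3)) dS = topg X.
Proof.
move=> lt; rewrite /topg /stripk; case: (clsP lt).
- by case=> -> ->.
- by case=> -> ->; rewrite (@sword_unit 0 0).
- case=> u [h -> ->]; rewrite -[5 * u]addn0 sword_unit //=; last by lia.
  by rewrite bits_nth.
case; first by case=> u [c [h1 h2 -> ->]]; rewrite sword_unit //=; [case: c h1 => [|[|[|[|[|]]]]] | lia].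
case.
  case=> c c3 [e ->]; rewrite ifF; last by apply/negP; rewrite /W; lia.
  by rewrite e sword_tip; case: c c3 {e} => [|[|[|]]].
case=> e ->; rewrite e eqxx (_ : X = 5 * k + 6 + 3) ?sword_tip //.
by rewrite /W in e; lia.
Qed.

Lemma stripk_bottom X : 0 < X < W -> upfacing (Some (stripk X 0)) dN = g_e'.
Proof.
case/andP=> X0 lt; rewrite /stripk; case: (clsP lt).
- by case=> e; rewrite e in X0.
- by case=> -> _; rewrite (@sword_unit 0 0).
- by case=> u [h -> _]; rewrite -[5 * u]addn0 sword_unit //=; lia.
case; first by case=> u [c [h1 h2 -> _]]; rewrite sword_unit //=; [case: c h1 => [|[|[|[|[|]]]]] | lia].
case.
  by case=> c c3 [e _]; rewrite e sword_tip; case: c c3 {e} => [|[|[|]]].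
by case=> e _; rewrite (_ : X = 5 * k + 6 + 3) ?sword_tip //; rewrite /W in e; lia.
Qed.

Lemma stripk_east j : j < 4 -> upfacing (Some (stripk W.-1 j)) dW = g_e.
Proof.
move=> j4; rewrite /stripk (_ : W.-1 = 5 * k + 6 + 3) ?sword_tip; last by rewrite /W; lia.
rewrite (_ : (_.+1 == W) = true); last by rewrite /W; lia.
by case: j j4 => [|[|[|[|]]]].
Qed.

Lemma cell_sword_None X j : X < W -> j < 4 -> cell (nth C_0 sword X) j = None ->
  j = 3 /\ exists2 c, c < 4 & X = 5 * k + 6 + c.
Proof.
move=> lt j4; case: (clsP lt).
- by case=> -> _; case: j j4 => [|[|[|[|]]]].
- by case=> -> _; rewrite (@sword_unit 0 0) //; case: j j4 => [|[|[|[|]]]].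
- case=> u [h -> _]; rewrite -[5 * u]addn0 sword_unit //=; last by lia.
  by case: j j4 => [|[|[|[|]]]].
case.
  case=> u [c [h1 h2 -> _]]; rewrite sword_unit //=; last by lia.
  by case: c h1 => [|[|[|[|[|]]]]] //; case: j j4 => [|[|[|[|]]]].
case.
  case=> c c3 [e _]; rewrite e sword_tip => h; split; last by exists c => //; lia.
  by case: c c3 h {e} => [|[|[|]]] //; case: j j4 => [|[|[|[|]]]].
case=> e _; rewrite (_ : X = 5 * k + 6 + 3) ?sword_tip; last by rewrite /W in e; lia.
by case: j j4 => [|[|[|[|]]]] // _ _; split=> //; exists 3.
Qed.

Lemma countk0 X : countk 0 X = convk X. Proof. by []. Qed.

Lemma countk_inc t X : countk (2 * t).+1 X = inck t.+1 X.
Proof.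
rewrite /countk /= mul2n odd_double /=; congr inck.
by rewrite doubleK.
Qed.

Lemma countk_ret t X : 0 < t < N -> countk (2 * t) X = retk t X.
Proof.
move=> h; rewrite /countk ifF; last by apply/negP; lia.
rewrite {1}mul2n odd_double ifT; last by lia.
by rewrite mul2n doubleK.
Qed.

Lemma countk_fin X : countk (2 * N) X = fink X.
Proof.
rewrite /countk ifF; last by apply/negP; lia.
by rewrite {1}mul2n odd_double ltnn.
Qed.

Lemma rowP r : r < R -> [\/ r = 0, exists2 t, t < N & r = (2 * t).+1,
  exists2 t, 0 < t < N & r = 2 * t | pb /\ r = 2 * N].
Proof.
rewrite /R => lt; case: (eqVneq r 0) => [->|r0]; first by constructor 1.
have [o|e] := boolP (odd r); first by constructor 2; exists r./2; lia.
have [lt'|ge] := ltnP r (2 * N); first by constructor 3; exists r./2; lia.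
by constructor 4; case: (pb) lt; split=> //; lia.
Qed.

Definition rowg wst est n X :=
  match cls X with
  | cWest => wst | cP => g_p pb | cBit a => g_n (bitn a n)
  | cBlank _ => g_nb | cEast => est
  end.

Lemma countk_dN r X : upfacing (Some (countk r X)) dN = g_null.
Proof.
rewrite /countk /convk /inck /retk /fink.
by case: (cls X) => [||a|a|]; do 3?[case: ifP => _].
Qed.

Lemma up_dN r X : X < W -> upfacing (KZ (Posz X, Posz r.+4)) dN = g_null.
Proof.
move=> XW; have [lt|ge] := ltnP r R; last by rewrite KZ_top.
by rewrite KZ_count // countk_dN.
Qed.

Lemma up_inc_dS t X : X < W -> t < N -> upfacing (KZ (Posz X, Posz (2 * t).+4)) dS =
  rowg g_mw g_ib (v + t) X.
Proof.
move=> XW tN; rewrite KZ_count // ?/R; last by lia.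
case: t tN => [|t] tN.
  by rewrite muln0 countk0 addn0 /convk /rowg; case: (cls X).
by rewrite countk_ret; [rewrite /retk /rowg; case: (cls X) | lia].
Qed.

Lemma up_ret_dS t X : X < W -> t < N -> upfacing (KZ (Posz X, Posz (2 * t).+1.+4)) dS =
  rowg (if t.+1 < N then g_rw else if pb then g_rwf else g_null) g_me (v + t.+1) X.
Proof.
move=> XW tN; rewrite KZ_count // ?/R; last by lia.
rewrite countk_inc /inck /rowg; case: (cls X) => [||a|a|] //.
  by case: (t.+1 < N).
by rewrite /= addnS bitnS.
Qed.

Lemma up_east m y : upfacing (KZ (Posz (W + m), y)) dE = g_null.
Proof.
have [lt|ge] := ltnP m R; last by rewrite KZ_right //; lia.
case: y => [j|d].
  have [lt'|ge] := ltnP j R.+4; last by rewrite KZ_top.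
  by rewrite KZ_east // /eastk; do 3?[case: ifP => _].
have [lt'|ge] := ltnP d (W - 4); last by rewrite KZ_bottom.
by rewrite KZ_east' //; case: ifP.
Qed.

Lemma up_eastW y : upfacing (KZ (Posz W, y)) dE = g_null.
Proof. by rewrite -[W]addn0 up_east. Qed.

(** Only increments run from east to west; in the other rows the eastern neighbour is attached
    through this cell and is masked. *)
Lemma up_conv_dE X y : X < W -> upfacing (KZ (Posz X.+1, Posz y.+4)) dE <> g_null ->
  odd y.
Proof.
move=> XW; have [e|n] := eqVneq X.+1 W; first by rewrite e up_eastW.
have [lt|ge] := ltnP y R; last by rewrite KZ_top.
have XW' : X.+1 < W by lia.
rewrite KZ_count // /countk; case: ifP => [_|_].
  by rewrite /convk; case: (clsP XW'); rewrite /cls; case: ifP => // _; case: ifP => // _;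
    case: ifP => // _; case: ifP.
case: ifP => // _.
by rewrite /retk /fink /cls; case: ifP => // _; case: ifP => // _;
    case: ifP => // _; case: ifP => // _; case: ifP.
Qed.

Lemma up_even_dE X r : X < W -> ~~ odd r ->
  upfacing (KZ (Posz X.+1, Posz r.+4)) dE = g_null.
Proof.
move=> XW /negP o; apply/eqP/negPn/negP => /eqP h.
by apply: o; apply: up_conv_dE h.
Qed.

(** A positive number not exceeding [2 ^ k] is a multiple of it only when equal to it. *)
Lemma inck_dvd t : 0 < t <= N -> (2 ^ k %| v + t) = (t == N).
Proof.
move=> h; apply/idP/eqP => [dv|->]; last by rewrite vN.
have := dvdn_leq _ dv; rewrite -vN; lia.
Qed.

(** Blank columns transmit the carry; at a bit the equality is [carryS], and at the western end it
    says that overflow occurs in the last increment exactly. *)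
Lemma inck_wire t X : 0 < t <= N -> X.+1 < W ->
  west (tile_of (inck t X.+1)) = east (tile_of (inck t X)).
Proof.
move=> ht XW; have XW0 : X < W by lia.
have cE u c : 0 < u -> u <= k -> c = 5 * u + 1 -> cls c = cBit (k - u).
  move=> u0 uk ->; rewrite /cls ifF; last by apply/negP; lia.
  rewrite ifF; last by apply/negP; rewrite /W; lia.
  rewrite ifT; last by lia.
  by rewrite ifF; [congr cBit; lia | apply/negP; lia].
rewrite /inck; case: (clsP XW).
- by case.
- case=> e ->; have -> : X = 0 by lia.
  rewrite /= inck_dvd //; have [->|n] := eqVneq t N; first by rewrite ltnn.
  by rewrite ifT //; lia.
- case=> u [hu e ->].
  have -> : cls X = cBlank (k - u.-1).
    rewrite /cls ifF; last by apply/negP; lia.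
    rewrite ifF; last by apply/negP; lia.
    rewrite ifF; last by apply/negP; lia.
    by congr cBlank; lia.
  rewrite /=; congr g_i.
  have -> : k - u.-1 = (k - u).+1 by lia.
  have -> : v + t = (v + t.-1).+1 by lia.
  by rewrite carryS.
- case.
    case=> u [c [hc uk e ->]] /=.
    have [c1|c1] := eqVneq c 1.
      have eX : X = 5 * u + 1 by lia.
      have [u0|u0] := posnP u.
        have -> : cls X = cP.
          by rewrite eX u0 /cls /= ifF //; apply/negP; rewrite /W; lia.
        by rewrite /= u0 subn0.
      by rewrite (cE u) //=; lia.
    have -> : cls X = cBlank (k - u).
      rewrite /cls ifF; last by apply/negP; lia.
      rewrite ifF; last by apply/negP; lia.
      rewrite ifF; last by apply/negP; lia.
      by congr cBlank; lia.
    by [].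
  case.
    case=> c c3 [e ->]; rewrite /= dvd1n.
    have -> : cls X = cBlank 0.
      rewrite /cls ifF; last by apply/negP; lia.
      rewrite ifF; last by apply/negP; lia.
      rewrite ifF; last by apply/negP; lia.
      by congr cBlank; lia.
    by rewrite /= dvd1n.
  case=> e ->; have -> : cls X = cBlank 0.
    rewrite /W in e; rewrite /cls ifF; last by apply/negP; lia.
    rewrite ifF; last by apply/negP; lia.
    rewrite ifF; last by apply/negP; lia.
    by congr cBlank; lia.
  by rewrite /= dvd1n.
Qed.

(** * The local condition in the counter *)

Lemma R_gt0 : 0 < R. Proof. exact: ltnW R2. Qed.

Let ok p := okcell 7 (KZ p) (fun d => KZ (nbr p d)).

Lemma west_dE X t : 0 < X -> X < W ->
  upfacing (Some (inck t X)) dE = west (tile_of (inck t X)).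
Proof.
move=> X0 XW; rewrite /inck /cls ifF; last by apply/negP; lia.
by case: ifP => // _; case: ifP => // _; case: ifP.
Qed.

Lemma inck_dW X t : X.+1 < W -> upfacing (Some (inck t X)) dW = g_null.
Proof.
move=> XW; rewrite /inck /cls; case: ifP => _; first by case: ifP.
rewrite ifF; last by apply/negP; lia.
by case: ifP => // _; case: ifP.
Qed.

Lemma conv_ok X : X < W -> ok (Posz X, Posz 4).
Proof.
move=> XW; rewrite /ok (KZ_count XW R_gt0) countk0.
have s : upfacing (KZ (nbr (Posz X, Posz 4) dS)) dS = topg X.
  by rewrite nbrS KZ_strip // stripk_top.
have n : upfacing (KZ (nbr (Posz X, Posz 4) dN)) dN = g_null.
  by rewrite nbrN (@up_dN 1).
have e : upfacing (KZ (nbr (Posz X, Posz 4) dE)) dE = g_null.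
  by rewrite nbrE (@up_even_dE X 0).
(* [g_c false] leaves the westernmost tile only and singles out the next column as that of the
   parity bit. *)
have w : upfacing (KZ (nbr (Posz X, Posz 4) dW)) dW =
    match X with 0 => g_null | X'.+1 => g_c (X' != 0) end.
  case: X XW {s n e} => [|X] XW //; rewrite nbrW (@KZ_count X 0) ?R_gt0 //; last by lia.
  rewrite countk0 /convk /cls; case: (eqVneq X 0) => // X0.
  rewrite ifF; last by apply/negP; lia.
  case: ifP => // /andP[h5 le]; case: ifP => // /eqP h0; lia.
apply: okcell_view n e s w _; rewrite /topg /convk; case: (clsP XW).
- by case=> -> ->; vm_compute.
- by case=> -> ->; case: (pb); vm_compute.
- case=> u [hu -> ->]; rewrite addn1 (_ : 5 * u != 0) /=; last by lia.
  by case: (bitn _ _); vm_compute.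
- case.
    case=> u [c [hc hu -> ->]]; rewrite addn1 (_ : 5 * u + c != 0) /=; last by lia.
    by vm_compute.
  case.
    case=> c hc [-> ->]; rewrite (_ : 5 * k + 6 + c = (5 * k + 5 + c).+1); last by lia.
    by rewrite (_ : 5 * k + 5 + c != 0) /=; [vm_compute | lia].
  case=> e' ->; rewrite (_ : X = (5 * k + 8).+1); last by rewrite /W in e'; lia.
  by rewrite (_ : 5 * k + 8 != 0); [vm_compute | lia].
Qed.

Lemma inc_ok t X : t < N -> X < W -> ok (Posz X, Posz (2 * t).+1.+4).
Proof.
move=> tN XW; have rR : (2 * t).+1 < R by rewrite /R; lia.
rewrite /ok KZ_count // countk_inc.
have s : upfacing (KZ (nbr (Posz X, Posz (2 * t).+1.+4) dS)) dS =
    rowg g_mw g_ib (v + t) X by rewrite nbrS up_inc_dS.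
have n : upfacing (KZ (nbr (Posz X, Posz (2 * t).+1.+4) dN)) dN = g_null.
  by rewrite nbrN (@up_dN (2 * t).+2).
have e : upfacing (KZ (nbr (Posz X, Posz (2 * t).+1.+4) dE)) dE =
    if X.+1 == W then g_null else east (tile_of (inck t.+1 X)).
  rewrite nbrE; case: eqP => [->|n']; first exact: up_eastW.
  rewrite KZ_count // ?countk_inc; last by lia.
  by rewrite west_dE ?inck_wire //; lia.
have w : upfacing (KZ (nbr (Posz X, Posz (2 * t).+1.+4) dW)) dW = g_null.
  case: X XW {s n e} => [|X] XW //; rewrite nbrW KZ_count ?countk_inc ?inck_dW //; lia.
apply: okcell_view n e s w _; rewrite /rowg /inck; case: (clsP XW).
- case=> -> ->; rewrite (_ : (1 == W) = false); last by apply/negP; rewrite /W; lia.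
  by case: (t.+1 < N); [vm_compute | case: (pb); vm_compute].
- case=> -> ->; rewrite ifF; last by apply/negP; rewrite /W; lia.
  by case: (_ %| _); case: (pb); vm_compute.
- case=> u [hu -> ->]; rewrite ifF; last by apply/negP; rewrite /W; lia.
  by rewrite /=; case: (_ %| _); case: (bitn _ _); vm_compute.
- case.
    case=> u [c [hc hu -> ->]]; rewrite ifF; last by apply/negP; rewrite /W; lia.
    by case: (_ %| _); vm_compute.
  case.
    case=> c hc [-> ->]; rewrite ifF; last by apply/negP; rewrite /W; lia.
    by case: (_ %| _); vm_compute.
  by case=> -> ->; rewrite eqxx; vm_compute.
Qed.

Lemma ret_ok t X : 0 < t < N -> X < W -> ok (Posz X, Posz (2 * t).+4).
Proof.
move=> tN XW; have rR : 2 * t < R by rewrite /R; lia.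
have e2 : 2 * t = (2 * t.-1).+2 by lia.
rewrite /ok KZ_count // countk_ret //.
have s : upfacing (KZ (nbr (Posz X, Posz (2 * t).+4) dS)) dS =
    rowg g_rw g_me (v + t) X.
  rewrite e2 nbrS up_ret_dS //; last by lia.
  rewrite prednK; last by lia.
  by rewrite ifT //; lia.
have n : upfacing (KZ (nbr (Posz X, Posz (2 * t).+4) dN)) dN = g_null.
  by rewrite nbrN (@up_dN (2 * t).+1).
have e : upfacing (KZ (nbr (Posz X, Posz (2 * t).+4) dE)) dE = g_null.
  by rewrite nbrE up_even_dE // mul2n odd_double.
have w : upfacing (KZ (nbr (Posz X, Posz (2 * t).+4) dW)) dW =
    if X == 0 then g_null else g_ret.
  case: X XW {s n e} => [|X] XW //; rewrite nbrW KZ_count //; last by lia.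
  rewrite countk_ret // /retk /cls; case: ifP => // _.
  rewrite ifF; last by apply/negP; lia.
  by case: ifP => // _; case: ifP.
apply: okcell_view n e s w _; rewrite /rowg /retk; case: (clsP XW).
- by case=> -> ->; vm_compute.
- by case=> -> ->; case: (pb); vm_compute.
- case=> u [hu -> ->]; rewrite ifF; last by apply/negP; lia.
  by case: (bitn _ _); vm_compute.
- case.
    by case=> u [c [hc hu -> ->]]; rewrite ifF; [vm_compute | apply/negP; lia].
  case.
    by case=> c hc [-> ->]; rewrite ifF; [vm_compute | apply/negP; lia].
  by case=> e' ->; rewrite ifF; [vm_compute | apply/negP; rewrite /W in e'; lia].
Qed.

Lemma fin_ok X : pb -> X < W -> ok (Posz X, Posz (2 * N).+4).
Proof.
move=> hp XW; have rR : 2 * N < R by rewrite /R hp; lia.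
have e2 : 2 * N = (2 * N.-1).+2 by lia.
rewrite /ok KZ_count // countk_fin //.
have s : upfacing (KZ (nbr (Posz X, Posz (2 * N).+4) dS)) dS =
    rowg g_rwf g_me (v + N) X.
  rewrite e2 nbrS up_ret_dS //; last by lia.
  rewrite prednK; last by lia.
  by rewrite ltnn hp.
have n : upfacing (KZ (nbr (Posz X, Posz (2 * N).+4) dN)) dN = g_null.
  by rewrite nbrN (@up_dN (2 * N).+1).
have e : upfacing (KZ (nbr (Posz X, Posz (2 * N).+4) dE)) dE = g_null.
  by rewrite nbrE up_even_dE // mul2n odd_double.
have w : upfacing (KZ (nbr (Posz X, Posz (2 * N).+4) dW)) dW =
    if X == 0 then g_null else g_t.
  case: X XW {s n e} => [|X] XW //; rewrite nbrW KZ_count //; last by lia.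
  rewrite countk_fin // /fink /cls; case: ifP => // _.
  rewrite ifF; last by apply/negP; lia.
  by case: ifP => // _; case: ifP.
apply: okcell_view n e s w _; rewrite /rowg /fink; case: (clsP XW).
- by case=> -> ->; vm_compute.
- by case=> -> ->; rewrite hp; vm_compute.
- case=> u [hu -> ->]; rewrite ifF; last by apply/negP; lia.
  (* After overflow all counter bits vanish, and 0 is the only bit that [k_Tb] accepts. *)
  suff -> : bitn (k - u) (v + N) = false by vm_compute.
  rewrite vN /bitn -expnB //; last by lia.
  by rewrite oddX orbF; apply/negP; lia.
- case.
    by case=> u [c [hc hu -> ->]]; rewrite ifF; [vm_compute | apply/negP; lia].
  case.
    by case=> c hc [-> ->]; rewrite ifF; [vm_compute | apply/negP; lia].
  by case=> e' ->; rewrite ifF; [vm_compute | apply/negP; rewrite /W in e'; lia].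
Qed.

Lemma count_ok r X : r < R -> X < W -> ok (Posz X, Posz r.+4).
Proof.
move=> rR XW; case: (rowP rR) => [->|[t tN ->]|[t tN ->]|[hp ->]].
- exact: conv_ok.
- exact: inc_ok.
- exact: ret_ok.
- exact: fin_ok.
Qed.

Lemma tip_ok c : c < 4 -> ok (Posz (5 * k + 6 + c), Posz 3).
Proof.
move=> c4; have XW : 5 * k + 6 + c < W by rewrite /W; lia.
rewrite /ok KZ_strip //.
have n : upfacing (KZ (nbr (Posz (5 * k + 6 + c), Posz 3) dN)) dN = g_null.
  by rewrite nbrN (@up_dN 0).
have e : upfacing (KZ (nbr (Posz (5 * k + 6 + c), Posz 3) dE)) dE =
    if c == 3 then g_null else g_ff.
  rewrite nbrE; case: eqP => [c3|c3].
    rewrite (_ : (5 * k + 6 + c).+1 = W) ?up_eastW //; rewrite /W; lia.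
  rewrite -addnS KZ_strip //; last by rewrite /W; lia.
  rewrite /stripk sword_tip.
  by case: (_.+1 == W); case: c c4 c3 {XW n} => [|[|[|[|]]]].
have s : upfacing (KZ (nbr (Posz (5 * k + 6 + c), Posz 3) dS)) dS =
    nth g_null [:: g_n2 false; g_h; g_null; g_gf] c.
  rewrite nbrS KZ_strip // /stripk sword_tip.
  by case: c c4 {XW n e} => [|[|[|[|]]]].
have w : upfacing (KZ (nbr (Posz (5 * k + 6 + c), Posz 3) dW)) dW = g_null.
  rewrite (_ : 5 * k + 6 + c = (5 * k + 5 + c).+1); last by lia.
  rewrite nbrW KZ_strip //; last by rewrite /W; lia.
  rewrite /stripk; case: c c4 {XW n e s} => [|c] c4.
    by rewrite (_ : 5 * k + 5 + 0 = 5 * k + 4 + 1) ?sword_unit //; lia.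
  rewrite (_ : 5 * k + 5 + c.+1 = 5 * k + 6 + c) ?sword_tip; last by lia.
  rewrite ifF; last by apply/negP; rewrite /W; lia.
  by case: c c4 => [|[|[|]]].
apply: okcell_view n e s w _; rewrite /stripk sword_tip.
have -> : ((5 * k + 6 + c).+1 == W) = (c == 3) by rewrite /W; lia.
by case: c c4 {XW} => [|[|[|[|]]]]; vm_compute.
Qed.

(** * The local condition in the southern and eastern blocks *)

Ltac ifs := repeat match goal with |- context [if ?b then _ else _] =>
  first [ rewrite (_ : b = true); last by lia | rewrite (_ : b = false); last by lia ] end.

Lemma W10 : 10 <= W. Proof. by rewrite /W; lia. Qed.

Lemma W_gt0 : 0 < W. Proof. by rewrite /W; lia. Qed.

Lemma south_dN d X : upfacing (Some (southk d X)) dN = if X == 5 + d then g_d' else g_e'.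
Proof.
rewrite /southk; case: (ltnP X (4 + d)) => lt.
  rewrite (_ : (X == 5 + d) = false); last by lia.
  by case: (eqVneq d 0) lt => // -> lt; case: X lt => [|[|[|[|X]]]].
case: (eqVneq X (4 + d)) => [e|_]; last by case: ifP.
by rewrite (_ : (X == 5 + d) = false); [case: ifP | lia].
Qed.

Lemma south_dE d X : 0 < X -> upfacing (Some (southk d X)) dE =
  if (0 < d) && (X <= 4 + d) then g_l' else g_null.
Proof.
move=> X0; rewrite /southk; case: (posnP d) => [->|d0].
  by case: X X0 => [|[|[|[|[|[|X]]]]]].
case: (ltnP X (4 + d)) => lt; first by ifs.
case: (eqVneq X (4 + d)) => [e|n]; first by ifs.
rewrite (_ : (X <= 4 + d) = false); last by lia.
by rewrite andbF; case: ifP.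
Qed.

Lemma south_dS d X : upfacing (Some (southk d.+1 X)) dS = g_null.
Proof.
by rewrite /southk; case: (X < _); case: (X == 4 + _); case: (X == 5 + _).
Qed.

Lemma south_dW d X : upfacing (Some (southk d X)) dW =
  if X < 4 + d then if d == 0 then nth g_null [:: g_k1; g_k2; g_k3; g_k4] X else g_null
  else if X == 4 + d then g_d1' else g_e.
Proof.
rewrite /southk; case: ifP => lt.
  case: ifP => [/eqP d0|//]; rewrite d0 in lt.
  by case: X lt => [|[|[|[|]]]].
by case: ifP => _; case: ifP.
Qed.

Lemma south_ok d X : d < W - 4 -> X < W -> ok (Posz X, Negz d).
Proof.
move=> hd XW; have w10 := W10; rewrite /ok KZ_south //.
have n : upfacing (KZ (nbr (Posz X, Negz d) dN)) dN =
    if d == 0 then if X == 0 then g_gk else g_e' else if X == 4 + d then g_d' else g_e'.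
  case: d hd => [|d] hd; last first.
    by rewrite nbrNn KZ_south ?south_dN //; lia.
  rewrite nbrNn0 KZ_strip //; case: (eqVneq X 0) => [->|X0] //.
  by rewrite stripk_bottom //; lia.
have e : upfacing (KZ (nbr (Posz X, Negz d) dE)) dE =
    if (0 < d) && (X < 4 + d) then g_l' else g_null.
  rewrite nbrE; have [e|ne] := eqVneq X.+1 W.
    by rewrite e up_eastW ifF //; apply/negP; lia.
  by rewrite KZ_south ?south_dE //; lia.
have s : upfacing (KZ (nbr (Posz X, Negz d) dS)) dS = g_null.
  rewrite nbrSn; have [lt|ge] := ltnP d.+1 (W - 4); last by rewrite KZ_bottom.
  by rewrite KZ_south // south_dS.
have w : upfacing (KZ (nbr (Posz X, Negz d) dW)) dW =
    if X is X'.+1 then if X' < 4 + d then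
      if d == 0 then nth g_null [:: g_k1; g_k2; g_k3; g_k4] X' else g_null
      else if X' == 4 + d then g_d1' else g_e
    else g_null.
  case: X XW {n e s} => [|X] XW //; rewrite nbrW KZ_south ?south_dW //; lia.
apply: okcell_view n e s w _; rewrite /southk.
case: (posnP d) => [->|d0].
  by case: X XW => [|[|[|[|[|[|X]]]]]] XW; vm_compute.
case: X XW => [|X] XW; first by ifs; vm_compute.
have [lt|] := ltnP X.+1 (4 + d); first by ifs; vm_compute.
rewrite leq_eqVlt => /orP[e|lt]; first by ifs; vm_compute.
by have [e|n] := eqVneq X.+1 (5 + d); ifs; vm_compute.
Qed.

Lemma east_dN m j : upfacing (Some (eastk m j)) dN = if j <= 4 + m then g_l else g_null.
Proof.
rewrite /eastk; case: (ltnP j (4 + m)) => lt; first by ifs.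
case: (eqVneq j (4 + m)) => [e|n]; first by ifs.
by rewrite (_ : (j <= 4 + m) = false); [case: ifP | lia].
Qed.

Lemma east_dS m j : upfacing (Some (eastk m j)) dS =
  if j < 4 + m then g_null else if j == 4 + m then g_d1 else g_u.
Proof. by rewrite /eastk; case: ifP => // _; case: ifP => // _; case: ifP. Qed.

Lemma east_dW m j : upfacing (Some (eastk m j)) dW = if j == 5 + m then g_d else g_e.
Proof.
rewrite /eastk; case: (ltnP j (4 + m)) => lt; first by ifs.
case: (eqVneq j (4 + m)) => [e|n]; first by ifs.
by case: ifP.
Qed.

Lemma count_dW r : r < R -> upfacing (Some (countk r W.-1)) dW = if r == 0 then g_d else g_e.
Proof.
move=> rR; have -> : countk r W.-1 = if r == 0 then k_CE else if odd r then k_IE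
    else if r < 2 * N then k_RE else k_TE.
  rewrite /countk /convk /inck /retk /fink.
  have -> // : cls W.-1 = cEast.
  by rewrite /cls; have w10 := W10; ifs.
by case: ifP => // _; case: ifP => // _; case: ifP.
Qed.

Lemma up_east_dW m j : m < R -> j < R.+4 ->
  upfacing (KZ (nbr (Posz (W + m), Posz j) dW)) dW = if j == 4 + m then g_d else g_e.
Proof.
move=> mR jR; have w10 := W10; case: m mR => [|m] mR.
  rewrite addn0 -{1}(prednK W_gt0) nbrW.
  case: (ltnP j 4) => j4; first by rewrite KZ_strip ?stripk_east //; [ifs | lia].
  rewrite (_ : (j == 4 + 0) = (j - 4 == 0)); last by lia.
  rewrite {1}(_ : j = (j - 4).+4) ?KZ_count ?count_dW //; lia.
rewrite addnS nbrW KZ_east ?east_dW //; lia.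
Qed.

Lemma east_ok m j : m < R -> j < R.+4 -> ok (Posz (W + m), Posz j).
Proof.
move=> mR jR; rewrite /ok KZ_east //.
have n : upfacing (KZ (nbr (Posz (W + m), Posz j) dN)) dN =
    if j < 4 + m then g_l else g_null.
  rewrite nbrN; have [lt|ge] := ltnP j.+1 R.+4; first by rewrite KZ_east // east_dN.
  by rewrite KZ_top //; ifs.
have e : upfacing (KZ (nbr (Posz (W + m), Posz j) dE)) dE = g_null.
  by rewrite nbrE -addnS up_east.
have s : upfacing (KZ (nbr (Posz (W + m), Posz j) dS)) dS =
    if j <= 4 + m then g_null else if j == 5 + m then g_d1 else g_u.
  case: j jR {n e} => [|j] jR.
    rewrite nbrS0 KZ_east' //; last by rewrite /W; lia.
    by case: ifP.
  by rewrite nbrS KZ_east ?east_dS //; lia.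
have w := up_east_dW mR jR.
apply: okcell_view n e s w _; rewrite /eastk.
have [lt|] := ltnP j (4 + m); first by ifs; vm_compute.
rewrite leq_eqVlt => /orP[e'|lt]; first by ifs; vm_compute.
by have [e'|n'] := eqVneq j (5 + m); ifs; vm_compute.
Qed.

Lemma east_ok' m d : m < R -> d < W - 4 -> ok (Posz (W + m), Negz d).
Proof.
move=> mR hd; have w10 := W10; rewrite /ok KZ_east' //.
have n : upfacing (KZ (nbr (Posz (W + m), Negz d) dN)) dN = g_l.
  case: d hd => [|d] hd.
    by rewrite nbrNn0 KZ_east // east_dN; ifs.
  rewrite nbrNn KZ_east' //; last by lia.
  by rewrite (_ : (d.+1 == W - 4) = false) ?andbF //; lia.
have e : upfacing (KZ (nbr (Posz (W + m), Negz d) dE)) dE = g_null.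
  by rewrite nbrE -addnS up_east.
have s : upfacing (KZ (nbr (Posz (W + m), Negz d) dS)) dS = g_null.
  rewrite nbrSn; have [lt|ge] := ltnP d.+1 (W - 4); last by rewrite KZ_bottom.
  by rewrite KZ_east' //; case: ifP.
have w : upfacing (KZ (nbr (Posz (W + m), Negz d) dW)) dW =
    if (m == 0) && (d.+1 == W - 4) then g_d1' else g_e.
  case: m mR {n e s} => [|m] mR.
    rewrite addn0 -{1}(prednK W_gt0) nbrW KZ_south // ?south_dW; last by lia.
    rewrite (_ : (W.-1 < 4 + d) = false); last by lia.
    by rewrite (_ : (W.-1 == 4 + d) = (d.+1 == W - 4)); last by lia.
  rewrite addnS nbrW KZ_east' //; last by lia.
  by case: ((m == 0) && (d.+1 == W - 4)).
apply: okcell_view n e s w _.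
by case: ((m == 0) && (d.+1 == W - 4)); vm_compute.
Qed.

(** * The surroundings of the square *)

Lemma quiet_ok p n e s w : KZ p = None ->
  upfacing (KZ (nbr p dN)) dN = n -> upfacing (KZ (nbr p dE)) dE = e ->
  upfacing (KZ (nbr p dS)) dS = s -> upfacing (KZ (nbr p dW)) dW = w ->
  gl_str n + gl_str e + gl_str s + gl_str w < 7 -> ok p.
Proof.
move=> kp hn he hs hw q; rewrite /ok kp.
by apply: okcell_view hn he hs hw _; apply: okview_quiet.
Qed.

Lemma left_dE y : gl_str (upfacing (KZ (Posz 0, y)) dE) < 7.
Proof.
have w0 := W_gt0; case: y => [j|d].
  have [j4|ge] := ltnP j 4.
    by rewrite KZ_strip //; case: j j4 => [|[|[|[|]]]].
  rewrite (_ : j = (j - 4).+4); last by lia.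
  have [lt|ge'] := ltnP (j - 4) R; last by rewrite KZ_top.
  rewrite KZ_count // /countk /convk /inck /retk /fink -[cls 0]/cWest.
  by case: (_ == 0); case: (odd _); case: (_./2 < N); case: (_ < 2 * N).
have [lt|ge] := ltnP d (W - 4); last by rewrite KZ_bottom.
by rewrite KZ_south // /southk; case: (d == 0).
Qed.

Lemma left_ok a y : ok (Negz a, y).
Proof.
apply: (@quiet_ok _ g_null (upfacing (KZ (nbr (Negz a, y) dE)) dE) g_null g_null) => //.
rewrite add0n !addn0; case: a => [|a]; first exact: (left_dE y).
by have -> : nbr (Negz a.+1, y) dE = (Negz a, y) by congr pair => /=; lia.
Qed.

Lemma right_ok X y : W + R <= X -> ok (Posz X, y).
Proof.
move=> h; have [X0 w10] := (W_gt0, W10); case: X h => [|X] h; first by lia.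
apply: (@quiet_ok _ g_null g_null g_null (upfacing (KZ (Posz X, y)) dW)).
- exact: KZ_right.
- by rewrite /nbr KZ_right.
- by rewrite nbrE KZ_right //; lia.
- by rewrite /nbr KZ_right.
- by rewrite nbrW.
rewrite !add0n; have [lt|ge] := leqP (W + R) X; first by rewrite KZ_right.
have -> : X = W + R.-1 by have := R_gt0; lia.
have rR : R.-1 < R by have := R_gt0; lia.
case: y => [j|d].
  have [lt|ge'] := ltnP j R.+4; last by rewrite KZ_top.
  (* In the last column the tile [k_U1], which would continue the diagonal by [g_d], falls above the
     square. *)
  rewrite KZ_east // east_dW ifF //; apply/negP; lia.
have [lt|ge'] := ltnP d (W - 4); last by rewrite KZ_bottom.
by rewrite KZ_east' //; case: ifP.
Qed.

(** The top row of the counter is the closing row or the last increment; the latter shows only glues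
    of strength 6, and [k_IWz false] shows none. *)
Lemma top_dS X : gl_str (upfacing (KZ (Posz X, Posz R.+3)) dS) < 7.
Proof.
have [XW|WX] := ltnP X W.
  rewrite -[R.+3](_ : (R.-1).+4 = _); last by have := R_gt0; lia.
  rewrite KZ_count //; last by have := R_gt0; lia.
  case: (boolP pb) => hp.
    have -> : R.-1 = 2 * N by rewrite /R hp; lia.
    by rewrite countk_fin /fink; case: (cls X).
  have -> : R.-1 = (2 * N.-1).+1 by rewrite /R (negbTE hp); lia.
  rewrite countk_inc /inck; case: (cls X) => //.
  by rewrite prednK // ltnn (negbTE hp).
have [lt|ge] := ltnP (X - W) R; last by rewrite KZ_right //; lia.
rewrite -(subnKC WX) KZ_east // east_dS.
by case: ifP => // _; case: ifP.
Qed.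

Lemma top_ok X j : R.+4 <= j -> ok (Posz X, Posz j).
Proof.
case: j => // j h.
apply: (@quiet_ok _ g_null g_null (upfacing (KZ (Posz X, Posz j)) dS) g_null).
- exact: KZ_top.
- by rewrite nbrN KZ_top //; lia.
- by rewrite nbrE KZ_top.
- by rewrite nbrS.
- by case: X => [|X]; rewrite ?nbrW ?KZ_top.
rewrite !add0n addn0; have [lt|ge] := ltnP j R.+4; last by rewrite KZ_top.
have -> : j = R.+3 by lia.
exact: top_dS.
Qed.

(** The strong glue [g_d'] belongs to [k_U1'], which in the last row would stand in column [W],
    outside this block. *)
Lemma bottom_dN X : gl_str (upfacing (KZ (Posz X, Negz (W - 5))) dN) < 7.
Proof.
have w10 := W10; have [XW|WX] := ltnP X W.
  rewrite KZ_south // ?south_dN; last by lia.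
  by rewrite (_ : (X == 5 + (W - 5)) = false); last by lia.
have [lt|ge] := ltnP (X - W) R; last by rewrite KZ_right //; lia.
rewrite -(subnKC WX) KZ_east' //; last by lia.
by case: ifP.
Qed.

Lemma bottom_ok X d : W - 4 <= d -> ok (Posz X, Negz d).
Proof.
have w10 := W10; case: d => [|d] h; first by lia.
apply: (@quiet_ok _ (upfacing (KZ (Posz X, Negz d)) dN) g_null g_null g_null).
- exact: KZ_bottom.
- by rewrite nbrNn.
- by rewrite nbrE KZ_bottom.
- by rewrite nbrSn KZ_bottom //; lia.
- by case: X => [|X]; rewrite ?nbrW ?KZ_bottom.
rewrite !addn0; have [lt|ge] := ltnP d (W - 4); last by rewrite KZ_bottom.
have -> : d = W - 5 by lia.
exact: bottom_dN.
Qed.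

(** * The cells filled in the last phase *)

Let KA := kw sword.

Lemma KA_E X j : KA (Posz X, Posz j) = cell (nth C_0 sword X) j.
Proof. by []. Qed.

Lemma size_sword : size sword = W.
Proof. by rewrite size_word size_bits /W; lia. Qed.

Lemma KA_bound X j q : KA (Posz X, Posz j) = Some q -> X < W /\ j < 4.
Proof.
rewrite KA_E => h; split; rewrite ltnNge; apply/negP => ge.
  by rewrite nth_default ?size_sword // cell0 in h.
by rewrite cell_big in h.
Qed.

Lemma new_ok p : KA p = None -> ok p.
Proof.
case: p => -[X|a] y; last by rewrite left_ok.
have [WX|XW] := leqP W X.
  have [lt|ge] := ltnP (X - W) R; last by rewrite right_ok //; lia.
  rewrite -(subnKC WX); case: y => [j|d].
    by have [jR|jR] := ltnP j R.+4; [rewrite east_ok | rewrite top_ok].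
  by have [hd|hd] := ltnP d (W - 4); [rewrite east_ok' | rewrite bottom_ok].
case: y => [j|d]; last first.
  by have [hd|hd] := ltnP d (W - 4); [rewrite south_ok | rewrite bottom_ok].
have [j4|j4] := ltnP j 4.
  rewrite KA_E => h; have [-> [c c4 ->]] := cell_sword_None XW j4 h.
  by rewrite tip_ok.
have [jR|jR] := ltnP j R.+4; last by rewrite top_ok.
by rewrite (_ : j = (j - 4).+4); [rewrite count_ok //; lia | lia].
Qed.
Inductive new_cell : pos -> kind -> Prop :=
  | NewTip c of c < 4 :
      new_cell (Posz (5 * k + 6 + c), Posz 3) (if c == 3 then k_fe else k_ff)
  | NewCount X r of X < W & r < R : new_cell (Posz X, Posz r.+4) (countk r X)
  | NewSouth X d of X < W & d < W - 4 : new_cell (Posz X, Negz d) (southk d X)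
  | NewEast m j of m < R & j < R.+4 : new_cell (Posz (W + m), Posz j) (eastk m j)
  | NewEast' m d of m < R & d < W - 4 : new_cell (Posz (W + m), Negz d)
      (if (m == 0) && (d.+1 == W - 4) then k_L0 else k_L).

Lemma new_cellP p q : KA p = None -> KZ p = Some q -> new_cell p q.
Proof.
case: p => -[X|//] y.
have [WX|XW] := leqP W X.
  have [lt|ge] := ltnP (X - W) R; last by rewrite KZ_right //; lia.
  rewrite -(subnKC WX) => _; case: y => [j|d].
    have [jR|jR] := ltnP j R.+4; last by rewrite KZ_top.
    by rewrite KZ_east // => -[<-]; constructor.
  have [hd|hd] := ltnP d (W - 4); last by rewrite KZ_bottom.
  by rewrite KZ_east' // => -[<-]; constructor.
case: y => [j|d]; last first.
  have [hd|hd] := ltnP d (W - 4); last by rewrite KZ_bottom.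
  by rewrite KZ_south // => _ [<-]; constructor.
have [j4|j4] := ltnP j 4.
  rewrite KA_E => h; rewrite KZ_strip // => -[<-].
  rewrite /stripk h; have [-> [c c4 ->]] := cell_sword_None XW j4 h.
  have -> : ((5 * k + 6 + c).+1 == W) = (c == 3) by rewrite /W; lia.
  by constructor.
have [jR|jR] := ltnP j R.+4; last by rewrite KZ_top.
rewrite (_ : j = (j - 4).+4) => [_|]; last by lia.
rewrite KZ_count //; last by lia.
by case=> <-; constructor => //; lia.
Qed.

(** * Order of attachment in the last phase *)

Definition bigr := W * W + R * W + W + 10.

(** Counter rows alternate their direction. In the blocks the two truncated differences add up to
    the distance to the diagonal, from which each row or column is filled; the first southern row
    runs eastward instead. [bigr] lifts the eastern block above its western neighbours. *)
Definition rank (p : pos) : nat :=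
  match p.1, p.2 with
  | Posz X, Posz j =>
      if X < W then if j < 4 then W.-1 - X
                    else 4 + (j - 4) * W + (if odd j then W.-1 - X else X)
      else bigr + (X - W) * (W + R + 10) + (j - (4 + (X - W))) + (4 + (X - W) - j)
  | Posz X, Negz d =>
      if X < W then d * W + (if d == 0 then X else X - (4 + d) + (4 + d - X))
      else bigr + (X - W) * (W + R + 10) + (d + 5 + (X - W))
  | _, _ => 0
  end.

Lemma rank_tip X j : X < W -> j < 4 -> rank (Posz X, Posz j) = W.-1 - X.
Proof. by rewrite /rank /= => -> ->. Qed.

Lemma rank_count X r : X < W ->
  rank (Posz X, Posz r.+4) = 4 + r * W + (if odd r then W.-1 - X else X).
Proof. by rewrite /rank /= => ->; rewrite !negbK !subSS subn0. Qed.

Lemma rank_south X d : X < W -> rank (Posz X, Negz d) =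
  d * W + (if d == 0 then X else X - (4 + d) + (4 + d - X)).
Proof. by rewrite /rank /= => ->. Qed.

Lemma rank_east m j : rank (Posz (W + m), Posz j) =
  bigr + m * (W + R + 10) + (j - (4 + m)) + (4 + m - j).
Proof. by rewrite /rank /= ifF ?addKn //; lia. Qed.

Lemma rank_east' m d : rank (Posz (W + m), Negz d) =
  bigr + m * (W + R + 10) + (d + 5 + m).
Proof. by rewrite /rank /= ifF ?addKn //; lia. Qed.

Lemma rank_south_lt X d : X < W -> d < W - 4 -> rank (Posz X, Negz d) < d.+1 * W.
Proof.
move=> XW hd; rewrite rank_south // mulSn [_ + d * W]addnC ltn_add2l.
by case: ifP => // _; lia.
Qed.

Lemma rank_count_lt X r : X < W -> rank (Posz X, Posz r.+4) < 4 + r.+1 * W.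
Proof.
move=> XW; rewrite rank_count // mulSn [W + _]addnC addnA ltn_add2l.
by case: ifP => // _; lia.
Qed.

Lemma rank_low y : isSome (KZ (Posz W.-1, y)) -> rank (Posz W.-1, y) < bigr.
Proof.
have w10 := W10; have XW : W.-1 < W by lia.
case: y => [j|d] h; rewrite /bigr.
  have [j4|j4] := ltnP j 4; first by rewrite rank_tip //; lia.
  have jR : j - 4 < R.
    by rewrite ltnNge; apply/negP => ge; move: h; rewrite KZ_top //; lia.
  rewrite (_ : j = (j - 4).+4); last by lia.
  have := rank_count_lt (j - 4) XW; have : (j - 4).+1 * W <= R * W by rewrite leq_mul2r jR orbT.
  by lia.
have hd : d < W - 4 by rewrite ltnNge; apply/negP => ge; move: h; rewrite KZ_bottom.
have := rank_south_lt XW hd; have : d.+1 * W <= W * W by rewrite leq_mul2r; lia.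
by lia.
Qed.

Lemma inp_count r X d : X < W -> inpk (countk r X) d ->
  match d with
  | dN => false | dS => true | dW => ~~ odd r && (0 < X) | dE => odd r && (X.+1 < W)
  end.
Proof.
move=> XW; rewrite /countk /convk /inck /retk /fink.
case: (clsP XW).
- case=> -> ->; case: (eqVneq r 0) => [->|_]; first by case: d.
  by case: (odd r); case: (_ < N); case: (_ < 2 * N); case: d => // _; rewrite /W; lia.
- case=> -> ->; case: (eqVneq r 0) => [->|_]; first by case: d.
  by case: (odd r); case: (_ < 2 * N); case: d => // _; rewrite /W; lia.
- case=> u [hu -> ->]; case: (eqVneq r 0) => [->|_]; first by case: d => // _; lia.
  by case: (odd r); case: (_ < 2 * N); case: d => // _; rewrite /W; lia.
- case.
    case=> u [c [hc hu -> ->]]; case: (eqVneq r 0) => [->|_]; first by case: d => // _; lia.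
    by case: (odd r); case: (_ < 2 * N); case: d => // _; rewrite /W; lia.
  case.
    case=> c hc [-> ->]; case: (eqVneq r 0) => [->|_]; first by case: d => // _; lia.
    by case: (odd r); case: (_ < 2 * N); case: d => // _; rewrite /W; lia.
  case=> e ->; have w10 := W10; case: (eqVneq r 0) => [->|_]; first by case: d => // _; lia.
  by case: (odd r); case: (_ < 2 * N); case: d => // _; lia.
Qed.

Lemma KA_top X : X < W -> isSome (KA (Posz X, Posz 3)) \/ rank (Posz X, Posz 3) < 4.
Proof.
move=> XW; rewrite KA_E; case e: (cell _ _) => [q|]; first by left.
right; rewrite rank_tip //; have [_ [c c4 ->]] := cell_sword_None XW (isT : 3 < 4) e.
by rewrite /W; lia.
Qed.

Lemma KA_row X j : X < W -> j < 3 -> isSome (KA (Posz X, Posz j)).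
Proof.
move=> XW j3; rewrite KA_E; case e: (cell _ _) => [q|] //.
by have [ej _] := cell_sword_None XW (ltnW j3) e; rewrite ej in j3.
Qed.

Lemma count_rank X r d : X < W -> r < R -> inpk (countk r X) d ->
  isSome (KA (nbr (Posz X, Posz r.+4) d)) \/
  rank (nbr (Posz X, Posz r.+4) d) < rank (Posz X, Posz r.+4).
Proof.
move=> XW rR /(inp_count XW); case: d => //.
- case/andP=> or lt; right; rewrite nbrE !rank_count //.
  by rewrite or; lia.
- move=> _; rewrite nbrS; case: r rR => [|r] rR.
    by have [h|h] := KA_top XW; [left | right; apply: leq_trans h _; rewrite rank_count // -addnA leq_addr].
  right; apply: leq_trans (rank_count_lt r XW) _.
  by rewrite [rank (_, Posz r.+1.+4)]rank_count // leq_addr.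
- case/andP=> er; case: X XW => // X XW _; right; rewrite nbrW !rank_count //; last by lia.
  by rewrite (negbTE er); lia.
Qed.

Lemma south_rank X d d' : X < W -> d < W - 4 -> inpk (southk d X) d' ->
  isSome (KA (nbr (Posz X, Negz d) d')) \/
  rank (nbr (Posz X, Negz d) d') < rank (Posz X, Negz d).
Proof.
move=> XW hd.
have hN : isSome (KA (nbr (Posz X, Negz d) dN)) \/
    rank (nbr (Posz X, Negz d) dN) < rank (Posz X, Negz d).
  case: d hd => [|d] hd; first by left; rewrite nbrNn0 KA_row.
  right; rewrite nbrNn.
  have hd' : d < W - 4 by lia.
  by have := rank_south_lt XW hd'; rewrite [rank (_, Negz d.+1)]rank_south //=; lia.
have hW : (d == 0) || (4 + d < X) -> 0 < X ->
    isSome (KA (nbr (Posz X, Negz d) dW)) \/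
    rank (nbr (Posz X, Negz d) dW) < rank (Posz X, Negz d).
  case: X XW {hN} => // X XW h _; right; rewrite nbrW !rank_south //; last by lia.
  by case: (eqVneq d 0) h => //= _ h; lia.
rewrite /southk; case: (ltnP X (4 + d)) => lt.
  case: (eqVneq d 0) lt => [d0 lt|d0 lt] i.
    have [X0|X0] := posnP X.
      by rewrite X0 d0 in i hN *; case: d' i.
    have dw : d' = dW.
      by rewrite d0 in lt; case: X X0 lt i {XW hN hW} => [|[|[|[|]]]] //; case: d'.
    by rewrite dw; apply: hW; rewrite ?d0.
  case: d' i => // _; right; rewrite nbrE !rank_south //; last by lia.
  by rewrite (negbTE d0); lia.
case: (eqVneq X (4 + d)) lt => [e _|n lt].
  case: (eqVneq d 0) => d0 i; last by case: d' i.
  have dw : d' = dW by case: d' i.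
  by rewrite dw; apply: hW; rewrite ?d0 //; lia.
have lt' : 4 + d < X by lia.
by case: ifP => _; case: d' => // _; apply: hW; rewrite ?lt' ?orbT //; lia.
Qed.

Lemma east_rank m j d : m < R -> j < R.+4 -> inpk (eastk m j) d ->
  rank (nbr (Posz (W + m), Posz j) d) < rank (Posz (W + m), Posz j).
Proof.
move=> mR jR.
have hW : rank (nbr (Posz (W + m), Posz j) dW) < rank (Posz (W + m), Posz j).
  case: m mR => [|m] mR.
    rewrite [rank (_, Posz j)]rank_east addn0 -{1}(prednK W_gt0) nbrW.
    apply: leq_trans (rank_low _) _; last by lia.
    have w10 := W10; have [j4|j4] := ltnP j 4; first by rewrite KZ_strip //; lia.
    by rewrite (_ : j = (j - 4).+4) ?KZ_count //; lia.
  by rewrite addnS nbrW -addnS !rank_east mulSn; lia.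
rewrite /eastk; case: (ltnP j (4 + m)) => lt.
  by case: d => // _; rewrite nbrN !rank_east; lia.
case: (eqVneq j (4 + m)) lt => [e _|n lt]; first by case: d.
case: j jR hW n lt => // j jR hW n lt.
by case: ifP => _; case: d => // _; rewrite nbrS !rank_east; lia.
Qed.

Lemma east_rank' m e d : m < R -> e < W - 4 ->
  inpk (if (m == 0) && (e.+1 == W - 4) then k_L0 else k_L) d ->
  rank (nbr (Posz (W + m), Negz e) d) < rank (Posz (W + m), Negz e).
Proof.
move=> mR he.
have hW : rank (nbr (Posz (W + m), Negz e) dW) < rank (Posz (W + m), Negz e).
  case: m mR => [|m] mR.
    rewrite [rank (_, Negz e)]rank_east' addn0 -{1}(prednK W_gt0) nbrW.
    apply: leq_trans (rank_low _) _; last by lia.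
    by have w10 := W10; rewrite KZ_south //; lia.
  by rewrite addnS nbrW -addnS !rank_east' mulSn; lia.
have hN : rank (nbr (Posz (W + m), Negz e) dN) < rank (Posz (W + m), Negz e).
  case: e he {hW} => [|e] he; rewrite ?nbrNn0 ?nbrNn !rank_east' ?rank_east; lia.
by case: ifP => _; case: d.
Qed.

Lemma origin_E : origin = (Posz 0, Posz 0). Proof. by []. Qed.

Definition square_box := [seq (Posz a, Posz b) | a <- iota 0 (W + R), b <- iota 0 R.+4] ++
  [seq (Posz a, Negz b) | a <- iota 0 (W + R), b <- iota 0 (W - 4)].

Lemma KZ_shape X (y : int) : isSome (KZ (Posz X, y)) =
  (X < W + R) && match y with Posz j => j < R.+4 | Negz d => d < W - 4 end.
Proof.
have [ge|lt] := leqP (W + R) X; first by rewrite KZ_right.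
have [XW|WX] := ltnP X W; case: y => [j|d] /=.
- have [j4|j4] := ltnP j 4; first by rewrite KZ_strip //=; lia.
  have [jR|jR] := ltnP j R.+4; last by rewrite KZ_top.
  by rewrite (_ : j = (j - 4).+4) ?KZ_count //; lia.
- by have [hd|hd] := ltnP d (W - 4); [rewrite KZ_south | rewrite KZ_bottom].
- have [jR|jR] := ltnP j R.+4; last by rewrite KZ_top.
  by rewrite -(subnKC WX) KZ_east //; lia.
- have [hd|hd] := ltnP d (W - 4); last by rewrite KZ_bottom.
  by rewrite -(subnKC WX) KZ_east' //; lia.
Qed.

Lemma KZ_box p : isSome (KZ p) -> p \in square_box.
Proof.
case: p => -[X|//] y; rewrite KZ_shape mem_cat => /andP[XW hy].
case: y hy => [j|d] hy; apply/orP; [left|right]; apply/allpairsP.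
  by exists (X, j); rewrite !mem_iota.
by exists (X, d); rewrite !mem_iota.
Qed.

Theorem final_phase i :
  stable 7 (conf bits Sweak Sweak) ->
  phase_yields i 7 (conf bits Sweak Sweak) (kconf KZ) /\ stable 7 (kconf KZ).
Proof.
move=> sA; apply: (@kgrow i 7 KA KZ rank square_box) => //.
- case=> x y q Ap; have [|X [j e]] := @kw_cases sword (x, y); first by rewrite -/KA Ap.
  rewrite {}e in Ap *; have [XW j4] := KA_bound Ap.
  by rewrite KZ_strip // /stripk -KA_E Ap.
- exact: KZ_box.
- by move=> p q d; apply: kw_closed; [apply: chained_word | apply: allin_word].
- exact: new_ok.
- move=> p q d Ap Zp; case: (new_cellP Ap Zp) => [c c4|X r XW rR|X e XW he|m j mR jR|m e mR he].
  + have XW : 5 * k + 6 + c < W by rewrite /W; lia.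
    case: eqP => [c3|c3]; case: d => // _; first by left; rewrite nbrS KA_row.
    by right; rewrite nbrE !rank_tip //; rewrite /W; lia.
  + exact: count_rank.
  + exact: south_rank.
  + by right; apply: east_rank.
  + by right; apply: east_rank'.
- move=> p q Ap Zp; case: (new_cellP Ap Zp) => [c c4|X r XW rR|X e XW he|m j mR jR|m e mR he].
  + by case: ifP.
  + by rewrite /countk /convk /inck /retk /fink; case: (cls X) => [||a|a|];
      do 3?[case: ifP => _].
  + rewrite /southk; case: ifP => _; last by case: ifP => _; case: ifP.
    by case: ifP => // _; case: X XW => [|[|[|[|X]]]] //=; rewrite nth_nil.
  + by rewrite /eastk; do 3?[case: ifP => _].
  + by case: ifP.
Qed.
End Final.

(** * Sequences of phases *)

Fixpoint run (ts : tile_system) i taus (A Z : config ts) : Prop :=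
  if taus is tau :: taus' then
    exists2 B, phase_yields i tau A B & run i.+1 taus' B Z
  else A = Z.

Lemma run_cat ts i s1 s2 (A B Z : config ts) :
  run i s1 A B -> run (i + size s1) s2 B Z -> run i (s1 ++ s2) A Z.
Proof.
elim: s1 i A => [|t s1 IH] i A /=; first by rewrite addn0 => ->.
by case=> C yC rC; rewrite addnS -addSn => rZ; exists C => //; apply: IH rC rZ.
Qed.

Lemma run_configs ts i taus (A Z : config ts) : run i taus A Z ->
  exists c : nat -> config ts, [/\ c 0 = A, c (size taus) = Z &
    forall j, j < size taus -> phase_yields (i + j) (nth 0 taus j) (c j) (c j.+1)].
Proof.
elim: taus i A => [|t taus IH] i A /=; first by move=> ->; exists (fun=> Z).
case=> B yB /IH [c [c0 cZ cs]]; exists (fun j => if j is j'.+1 then c j' else A).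
split=> // -[_|j lt]; first by rewrite addn0 c0.
by rewrite addnS -addSn; apply: cs.
Qed.

Lemma run_uniquely_assembles ts taus (Z : config ts) (Y : pred pos) :
  run 0 taus (seed_config ts) Z -> supertile Z -> shape Z =1 Y ->
  uniquely_assembles ts taus Y.
Proof.
case/run_configs => c [c0 cZ cs] sZ hZ.
by apply: (uniquely_assembles_phases c0 cs); rewrite cZ.
Qed.

(** Pulses rely on removal, which phase 0 forbids. *)
Lemma run_bits bs bits i : 0 < i ->
  run i (flatten [seq [:: 11 + nat_of_bool b; 8] | b <- bs])
    (conf bits Sweak Sweak) (conf (bits ++ bs) Sweak Sweak).
Proof.
elim: bs bits i => [|b bs IH] bits i i0 /=; first by rewrite cats0.
exists (conf bits (if b then Sstrong else Sweak) Sstrong); first exact: pulse.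
exists (conf (rcons bits b) Sweak Sweak); first by have [] := strip_step i.+1 bits b.
by rewrite -cat_rcons; apply: IH.
Qed.

(** * The square and the choice of its parameters *)

Section Square.

Variables (k v N : nat) (pb : bool).
Definition program :=
  8 :: flatten [seq [:: 11 + nat_of_bool b; 8] | b <- bits k v pb] ++ [:: 7].

Lemma size_program : size program = 2 * k + 4.
Proof.
have e s : size (flatten [seq [:: 11 + nat_of_bool b; 8] | b <- s]) = 2 * size s.
  by elim: s => //= b s ->; lia.
rewrite -[LHS]/(size (flatten [seq [:: 11 + nat_of_bool b; 8] | b <- bits k v pb]
  ++ [:: 7])).+1.
by rewrite size_cat e size_bits /=; lia.
Qed.

Hypothesis N0 : 0 < N.
Hypothesis vN : v + N = 2 ^ k.

Lemma program_run :
  run 0 program (seed_config sys) (kconf (KZ k v N pb)).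
Proof.
exists (conf [::] Sweak Sweak); first by have [] := strip_start.
apply: run_cat; first exact: run_bits.
rewrite cat0s /=; exists (kconf (KZ k v N pb)) => //.
exact: (proj1 (@final_phase k v N pb N0 vN _ (stable_le (isT : 7 <= 8) (@cf_stable _ _ _)))).
Qed.

Lemma KZ_supertile : supertile (kconf (KZ k v N pb)).
Proof.
have [_ st] := @final_phase k v N pb N0 vN 0 (stable_le (isT : 7 <= 8) (@cf_stable _ _ _)).
pose D := seq_fset tt [seq p <- square_box k N pb | isSome (KZ k v N pb p)].
apply: (@stable_supertile _ 7 _ D) => //.
  by rewrite shape_kconf origin_E KZ_shape /W; lia.
move=> p; rewrite shape_kconf seq_fsetE mem_filter andb_idr //.
exact: KZ_box.
Qed.

(** The seed is in the first column, above the [W - 4 = 5k + 6] southern rows; the heights [W - 4],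
    4 and [R] add up to the width [W + R]. *)
Lemma square_assembled n : n = 5 * k + 10 + 2 * N + pb ->
  uniquely_assembles sys program (square n (0, - (5 * k + 6)%:Z)%R).
Proof.
move=> en; apply: run_uniquely_assembles program_run KZ_supertile _.
move=> [x y]; rewrite shape_kconf /square /= en; case: x => [X|X]; last by [].
by rewrite KZ_shape /R /W; case: y => [j|d]; lia.
Qed.

End Square.

(** Take the least [k > 1] whose interval of sides has its upper end at [n] or beyond. If [k > 2],
    the interval of [k - 1] ends before [n], that is, [5 (k - 1) + 11 + 2^k < n]; this gives both
    the lower end of the interval of [k] and [2^k <= n]. *)
Lemma counter_size n : 22 <= n -> exists k N (pb : bool),
  [/\ n = 5 * k + 10 + 2 * N + pb, 0 < N <= 2 ^ k & 1 < k <= trunc_log 2 n].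
Proof.
move=> n22.
have ex : exists k, (1 < k) && (n <= 5 * k + 11 + 2 ^ k.+1).
  by exists n; apply/andP; split; [lia | have := ltn_expl n (isT : 1 < 2); lia].
case: (ex_minnP ex) => k /andP[k1 le] min.
have [lo klog] : 5 * k + 12 <= n /\ k <= trunc_log 2 n.
  (* For [k = 2] there is no smaller candidate; the lower end [5 * 2 + 12 = 22] is the hypothesis on
     [n]. *)
  have [k2|k2] := leqP k 2.
    have -> : k = 2 by lia.
    by split=> //; apply: trunc_log_max => //; lia.
  have : ~~ ((1 < k.-1) && (n <= 5 * k.-1 + 11 + 2 ^ k.-1.+1)).
    by apply/negP => /min; lia.
  rewrite prednK; last by lia.
  have k8 : 2 ^ 3 <= 2 ^ k by rewrite leq_exp2l.
  move=> h; split; first by lia.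
  by apply: trunc_log_max => //; lia.
exists k, (n - (5 * k + 10))./2, (odd (n - (5 * k + 10))).
by rewrite expnS in le; split; [lia | lia | rewrite k1 klog].
Qed.

Theorem theorem1 :
  exists (c : nat) (ts : tile_system) (C : nat),
    forall n : nat, 22 <= n ->
      exists taus : seq nat,
        [/\ size taus <= C * trunc_log 2 n,
            forall tau, tau \in taus -> 0 < tau <= c &
            exists o : pos, uniquely_assembles ts taus (square n o)].
Proof.
(* 12 is the highest temperature used; the [2k + 4] phases are at most [4k], since [k] is at least
   2. *)
exists 12, sys, 4 => n /counter_size [k [N [pb [en /andP[N0 Nk] /andP[k1 klog]]]]].
have vN : 2 ^ k - N + N = 2 ^ k by rewrite subnK.
exists (program k (2 ^ k - N) pb); split; last first.
- by exists (0, - (5 * k + 6)%:Z)%R; apply: (square_assembled N0 vN en).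
- move=> tau; rewrite inE mem_cat mem_seq1 => /or3P[/eqP -> //||/eqP -> //].
  case/flattenP => s /mapP[b _ ->]; rewrite !inE => /orP[] /eqP -> //.
  by case: b.
by rewrite size_program; lia.
Qed.
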